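(* Let $\gamma>0$ and $(u_0,u_1)\in D(A)\times D(A^{1/2})$ with $u_0\ne0$. Then there exists $\varepsilon_0>0$ such that for every $\varepsilon\in(0,\varepsilon_0]$ the global solution $u_\varepsilon$ of $$\varepsilon u_\varepsilon''(t)+|A^{1/2}u_\varepsilon(t)|^{2\gamma}Au_\varepsilon(t)+u_\varepsilon'(t)=0\quad(t\ge0),\qquad u_\varepsilon(0)=u_0,\quad u_\varepsilon'(0)=u_1,$$ has the following property: there exists a non-zero vector $u_{\varepsilon,\infty}\in H_{\{\nu\}}$ such that, as $t\to+\infty$, $$(1+t)^{1/(2\gamma)}\bigl(u_\varepsilon(t),(1+t)u_\varepsilon'(t)\bigr)\to\Bigl(u_{\varepsilon,\infty},-\frac1{2\gamma}u_{\varepsilon,\infty}\Bigr)\quad\text{in }D(A)\times D(A^{1/2}).$$ Moreover the following hold. 1. There exist constants $K_{\varepsilon,1},K_{\varepsilon,2}>0$ such that for all $t\ge0$ $$\frac{K_{\varepsilon,1}}{1+t}\le e^{-2\nu^2\gamma B_\varepsilon(t)}\le\frac{K_{\varepsilon,2}}{1+t}.$$ Furthermore, if $u_{0,\nu}\ne0$, then $K_{\varepsilon,1}$ and $K_{\varepsilon,2}$ can be taken independent of $\varepsilon$. 2. As $t\to+\infty$, $$(1+t)b_\varepsilon(t)\to\frac1{2\nu^2\gamma},\qquad (1+t)^{1/\gamma}|u_{\varepsilon,\nu}(t)|^2\to\frac1{\nu^2(2\nu^2\gamma)^{1/\gamma}}.$$ 3. There exists a constant $K_\varepsilon$ such that for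 all $t\ge0$ $$|u_\varepsilon''(t)|^2\le K_\varepsilon\frac1{(1+t)^{4+1/\gamma}}.$$
   Context: $H$ is a real Hilbert space with norm $|\cdot|$ and scalar product $\langle\cdot,\cdot\rangle$. $A$ is a self-adjoint linear operator on $H$ with dense domain $D(A)$, coercive: $\langle Au,u\rangle\ge\sigma_0|u|^2$ for all $u\in D(A)$, for some $\sigma_0>0$. $H$ has a countable (orthonormal) basis $(e_k)_k$ of eigenvectors of $A$, $Ae_k=\lambda_k^2e_k$ with $\lambda_k>0$; for $u\in H$ write $u=\sum_k u_ke_k$, and write $u_{0,k},u_{1,k}$ for the components of $u_0,u_1$. Set $\nu:=\min\{\lambda_k:\ u_{0,k}\ne0\text{ or }u_{1,k}\neq 0\}$ (the minimum is understood to be attained). $H_{\{\nu\}}:=\{u\in H:u=\sum_{k:\lambda_k=\nu}u_ke_k\}$, and for $u\in H$ its component in $H_{\{\nu\}}$ is $u_\nu:=\sum_{k:\lambda_k=\nu}u_ke_k$; thus $u_{\varepsilon,\nu}(t)$ and $u_{0,\nu}$ are the components in $H_{\{\nu\}}$ of $u_\varepsilon(t)$ and $u_0$. Known fact (recalled from the literature): for $\varepsilon$ small the Cauchy problem has a unique global solution $u_\varepsilon\in C^2([0,+\infty),H)\cap C^1([0,+\infty),D(A^{1/2}))\cap C^0([0,+\infty),D(A))$, and there are constants $K_1,K_2>0$ independent of $\varepsilon$ such that for all $t\ge0$: $K_1(1+t)^{-1/\gamma}\le|A^{1/2}u_\varepsilon(t)|^2\le K_2(1+t)^{-1/\gamma}$,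 $K_1(1+t)^{-1/\gamma}\le|Au_\varepsilon(t)|^2\le K_2(1+t)^{-1/\gamma}$, $|u_\varepsilon'(t)|^2\le K_2(1+t)^{-2-1/\gamma}$. It is always assumed that $\varepsilon\le1$ is small enough for this to hold, and $u_\varepsilon$ denotes this solution. Define $b_\varepsilon(t):=|A^{1/2}u_\varepsilon(t)|^{2\gamma}$ and $B_\varepsilon(t):=\int_0^tb_\varepsilon(s)\,ds$. ''Independent of $\varepsilon$'' means the same constant works for all $\varepsilon\in(0,\varepsilon_0]$. *)

(* Defs.v *)
From Stdlib Require Import Reals.
From Coquelicot Require Export Coquelicot.

Set Implicit Arguments.
Unset Strict Implicit.
Unset Printing Implicit Defensive.

Open Scope R_scope.

Record RealHilbert : Type := {
  carrier :> CompleteNormedModule R_AbsRing;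
  ip : carrier -> carrier -> R;
  ip_sym : forall x y, ip x y = ip y x;
  ip_plus_l : forall x y z, ip (plus x y) z = ip x z + ip y z;
  ip_scal_l : forall (a : R) x y, ip (scal a x) y = a * ip x y;
  ip_norm : forall x, ip x x = norm x ^ 2
}.

(* Unbounded linear operators: [op] is a total function whose values outside
   [dom] are irrelevant. *)
Record operator (H : RealHilbert) : Type := {
  dom : H -> Prop;
  op :> H -> H;
  dom_zero : dom zero;
  dom_plus : forall x y, dom x -> dom y -> dom (plus x y);
  dom_scal : forall (a : R) x, dom x -> dom (scal a x);
  op_plus : forall x y, dom x -> dom y -> op (plus x y) = plus (op x) (op y);
  op_scal : forall (a : R) x, dom x -> op (scal a x) = scal a (op x)
}.

Section Operators.
Variable H : RealHilbert.
Implicit Types A S T : operator H.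

Definition densely_defined T : Prop :=
  forall (x : H) (d : R), 0 < d -> exists y, dom T y /\ norm (minus y x) < d.

(* T = T^*, domains included: the left-hand side of the equivalence says that
   v is in D(T^* ) with T^* v = w. *)
Definition self_adjoint T : Prop :=
  densely_defined T /\
  forall v w : H,
    (forall x, dom T x -> ip (T x) v = ip x w) <-> (dom T v /\ T v = w).

Definition coercive T : Prop :=
  exists sigma0 : R, 0 < sigma0 /\
    forall x, dom T x -> sigma0 * norm x ^ 2 <= ip (T x) x.

(* S = A^{1/2}: the (unique) nonnegative self-adjoint operator with S^2 = A,
   domains included. *)
Definition is_sqrt A S : Prop :=
  self_adjoint S /\
  (forall x, dom S x -> 0 <= ip (S x) x) /\
  (forall x, dom A x <-> (dom S x /\ dom S (S x))) /\
  (forall x, dom A x -> A x = S (S x)).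

(* Countable orthonormal basis. Null vectors are allowed in the enumeration,
   as padding, so that finite-dimensional spaces are covered too; a null e_k
   contributes neither coefficients nor terms to any expansion. *)
Definition orthonormal_basis (e : nat -> H) : Prop :=
  (forall j k, j <> k -> ip (e j) (e k) = 0) /\
  (forall k, e k = zero \/ norm (e k) = 1) /\
  (forall x : H, is_series (fun k => scal (ip x (e k)) (e k)) x).

Definition eigenbasis A (e : nat -> H) (lam : nat -> R) : Prop :=
  orthonormal_basis e /\
  forall k, 0 < lam k /\ dom A (e k) /\ A (e k) = scal (lam k ^ 2) (e k).

Section Spectral.
Variables (e : nat -> H) (lam : nat -> R).

Definition component_terms (nu : R) (x : H) (k : nat) : H :=
  if Req_EM_T (lam k) nu then scal (ip x (e k)) (e k) else zero.

Definition component (nu : R) (x : H) : H :=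
  iota (is_series (component_terms nu x)).

Definition in_eigenspace (nu : R) (x : H) : Prop :=
  is_series (component_terms nu x) x.

Definition is_lowest_frequency (u0 u1 : H) (nu : R) : Prop :=
  (exists k, (ip u0 (e k) <> 0 \/ ip u1 (e k) <> 0) /\ lam k = nu) /\
  (forall k, ip u0 (e k) <> 0 \/ ip u1 (e k) <> 0 -> nu <= lam k).

End Spectral.

(* D(T) carries the graph topology, i.e. the one induced by this map from
   the product topology of H * H. *)
Definition graph T (x : H) : H * H := (x, T x).

Definition cvg_infty_in T (f : R -> H) (l : H) : Prop :=
  dom T l /\
  filterlim (fun t => graph T (f t)) (Rbar_locally p_infty)
            (locally (graph T l)).

End Operators.

(* Continuity and differentiability on [0, +oo), one-sided at 0. *)
Definition at_nonneg (t : R) : (R -> Prop) -> Prop :=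
  within (fun s => 0 <= s) (locally t).

Definition continuous_nonneg (V : UniformSpace) (f : R -> V) : Prop :=
  forall t, 0 <= t -> filterlim f (at_nonneg t) (locally (f t)).

Definition derive_nonneg (V : NormedModule R_AbsRing) (f df : R -> V) : Prop :=
  forall t, 0 <= t ->
    filterdiff f (at_nonneg t) (fun h : R => scal h (df t)).

(* x^a for x >= 0 and a > 0: unlike [Rpower], it is 0 at x = 0. *)
Definition rpow (x a : R) : R := if Rlt_dec 0 x then Rpower x a else 0.

Section Kirchhoff.
Variables (H : RealHilbert) (A S : operator H) (gamma : R) (u0 u1 : H).
Implicit Types u du ddu : R -> H.

Definition b (u : R -> H) (t : R) : R := rpow (norm (S (u t))) (2 * gamma).

Definition B (u : R -> H) (t : R) : R := RInt (b u) 0 t.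

Record is_global_solution (eps : R) (u du ddu : R -> H) : Prop := {
  sol_derive1 : derive_nonneg u du;
  sol_derive2 : derive_nonneg du ddu;
  sol_cont2 : continuous_nonneg ddu;
  sol_dom_S : forall t, 0 <= t -> dom S (u t) /\ dom S (du t);
  sol_derive_S : derive_nonneg (V := prod_NormedModule R_AbsRing H H)
                   (fun t => graph S (u t)) (fun t => graph S (du t));
  sol_cont_S : continuous_nonneg (fun t => graph S (du t));
  sol_dom_A : forall t, 0 <= t -> dom A (u t);
  sol_cont_A : continuous_nonneg (fun t => graph A (u t));
  sol_eq : forall t, 0 <= t ->
    plus (plus (scal eps (ddu t)) (scal (b u t) (A (u t)))) (du t) = zero;
  sol_init0 : u 0 = u0;
  sol_init1 : du 0 = u1
}.

Definition decay_estimates (K1 K2 : R) (u du : R -> H) : Prop :=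
  forall t, 0 <= t ->
    K1 * Rpower (1 + t) (- (1 / gamma)) <= norm (S (u t)) ^ 2
      <= K2 * Rpower (1 + t) (- (1 / gamma)) /\
    K1 * Rpower (1 + t) (- (1 / gamma)) <= norm (A (u t)) ^ 2
      <= K2 * Rpower (1 + t) (- (1 / gamma)) /\
    norm (du t) ^ 2 <= K2 * Rpower (1 + t) (- 2 - 1 / gamma).

(* The well-posedness and decay result recalled from the literature, which
   gives a meaning to u_eps for eps in (0, eps1]. *)
Definition well_posed_with_decay (eps1 K1 K2 : R) : Prop :=
  0 < eps1 <= 1 /\ 0 < K1 /\ 0 < K2 /\
  forall eps, 0 < eps <= eps1 ->
    exists u du ddu,
      is_global_solution eps u du ddu /\
      decay_estimates K1 K2 u du /\
      forall v dv ddv, is_global_solution eps v dv ddv ->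
        forall t, 0 <= t -> v t = u t.

End Kirchhoff.

(* Main.v *)
Require Import Defs.
From Stdlib Require Import Reals Lra Lia Arith Classical.
From Coquelicot Require Import Coquelicot.
Open Scope R_scope.

(** The coordinates y of a solution u along the eigenvectors all solve scalar
    equations eps y'' + y' + m b(t) y = 0, where m = lam_k ^ 2 and the
    coefficient b = |A^{1/2} u|^{2 gamma} is the same for all of them.  The
    known decay of u says that b has size 1/(1+t), and also that |b'| is at
    most a multiple of b/(1+t) ([solution_coefficient]).  So the problem is
    linear with a slowly varying coefficient, and every constant in these
    bounds is independent of eps.  Let B be the primitive of b and n = nu ^ 2.

    When m stays below a fixed level, friction dominates and y follows the
    first order equation y' = - m b y.  The rescaled unknown Y = exp(m B) y has
    a derivative Z which is damped at the rate 1/eps and forced only through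
    b' and b^2, so Z is O((1+t)^{-2}) and the corrected unknown X = Y + eps Z
    drifts by O(eps) in total; hence Y converges
    ([low_mode_bound], [low_mode_cvg]).  When m is large compared with n, the
    mode may oscillate, but a Lyapunov functional shows that its energy decays
    like exp(- 2 p B), uniformly in m ([energy_decay]).  The value
    p = n (1 + 3 gamma) is chosen large enough for these modes to be
    negligible even in the estimate of u''.

    Both regimes bound exp(2 n B) y^2 and its analogues for y' and y'' by
    summable sequences built from the initial data, while each rescaled
    coordinate converges, to zero unless lam_k = nu.  Dominated convergence
    over k yields a limit Y of exp(n B) u in D(A), lying in the eigenspace of
    nu ([profile_exists]).  This limit is not zero because some coordinate with
    lam_k = nu has non-zero data.  If its initial position is non-zero, the
    rescaled coordinate stays comparable to that position, uniformly in eps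
    ([low_mode_persists]).
    Otherwise the initial velocity displaces X by eps times that velocity,
    which exceeds the later drift ([low_mode_kicked]).

    It remains to identify exp(n B).  The definition of b gives
    (exp(2 n gamma B))' = 2 n gamma (exp(2 n B) |A^{1/2} u|^2)^gamma, whose
    right-hand side is bounded and tends to a positive constant.  Thus
    exp(2 n gamma B) grows linearly ([weight_upper], [weight_lower],
    [weight_lim]), and all the assertions follow by inserting this in the
    convergence of the rescaled solution ([solution_asymptotics]). *)

(** * Calculus on the half line *)

Ltac use_derivative D :=
  match type of D with
  | is_derive ?f ?s ?l =>
      replace (Derive (fun x : R => f x) s) with l
        by (symmetry; exact (is_derive_unique f s l D))
  end.

Lemma nonincreasing_on_nonneg (f df : R -> R) :
  (forall t, 0 <= t -> is_derive f t (df t)) ->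
  (forall t, 0 <= t -> df t <= 0) ->
  forall s t, 0 <= s <= t -> f t <= f s.
Proof.
intros Hd Hneg s t Ht.
destruct (MVT_gen f s t df) as [c [Hc E]].
- intros x Hx; apply Hd; rewrite Rmin_left in Hx; lra.
- intros x Hx; rewrite Rmin_left in Hx by lra.
  apply derivable_continuous_pt; exists (df x).
  apply is_derive_Reals, Hd; lra.
- rewrite Rmin_left, Rmax_right in Hc by lra.
  specialize (Hneg c ltac:(lra)); nra.
Qed.

Lemma nondecreasing_on_nonneg (f df : R -> R) :
  (forall t, 0 <= t -> is_derive f t (df t)) ->
  (forall t, 0 <= t -> 0 <= df t) ->
  forall s t, 0 <= s <= t -> f s <= f t.
Proof.
intros Hd Hpos s t Ht.
enough (- f t <= - f s) by lra.
apply (nonincreasing_on_nonneg (fun t => - f t) (fun t => - df t)); auto.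
- intros r Hr; apply (is_derive_opp f r (df r)); auto.
- intros r Hr; specialize (Hpos r Hr); lra.
Qed.

Lemma div_le_self (c t : R) : 0 <= c -> 0 <= t -> c / (1 + t) <= c.
Proof.
intros Hc Ht; apply (Rmult_le_reg_r (1 + t)); [lra|].
replace (c / (1 + t) * (1 + t)) with c by (field; lra). nra.
Qed.

Lemma Rmult_nonneg_nonpos x y : 0 <= x -> y <= 0 -> x * y <= 0.
Proof. intros; nra. Qed.

Lemma inv_shift_bounds t : 0 <= t -> 0 < / (1 + t) <= 1.
Proof.
intros Ht; split; [apply Rinv_0_lt_compat; lra|].
rewrite <- Rinv_1; apply Rinv_le_contravar; lra.
Qed.

Lemma exp_ge1 x : 0 <= x -> 1 <= exp x.
Proof. intros Hx; generalize (exp_ineq1_le x); lra. Qed.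

Lemma exp_le1 x : x <= 0 -> exp x <= 1.
Proof.
intros Hx; rewrite <- exp_0.
destruct (Rle_lt_or_eq_dec _ _ Hx) as [H| ->]; [left; apply exp_increasing; auto | lra].
Qed.

(** Adding or subtracting K/(1+t) makes f monotone, which gives the Cauchy criterion. *)
Lemma quadratic_slope_cvg (f df : R -> R) (K : R) :
  (forall t, 0 <= t -> is_derive f t (df t)) ->
  (forall t, 0 <= t -> Rabs (df t) <= K / (1 + t) ^ 2) ->
  exists l : R, is_lim f p_infty l.
Proof.
intros Hd Hb.
assert (HK : 0 <= K).
{ specialize (Hb 0 ltac:(lra)); replace (K / (1 + 0) ^ 2) with K in Hb by field.
  generalize (Rabs_pos (df 0)); lra. }
assert (Hinc : forall sg s t, -1 <= sg <= 1 -> 0 <= s <= t ->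
          sg * (f t - f s) <= K / (1 + s)).
{ intros sg s t Hsg Hst.
  assert (E : sg * f t + K / (1 + t) <= sg * f s + K / (1 + s)).
  { apply (nonincreasing_on_nonneg (fun t => sg * f t + K / (1 + t))
      (fun t => sg * df t - K / (1 + t) ^ 2)); auto.
    - intros r Hr; generalize (Hd r Hr); intros D; auto_derive.
      + repeat split; [eexists; eassumption|lra].
      + use_derivative D; unfold Rdiv; field; lra.
    - intros r Hr; generalize (Hb r Hr); intros D.
      enough (sg * df r <= Rabs (df r)) by lra.
      generalize (Rle_abs (df r)) (Rle_abs (- df r)) (Rabs_pos (df r)); rewrite Rabs_Ropp.
      intros; nra. }
  assert (0 <= K / (1 + t)) by (apply Rdiv_le_0_compat; lra). lra. }
destruct (proj1 (filterlim_locally_cauchy (F := Rbar_locally p_infty) f)) as [l Hl].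
- intros eps. exists (fun t => (K + 1) / eps < t); split; [exists ((K + 1) / eps); auto|].
  assert (Hclose : forall s t, (K + 1) / eps < s -> s <= t -> Rabs (f t - f s) < eps).
  { intros s t Hs Hst. destruct eps as [e He]; simpl in *.
    assert (0 < (K + 1) / e) by (apply Rdiv_lt_0_compat; lra).
    assert (K / (1 + s) < e).
    { apply (Rmult_lt_reg_r (1 + s)); [lra|].
      replace (K / (1 + s) * (1 + s)) with K by (field; lra).
      assert ((K + 1) / e * e < s * e) as H1 by (apply Rmult_lt_compat_r; lra).
      replace ((K + 1) / e * e) with (K + 1) in H1 by (field; lra). lra. }
    apply Rabs_def1; [generalize (Hinc 1 s t ltac:(lra) ltac:(lra)) |
                      generalize (Hinc (-1) s t ltac:(lra) ltac:(lra))]; lra. }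
  intros s t Hs Ht. destruct (Rle_dec s t) as [H|H].
  + apply Hclose; auto.
  + apply ball_sym, Hclose; auto; lra.
- exists l; exact Hl.
Qed.

(** * A fast variable driving a slow one *)

Section FastSlow.
Variables (eps c : R) (X Z ka et : R -> R).
Hypothesis heps : 0 < eps <= 1 / 8.
Hypothesis hc : 0 <= c.
Hypothesis hec : 8 * eps * c <= 1.
Hypothesis hX : forall t, 0 <= t -> is_derive X t (eps * (ka t * Z t + et t * X t)).
Hypothesis hZ : forall t, 0 <= t ->
  is_derive Z t (- Z t / eps + (ka t * Z t + et t * X t)).
Hypothesis hka : forall t, 0 <= t -> Rabs (ka t) <= c / (1 + t).
Hypothesis het : forall t, 0 <= t -> Rabs (et t) <= c / (1 + t) ^ 2.

Let Q t := X t ^ 2 + eps * Z t ^ 2.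

Lemma fast_slow_energy_nonneg t : 0 <= Q t.
Proof.
unfold Q; apply Rplus_le_le_0_compat; [apply pow2_ge_0|].
apply Rmult_le_pos; [lra|apply pow2_ge_0].
Qed.

Lemma coupling_le t : 0 <= t ->
  Rabs (ka t * Z t + et t * X t)
    <= c * (Rabs (Z t) / (1 + t) + Rabs (X t) / (1 + t) ^ 2).
Proof.
intros Ht; eapply Rle_trans; [apply Rabs_triang|]; rewrite 2!Rabs_mult.
generalize (Rmult_le_compat_r _ _ _ (Rabs_pos (Z t)) (hka t Ht))
  (Rmult_le_compat_r _ _ _ (Rabs_pos (X t)) (het t Ht)); unfold Rdiv; lra.
Qed.

(** The product of the two unknowns is the only harmful term: split by Young's
    inequality, one half has an integrable coefficient and the other is absorbed by
    the damping of Z. *)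
Lemma coupling_mul_le t : 0 <= t ->
  2 * eps * ((X t + Z t) * (ka t * Z t + et t * X t))
    <= 4 * eps * c / (1 + t) ^ 2 * X t ^ 2 + Z t ^ 2 / 2.
Proof.
intros Ht.
pose (i := / (1 + t)).
assert (Hi : 0 < i <= 1) by (apply inv_shift_bounds; auto).
generalize (coupling_le t Ht).
replace (Rabs (Z t) / (1 + t) + Rabs (X t) / (1 + t) ^ 2) with
  (Rabs (Z t) * i + Rabs (X t) * i ^ 2) by (unfold i; field; lra).
replace (4 * eps * c / (1 + t) ^ 2) with (4 * eps * c * i ^ 2) by (unfold i; field; lra).
set (w := ka t * Z t + et t * X t).
rewrite <- (pow2_abs (X t)); rewrite <- (pow2_abs (Z t)).
intros Hw.
assert (E : (X t + Z t) * w <= (Rabs (X t) + Rabs (Z t)) * Rabs w).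
{ eapply Rle_trans; [apply Rle_abs|]; rewrite Rabs_mult.
  apply Rmult_le_compat_r; [apply Rabs_pos|apply Rabs_triang]. }
generalize (Rabs_pos (X t)) (Rabs_pos (Z t)); intros Ha Hz.
set (a := Rabs (X t)) in *; set (z := Rabs (Z t)) in *.
assert (F : (a + z) * Rabs w <= c * (2 * i ^ 2 * a ^ 2 + 2 * z ^ 2)).
{ eapply Rle_trans; [apply Rmult_le_compat_l; [lra|exact Hw]|].
  replace ((a + z) * (c * (z * i + a * i ^ 2))) with (c * ((a + z) * (z * i + a * i ^ 2))) by ring.
  apply Rmult_le_compat_l; auto.
  assert (0 <= (i * a - z) ^ 2) by apply pow2_ge_0.
  assert (0 <= a * z * i) by (repeat apply Rmult_le_pos; lra).
  assert (a * z * i * i <= a * z * i * 1) by (apply Rmult_le_compat_l; lra).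
  assert (0 <= z ^ 2) by apply pow2_ge_0.
  assert (z ^ 2 * i <= z ^ 2 * 1) by (apply Rmult_le_compat_l; lra).
  nra. }
assert (2 * eps * ((X t + Z t) * w) <= 2 * eps * (c * (2 * i ^ 2 * a ^ 2 + 2 * z ^ 2))).
{ apply Rmult_le_compat_l; lra. }
assert (0 <= z ^ 2) by apply pow2_ge_0.
assert (8 * eps * c * z ^ 2 <= 1 * z ^ 2) by (apply Rmult_le_compat_r; lra).
lra.
Qed.

(** Gronwall's inequality with the integrable rate 4 eps c/(1+t)^2; the factor
    exp(4 eps c) is below 3 because eps c <= 1/8. *)
Lemma fast_slow_bounded t : 0 <= t -> Q t <= 3 * Q 0.
Proof.
intros Ht.
assert (E : exp (4 * eps * c / (1 + t)) * Q t <= exp (4 * eps * c / (1 + 0)) * Q 0).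
{ apply (nonincreasing_on_nonneg (fun s => exp (4 * eps * c / (1 + s)) * Q s)
    (fun s => exp (4 * eps * c / (1 + s)) *
       (- (4 * eps * c / (1 + s) ^ 2) * Q s +
        (2 * eps * ((X s + Z s) * (ka s * Z s + et s * X s)) - 2 * Z s ^ 2)))); [| |lra].
  - intros s Hs; unfold Q; generalize (hX s Hs) (hZ s Hs); intros D1 D2.
    auto_derive.
    + repeat split; try (eexists; eassumption); lra.
    + use_derivative D1; use_derivative D2; unfold Rdiv; field; lra.
  - intros s Hs; apply Rmult_nonneg_nonpos; [left; apply exp_pos|].
    generalize (coupling_mul_le s Hs); intros; unfold Q.
    assert (0 <= 4 * eps * c / (1 + s) ^ 2).
    { apply Rdiv_le_0_compat; [|apply pow_lt; lra].
      repeat apply Rmult_le_pos; lra. }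
    assert (0 <= Z s ^ 2) by apply pow2_ge_0.
    assert (0 <= 4 * eps * c / (1 + s) ^ 2 * (eps * Z s ^ 2)).
    { apply Rmult_le_pos; auto; apply Rmult_le_pos; lra. }
    lra. }
assert (HQ : forall s, 0 <= Q s) by apply fast_slow_energy_nonneg.
assert (0 <= eps * c) by (apply Rmult_le_pos; lra).
assert (1 <= exp (4 * eps * c / (1 + t))).
{ apply exp_ge1, Rdiv_le_0_compat; lra. }
assert (exp (4 * eps * c / (1 + 0)) <= 3).
{ apply Rle_trans with (exp 1); [|apply exp_le_3].
  destruct (Rle_lt_or_eq_dec (4 * eps * c / (1 + 0)) 1) as [h|h].
  - apply Rle_trans with (4 * eps * c); [apply div_le_self; lra|lra].
  - left; apply exp_increasing; auto.
  - rewrite h; lra. }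
generalize (HQ t) (HQ 0); intros; nra.
Qed.

(** The damping rate 1/eps exceeds the logarithmic derivative 4/(1+t) of the
    weight, and the forcing et X of Z carries the factor (1+t)^{-2}. *)
Lemma fast_slow_decay t : 0 <= t -> (1 + t) ^ 4 * Z t ^ 2 <= Z 0 ^ 2 + Q 0.
Proof.
intros Ht.
assert (HQ0 : 0 <= Q 0) by apply fast_slow_energy_nonneg.
assert (E : exp (t / eps) * ((1 + t) ^ 4 * Z t ^ 2 - Q 0)
            <= exp (0 / eps) * ((1 + 0) ^ 4 * Z 0 ^ 2 - Q 0)).
{ apply (nonincreasing_on_nonneg (fun s => exp (s / eps) * ((1 + s) ^ 4 * Z s ^ 2 - Q 0))
   (fun s => exp (s / eps) / eps * ((1 + s) ^ 4 * Z s ^ 2 - Q 0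
       + eps * (4 * (1 + s) ^ 3 * Z s ^ 2) - 2 * (1 + s) ^ 4 * Z s ^ 2
       + 2 * eps * (1 + s) ^ 4 * (Z s * (ka s * Z s + et s * X s))))); [| |lra].
  - intros s Hs; generalize (hZ s Hs); intros D; auto_derive.
    + repeat split; try (eexists; eassumption).
    + use_derivative D; unfold Rdiv; field; lra.
  - intros s Hs; apply Rmult_nonneg_nonpos; [left; apply Rdiv_lt_0_compat; [apply exp_pos|lra]|].
    generalize (fast_slow_bounded s Hs); intros HQ; unfold Q at 1 in HQ.
    set (f := (1 + s) ^ 4 * Z s ^ 2).
    assert (Hf : 0 <= f) by (apply Rmult_le_pos; [apply pow_le; lra|apply pow2_ge_0]).
    assert (H1 : eps * (4 * (1 + s) ^ 3 * Z s ^ 2) <= f / 2).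
    { replace (eps * (4 * (1 + s) ^ 3 * Z s ^ 2)) with ((4 * eps) * ((1 + s) ^ 3 * Z s ^ 2)) by ring.
      assert ((1 + s) ^ 3 * Z s ^ 2 <= f).
      { unfold f; apply Rmult_le_compat_r; [apply pow2_ge_0|].
        apply Rle_pow; [lra|auto]. }
      assert (0 <= (1 + s) ^ 3 * Z s ^ 2) by (apply Rmult_le_pos; [apply pow_le; lra|apply pow2_ge_0]).
      nra. }
    assert (H2 : 2 * eps * (1 + s) ^ 4 * (Z s * (ka s * Z s + et s * X s))
                  <= f / 4 + (f + X s ^ 2) / 8).
    { pose (i := / (1 + s)).
      assert (Hi : 0 < i <= 1) by (apply inv_shift_bounds; auto).
      generalize (coupling_le s Hs).
      set (w := ka s * Z s + et s * X s); intros Hw.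
      assert (Hzw : Z s * w <= c * (Z s ^ 2 + Rabs (Z s) * Rabs (X s) * i ^ 2)).
      { eapply Rle_trans; [apply Rle_abs|]; rewrite Rabs_mult.
        eapply Rle_trans; [apply Rmult_le_compat_l; [apply Rabs_pos|exact Hw]|].
        rewrite <- (pow2_abs (Z s)).
        replace (Rabs (Z s) * (c * (Rabs (Z s) / (1 + s) + Rabs (X s) / (1 + s) ^ 2)))
         with (c * (Rabs (Z s) ^ 2 * i + Rabs (Z s) * Rabs (X s) * i ^ 2)) by (unfold i; field; lra).
        apply Rmult_le_compat_l; auto.
        assert (0 <= Rabs (Z s) ^ 2) by apply pow2_ge_0. nra. }
      assert (P4 : 0 < (1 + s) ^ 4) by (apply pow_lt; lra).
      assert (Hm : (1 + s) ^ 4 * (Z s * w) <= c * (f + ((1 + s) ^ 2 * Rabs (Z s)) * Rabs (X s))).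
      { eapply Rle_trans; [apply Rmult_le_compat_l; [lra|exact Hzw]|].
        right; unfold f, i; field; lra. }
      assert (Hf2 : ((1 + s) ^ 2 * Rabs (Z s)) ^ 2 = f).
      { unfold f; rewrite <- (pow2_abs (Z s)); ring. }
      set (g := (1 + s) ^ 2 * Rabs (Z s)) in *.
      assert (g * Rabs (X s) <= (f + X s ^ 2) / 2).
      { rewrite <- Hf2, <- (pow2_abs (X s)).
        assert (0 <= (g - Rabs (X s)) ^ 2) by apply pow2_ge_0. nra. }
      assert (0 <= X s ^ 2) by apply pow2_ge_0.
      assert (2 * eps * ((1 + s) ^ 4 * (Z s * w)) <= 2 * eps * (c * (f + (f + X s ^ 2) / 2))).
      { apply Rmult_le_compat_l; [lra|]. eapply Rle_trans; [exact Hm|].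
        apply Rmult_le_compat_l; lra. }
      assert (8 * eps * c * (f + (f + X s ^ 2) / 2) <= 1 * (f + (f + X s ^ 2) / 2)).
      { apply Rmult_le_compat_r; lra. }
      lra. }
    assert (0 <= eps * Z s ^ 2) by (apply Rmult_le_pos; [lra|apply pow2_ge_0]).
    unfold f in *; lra. }
replace (0 / eps) with 0 in E by (field; lra); rewrite exp_0 in E.
assert (1 <= exp (t / eps)) by (apply exp_ge1, Rdiv_le_0_compat; lra).
assert (0 <= Z 0 ^ 2) by apply pow2_ge_0.
replace ((1 + 0) ^ 4 * Z 0 ^ 2) with (Z 0 ^ 2) in E by ring.
set (f := (1 + t) ^ 4 * Z t ^ 2) in *; set (r := exp (t / eps)) in *.
destruct (Rle_dec f (Q 0)) as [h|h]; [lra|].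
assert (1 * (f - Q 0) <= r * (f - Q 0)) by (apply Rmult_le_compat_r; lra); lra.
Qed.

(** The slope of X contains Z only through ka Z, and ka is square integrable in
    time; so is Z, by the dissipation in the energy identity of Q.  The functional
    below turns the Cauchy-Schwarz inequality in time into a pointwise one, so that no
    integral appears.  Keeping q free is what makes the bound proportional to the data. *)
Lemma fast_slow_drift q t : 0 < q -> Q 0 <= q ^ 2 -> 0 <= t ->
  Rabs (X t - X 0) <= 7 * c * eps * q.
Proof.
intros Hq HQ0 Ht.
assert (HQ : forall s, 0 <= Q s) by apply fast_slow_energy_nonneg.
assert (Hsg : forall sg, Rabs sg = 1 -> sg * (X t - X 0) <= 7 * c * eps * q).
{ intros sg Hsg.
  (* Q/q integrates the term Z^2/q from Young's inequality; the last term
     is the primitive of -6 c eps q/(1+t)^2. *)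
  pose (Phi := fun s => sg * X s + eps * c / q * Q s - 6 * c * eps * q * (1 - / (1 + s))).
  assert (E : Phi t <= Phi 0).
  { apply (nonincreasing_on_nonneg Phi (fun s =>
      sg * (eps * (ka s * Z s + et s * X s)) +
      eps * c / q * (2 * eps * ((X s + Z s) * (ka s * Z s + et s * X s)) - 2 * Z s ^ 2)
      - 6 * c * eps * q / (1 + s) ^ 2)); [| |lra].
    - intros s Hs; unfold Phi, Q; generalize (hX s Hs) (hZ s Hs); intros D1 D2.
      auto_derive.
      + repeat split; try (eexists; eassumption); lra.
      + use_derivative D1; use_derivative D2; unfold Rdiv; field; lra.
    - intros s Hs.
      generalize (coupling_le s Hs) (coupling_mul_le s Hs).
      set (w := ka s * Z s + et s * X s).
      pose (i := / (1 + s)).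
      assert (Hi : 0 < i <= 1) by (apply inv_shift_bounds; auto).
      replace (4 * eps * c / (1 + s) ^ 2) with (4 * eps * c * i ^ 2) by (unfold i; field; lra).
      replace (Rabs (Z s) / (1 + s) + Rabs (X s) / (1 + s) ^ 2) with
         (Rabs (Z s) * i + Rabs (X s) * i ^ 2) by (unfold i; field; lra).
      replace (6 * c * eps * q / (1 + s) ^ 2) with (6 * c * eps * q * i ^ 2) by (unfold i; field; lra).
      intros Hw Hm.
      assert (Hsw : sg * w <= Rabs w).
      { eapply Rle_trans; [apply Rle_abs|]; rewrite Rabs_mult, Hsg; lra. }
      assert (HX : X s ^ 2 <= 3 * q ^ 2).
      { generalize (fast_slow_bounded s Hs); unfold Q at 1.
        assert (0 <= eps * Z s ^ 2) by (apply Rmult_le_pos; [lra|apply pow2_ge_0]). lra. }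
      assert (HXa : Rabs (X s) <= 2 * q).
      { apply Rsqr_incr_0; [|apply Rabs_pos|lra].
        unfold Rsqr. rewrite <- (pow2_abs (X s)) in HX. nra. }
      assert (Hz : Rabs (Z s) * i <= Z s ^ 2 / q + q * i ^ 2 / 4).
      { rewrite <- (pow2_abs (Z s)). apply (Rmult_le_reg_r q); auto.
        replace ((Rabs (Z s) ^ 2 / q + q * i ^ 2 / 4) * q) with (Rabs (Z s) ^ 2 + (q * i) ^ 2 / 4)
          by (field; lra).
        assert (0 <= (Rabs (Z s) - q * i / 2) ^ 2) by apply pow2_ge_0. nra. }
      assert (Hi2 : 0 <= i ^ 2) by apply pow2_ge_0.
      assert (Hxi : Rabs (X s) * i ^ 2 <= 2 * q * i ^ 2) by (apply Rmult_le_compat_r; lra).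
      assert (Hec : 0 <= eps * c) by (apply Rmult_le_pos; lra).
      assert (H1 : sg * (eps * w) <= eps * c * (Z s ^ 2 / q + q * i ^ 2 / 4 + 2 * q * i ^ 2)).
      { replace (sg * (eps * w)) with (eps * (sg * w)) by ring. rewrite Rmult_assoc.
        apply Rmult_le_compat_l; [lra|]. apply Rle_trans with (1 := Hsw), Rle_trans with (1 := Hw).
        apply Rmult_le_compat_l; lra. }
      assert (HZ0 : 0 <= Z s ^ 2) by apply pow2_ge_0.
      assert (H2 : 2 * eps * ((X s + Z s) * w) - 2 * Z s ^ 2 <= 3 / 2 * (q ^ 2 * i ^ 2) - Z s ^ 2).
      { assert (0 <= i ^ 2 * X s ^ 2) by (apply Rmult_le_pos; [lra|apply pow2_ge_0]).
        assert (i ^ 2 * X s ^ 2 <= i ^ 2 * (3 * q ^ 2)) by (apply Rmult_le_compat_l; lra).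
        assert (8 * eps * c * (i ^ 2 * X s ^ 2) <= 1 * (i ^ 2 * X s ^ 2)) by (apply Rmult_le_compat_r; lra).
        lra. }
      assert (H3 : eps * c / q * (2 * eps * ((X s + Z s) * w) - 2 * Z s ^ 2)
                   <= eps * c / q * (3 / 2 * (q ^ 2 * i ^ 2) - Z s ^ 2)).
      { apply Rmult_le_compat_l; auto. apply Rdiv_le_0_compat; auto. }
      replace (eps * c / q * (3 / 2 * (q ^ 2 * i ^ 2) - Z s ^ 2)) with
        (eps * c * (3 / 2 * (q * i ^ 2) - Z s ^ 2 / q)) in H3 by (field; lra).
      assert (0 <= eps * c * (q * i ^ 2)) by (repeat apply Rmult_le_pos; lra).
      lra. }
  unfold Phi in E. rewrite Rplus_0_r, Rinv_1 in E.
  assert (0 <= eps * c) by (apply Rmult_le_pos; lra).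
  assert (0 <= eps * c / q * Q t).
  { apply Rmult_le_pos; auto; apply Rdiv_le_0_compat; auto. }
  assert (eps * c / q * Q 0 <= eps * c * q).
  { replace (eps * c * q) with (eps * c / q * q ^ 2) by (field; lra).
    apply Rmult_le_compat_l; auto; apply Rdiv_le_0_compat; auto. }
  assert (0 <= / (1 + t)) by (left; apply Rinv_0_lt_compat; lra).
  assert (0 <= 6 * c * eps * q * / (1 + t)).
  { apply Rmult_le_pos; auto. assert (0 <= eps * c * q) by (apply Rmult_le_pos; lra). lra. }
  lra. }
apply Rabs_le; split.
- generalize (Hsg (-1) ltac:(rewrite Rabs_left; lra)); lra.
- generalize (Hsg 1 Rabs_R1); lra.
Qed.

Lemma fast_slow_cvg : exists l : R, is_lim X p_infty l.
Proof.
pose (K := eps * c * (1 + Z 0 ^ 2 + Q 0 + (1 + 3 * Q 0))).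
apply quadratic_slope_cvg with (1 := hX) (K := K).
intros t Ht.
assert (HQ0 : 0 <= Q 0) by apply fast_slow_energy_nonneg.
assert (0 <= Z 0 ^ 2) by apply pow2_ge_0.
pose (i := / (1 + t)).
assert (Hi : 0 < i <= 1) by (apply inv_shift_bounds; auto).
rewrite Rabs_mult, (Rabs_right eps) by lra.
replace (K / (1 + t) ^ 2) with (eps * (c * (((1 + Z 0 ^ 2 + Q 0) * i + (1 + 3 * Q 0) * i) * i)))
 by (unfold K, i; field; lra).
apply Rmult_le_compat_l; [lra|].
eapply Rle_trans; [apply coupling_le; auto|]. apply Rmult_le_compat_l; auto.
replace (Rabs (Z t) / (1 + t) + Rabs (X t) / (1 + t) ^ 2) with
         ((Rabs (Z t) + Rabs (X t) * i) * i) by (unfold i; field; lra).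
apply Rmult_le_compat_r; [lra|]. apply Rplus_le_compat.
- generalize (fast_slow_decay t Ht); intros D.
  assert (Hz : (1 + t) ^ 2 * Rabs (Z t) <= 1 + Z 0 ^ 2 + Q 0).
  { assert (((1 + t) ^ 2 * Rabs (Z t)) ^ 2 <= Z 0 ^ 2 + Q 0).
    { rewrite Rpow_mult_distr, pow2_abs. eapply Rle_trans; [|exact D]. right; ring. }
    set (g := (1 + t) ^ 2 * Rabs (Z t)) in *. nra. }
  replace (Rabs (Z t)) with (i ^ 2 * ((1 + t) ^ 2 * Rabs (Z t))) by (unfold i; field; lra).
  assert (i ^ 2 <= i) by nra. assert (0 <= i ^ 2) by apply pow2_ge_0.
  nra.
- apply Rmult_le_compat_r; [lra|].
  generalize (fast_slow_bounded t Ht); unfold Q at 1; intros.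
  assert (0 <= eps * Z t ^ 2) by (apply Rmult_le_pos; [lra|apply pow2_ge_0]).
  rewrite <- (pow2_abs (X t)) in H0. nra.
Qed.

End FastSlow.

Lemma is_lim_inv_shift : is_lim (fun t => / (1 + t)) p_infty 0.
Proof.
apply is_lim_spec; intros [e He]; simpl.
exists (/ e); intros t Ht.
assert (0 < / e) by (apply Rinv_0_lt_compat; auto).
rewrite Rminus_0_r, Rabs_right by (left; apply Rinv_0_lt_compat; lra).
rewrite <- (Rinv_inv e); apply Rinv_lt_contravar; [apply Rmult_lt_0_compat|]; lra.
Qed.

Lemma is_lim_ext_nonneg (f g : R -> R) (l : Rbar) :
  (forall t, 0 <= t -> f t = g t) -> is_lim f p_infty l -> is_lim g p_infty l.
Proof.
intros H; apply is_lim_ext_loc; exists 0; intros t Ht; apply H; lra.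
Qed.

Lemma is_lim_0_of_square (f g : R -> R) (K : R) :
  (forall t, 0 <= t -> f t ^ 2 <= K * g t) ->
  is_lim g p_infty 0 -> is_lim f p_infty 0.
Proof.
intros H Hg.
assert (Hs : is_lim (fun t => sqrt (K * g t)) p_infty 0).
{ rewrite <- sqrt_0. apply (is_lim_comp_continuous (fun t => K * g t) sqrt).
  - replace (Finite 0) with (Rbar_mult K 0) by (simpl; f_equal; ring).
    apply is_lim_scal_l; auto.
  - apply continuous_sqrt. }
apply (is_lim_le_le_loc (fun t => - sqrt (K * g t)) (fun t => sqrt (K * g t))); auto.
- exists 0; intros t Ht.
  assert (Rabs (f t) <= sqrt (K * g t)) as E.
  { rewrite <- sqrt_Rsqr_abs; apply sqrt_le_1_alt; unfold Rsqr.
    generalize (H t ltac:(lra)); lra. }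
  apply Rabs_le_between in E; lra.
- replace (Finite 0) with (Rbar_opp 0) by (simpl; f_equal; ring).
  apply is_lim_opp; auto.
Qed.

Lemma is_lim_scal_pos_infty (f : R -> R) (a : R) (x : Rbar) :
  0 < a -> is_lim f x p_infty -> is_lim (fun t => a * f t) x p_infty.
Proof.
intros Ha Hf; generalize (is_lim_scal_l f a x p_infty Hf).
replace (Rbar_mult a p_infty) with p_infty; auto.
symmetry; unfold Rbar_mult, Rbar_mult'. destruct (Rle_dec 0 a) as [h|h]; [|lra].
destruct (Rle_lt_or_eq_dec 0 a h); [reflexivity|lra].
Qed.

Lemma exp_double x : exp x ^ 2 = exp (2 * x).
Proof. replace (2 * x) with (x + x) by ring; rewrite exp_plus; ring. Qed.

(** * Coordinates in a Hilbert space *)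

Lemma minus_zero_eq (G : AbelianGroup) (x y : G) : minus x y = zero -> x = y.
Proof.
intros Hz; apply (plus_reg_r (opp y)); transitivity (@zero G); [exact Hz|].
symmetry; apply plus_opp_r.
Qed.

Lemma Rlt_of_sq (x d : R) : 0 < d -> x ^ 2 < d ^ 2 -> x < d.
Proof. intros; nra. Qed.

Section Hilbert.
Variable H : RealHilbert.
Implicit Types x y z w l : H.

Lemma ip_scal_r (a : R) x y : ip x (scal a y) = a * ip x y.
Proof. rewrite ip_sym, ip_scal_l, ip_sym; auto. Qed.

Lemma ip_zero_l x : ip zero x = 0.
Proof.
assert (E : ip zero x = ip (scal 0 zero) x) by (f_equal; symmetry; apply (scal_zero_r (V := H) (0 : R))).
rewrite E, ip_scal_l; ring.
Qed.

Lemma ip_zero_r x : ip x zero = 0.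
Proof. rewrite ip_sym; apply ip_zero_l. Qed.

Lemma ip_opp_l x y : ip (opp x) y = - ip x y.
Proof.
assert (E : ip (plus x (opp x)) y = 0) by (etransitivity; [apply (f_equal (fun z => ip z y)), (plus_opp_r x)|apply ip_zero_l]).
rewrite ip_plus_l in E; lra.
Qed.

Lemma ip_minus_l x y z : ip (minus x y) z = ip x z - ip y z.
Proof. unfold minus; rewrite ip_plus_l, ip_opp_l; ring. Qed.

Lemma ip_minus_r x y z : ip z (minus x y) = ip z x - ip z y.
Proof. rewrite ip_sym, ip_minus_l, (ip_sym x), (ip_sym y); auto. Qed.

Lemma ip_self_nonneg x : 0 <= ip x x.
Proof. rewrite ip_norm; apply pow2_ge_0. Qed.

Lemma ip_self_eq0 x : ip x x = 0 -> x = zero.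
Proof.
rewrite ip_norm; intros E; apply (norm_eq_zero (V := H)).
generalize (norm_ge_0 x); intros; nra.
Qed.

Lemma ip_ext x y : (forall w, ip x w = ip y w) -> x = y.
Proof.
intros E.
apply (minus_zero_eq H), ip_self_eq0; rewrite ip_minus_l, E; ring.
Qed.

Lemma norm_scal_sq (a : R) x : norm (scal a x) ^ 2 = a ^ 2 * norm x ^ 2.
Proof. rewrite <- !ip_norm, ip_scal_l, ip_scal_r; ring. Qed.

Lemma cauchy_schwarz x y : Rabs (ip x y) <= norm x * norm y.
Proof.
apply Rsqr_incr_0; [|apply Rabs_pos|apply Rmult_le_pos; apply norm_ge_0].
rewrite <- Rsqr_abs; unfold Rsqr.
replace (norm x * norm y * (norm x * norm y)) with (norm x ^ 2 * norm y ^ 2) by ring.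
rewrite <- !ip_norm.
destruct (Req_dec (ip y y) 0) as [Hy|Hy].
{ rewrite (ip_self_eq0 _ Hy), !ip_zero_r; lra. }
assert (Hy0 : 0 < ip y y) by (generalize (ip_self_nonneg y); lra).
generalize (ip_self_nonneg (minus (scal (ip y y) x) (scal (ip x y) y))).
rewrite ip_minus_l, !ip_minus_r, !ip_scal_l, !ip_scal_r, (ip_sym y x).
intros E. assert (0 <= ip y y * (ip x x * ip y y - ip x y * ip x y)) by lra.
assert (0 <= ip x x * ip y y - ip x y * ip x y); [|lra].
apply (Rmult_le_reg_l (ip y y)); lra.
Qed.

Lemma ip_is_linear w : is_linear (fun x : H => ip x w).
Proof.
split.
- intros x y; apply ip_plus_l.
- intros k x; apply ip_scal_l.
- exists (norm w + 1); split; [generalize (norm_ge_0 w); lra|].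
  intros x. eapply Rle_trans; [apply cauchy_schwarz|].
  generalize (norm_ge_0 w) (norm_ge_0 x); nra.
Qed.

Lemma filterlim_ip {T} (F : (T -> Prop) -> Prop) (FF : Filter F) (f : T -> H) l w :
  filterlim f F (locally l) -> filterlim (fun t => ip (f t) w) F (locally (ip l w)).
Proof.
intros Hf; apply (filterlim_comp _ _ _ f (fun x => ip x w) F (locally l)); [exact Hf|].
apply (linear_cont (fun x : H => ip x w)), ip_is_linear.
Qed.

Lemma ip_sum_n (a : nat -> H) w N : ip (sum_n a N) w = sum_n (fun k => ip (a k) w) N.
Proof.
induction N as [|N IH]; [rewrite !sum_O; auto|].
rewrite !sum_Sn, ip_plus_l, IH; auto.
Qed.

Lemma is_series_ip (a : nat -> H) l w :
  is_series a l -> is_series (fun k => ip (a k) w) (ip l w).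
Proof.
intros Ha; unfold is_series.
apply filterlim_ext with (f := fun N => ip (sum_n a N) w).
{ intros N; apply ip_sum_n. }
apply filterlim_ip; auto; apply eventually_filter.
Qed.

Section Basis.
Variable e : nat -> H.
Hypothesis he : orthonormal_basis e.

Lemma parseval x y : is_series (fun k => ip x (e k) * ip y (e k)) (ip x y).
Proof.
destruct he as (_ & _ & Hs).
apply is_series_ext with (a := fun k => ip (scal (ip x (e k)) (e k)) y).
{ intros k; rewrite ip_scal_l, (ip_sym y); auto. }
apply is_series_ip, Hs.
Qed.

Lemma parseval_sq x : is_series (fun k => ip x (e k) ^ 2) (norm x ^ 2).
Proof.
rewrite <- ip_norm; apply is_series_ext with (2 := parseval x x); intros; simpl; ring.
Qed.

Lemma coordinates_ext x y : (forall k, ip x (e k) = ip y (e k)) -> x = y.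
Proof.
intros E; apply ip_ext; intros w.
rewrite <- (is_series_unique _ _ (parseval x w)), <- (is_series_unique _ _ (parseval y w)).
apply Series_ext; intros k; rewrite E; auto.
Qed.

Lemma norm_sq_le_of_coordinates x (M : nat -> R) :
  ex_series M -> (forall k, ip x (e k) ^ 2 <= M k) -> norm x ^ 2 <= Series M.
Proof.
intros HM Hx; rewrite <- (is_series_unique _ _ (parseval_sq x)).
apply Series_le; auto; intros k; split; auto; apply pow2_ge_0.
Qed.

Lemma basis_norm_sq k : ip (e k) (e k) <= 1 /\ (e k <> zero -> ip (e k) (e k) = 1).
Proof.
destruct he as (_ & H1 & _); rewrite ip_norm; destruct (H1 k) as [E|E].
- assert (En : norm (e k) = 0) by (rewrite E; apply (norm_zero (V := H))).
  rewrite En; split; [lra|intros C; destruct C; auto].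
- rewrite E; split; intros; rewrite ?E; lra.
Qed.

Lemma ip_sum_n_m (a : nat -> R) n m w :
  ip (sum_n_m (fun k => scal (a k) (e k)) n m) w = sum_n_m (fun k => a k * ip (e k) w) n m.
Proof.
destruct (le_dec n m) as [h|h].
2:{ rewrite !sum_n_m_zero by lia; apply ip_zero_l. }
induction m as [|m IH].
- assert (n = 0)%nat by lia; subst; rewrite !sum_n_n, ip_scal_l; auto.
- destruct (Nat.eq_dec n (S m)) as [->|Hn].
  + rewrite !sum_n_n, ip_scal_l; auto.
  + rewrite !sum_n_Sm by lia. rewrite ip_plus_l, ip_scal_l, IH by lia; auto.
Qed.

Lemma orthogonal_sum_norm_sq (a : nat -> R) n m :
  norm (sum_n_m (fun k => scal (a k) (e k)) n m) ^ 2
    = sum_n_m (fun k => a k ^ 2 * ip (e k) (e k)) n m.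
Proof.
rewrite <- ip_norm, ip_sum_n_m. apply sum_n_m_ext_loc; intros k Hk.
rewrite ip_sym, ip_sum_n_m.
replace (a k ^ 2 * ip (e k) (e k)) with (a k * (a k * ip (e k) (e k))) by ring. f_equal.
destruct he as (Ho & _ & _).
rewrite (sum_n_m_ext_loc _ (fun j => if Nat.eq_dec j k then a k * ip (e k) (e k) else 0)).
2:{ intros j _; destruct (Nat.eq_dec j k) as [->|Hj]; auto. rewrite (Ho j k Hj); apply Rmult_0_r. }
assert (G : forall N, (n <= k)%nat -> sum_n_m (fun j => if Nat.eq_dec j k then a k * ip (e k) (e k) else 0) n N
   = if le_dec k N then a k * ip (e k) (e k) else 0).
{ intros N Hnk; induction N as [|N IH].
  - destruct n as [|n'].
    + rewrite sum_n_n; destruct (Nat.eq_dec 0 k), (le_dec k 0); auto; lia.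
    + rewrite sum_n_m_zero by lia. destruct (le_dec k 0); [lia|auto].
  - destruct (le_dec n (S N)) as [h|h].
    + rewrite sum_n_Sm, IH by lia. change plus with Rplus. 
      destruct (Nat.eq_dec (S N) k), (le_dec k N), (le_dec k (S N)); try lia; first [apply Rplus_0_l | apply Rplus_0_r].
    + rewrite sum_n_m_zero by lia. destruct (le_dec k (S N)); [lia|auto]. }
rewrite G by lia. destruct (le_dec k m); [auto|lia].
Qed.

(** A null vector of the enumeration imposes a null coefficient, hence the last
    hypothesis. *)
Lemma riesz_fischer (a M : nat -> R) :
  ex_series M -> (forall k, a k ^ 2 <= M k) -> (forall k, e k = zero -> a k = 0) ->
  exists l, is_series (fun k => scal (a k) (e k)) l /\ forall k, ip l (e k) = a k.
Proof.
intros HM Ha Hz.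
assert (Hex : ex_series (fun k => scal (a k) (e k))).
{ apply ex_series_Cauchy; intros [d Hd].
  assert (Hd2 : 0 < d ^ 2) by (apply pow_lt; auto).
  destruct (Cauchy_ex_series M HM (mkposreal _ Hd2)) as [N HN]; exists N; intros n m Hn Hm.
  specialize (HN n m Hn Hm); simpl in HN |- *.
  apply Rlt_of_sq; auto.
  { rewrite orthogonal_sum_norm_sq. eapply Rle_lt_trans; [|exact HN].
    eapply Rle_trans; [|apply Rle_abs]. apply sum_n_m_le; intros k.
    apply Rle_trans with (2 := Ha k).
    destruct (basis_norm_sq k) as [H1 _]; generalize (pow2_ge_0 (a k)); nra. } }
destruct Hex as [l Hl]; exists l; split; auto; intros k.
destruct he as (Ho & _ & _).
generalize (is_series_unique _ _ (is_series_ip _ _ (e k) Hl)); intros <-.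
assert (E : a k = a k * ip (e k) (e k)).
{ destruct (Req_dec (a k) 0) as [->|Hk]; [ring|].
  rewrite (proj2 (basis_norm_sq k)); [ring|intros C; apply Hk, Hz, C]. }
apply is_series_unique. 
apply is_series_ext with (a := fun j => if Nat.eq_dec j k then a k else 0).
{ intros j; rewrite ip_scal_l; destruct (Nat.eq_dec j k) as [->|Hj]; auto.
  rewrite (Ho j k Hj); symmetry; apply Rmult_0_r. }
apply (filterlim_ext_loc (fun _ : nat => a k)); [|apply filterlim_const].
exists k; intros N HN; symmetry.
assert (G : forall N, sum_n (fun j => if Nat.eq_dec j k then a k else 0) N
   = if le_dec k N then a k else 0).
{ induction N0 as [|N0 IH].
  - rewrite sum_O; destruct (Nat.eq_dec 0 k), (le_dec k 0); auto; lia.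
  - rewrite sum_Sn, IH. change plus with Rplus.
    destruct (Nat.eq_dec (S N0) k), (le_dec k N0), (le_dec k (S N0)); try lia; first [apply Rplus_0_l | apply Rplus_0_r]. }
rewrite G; destruct (le_dec k N); [auto|lia].
Qed.

End Basis.
End Hilbert.

(** * Dominated convergence of coordinates *)

Lemma sum_n_vanishes (a : nat -> R -> R) N :
  (forall k, is_lim (a k) p_infty 0) -> is_lim (fun t => sum_n (fun k => a k t) N) p_infty 0.
Proof.
intros Ha; induction N as [|N IH].
- apply (is_lim_ext (a 0%nat)); auto; intros t; rewrite sum_O; auto.
- apply (is_lim_ext (fun t => sum_n (fun k => a k t) N + a (S N) t)).
  { intros t; rewrite sum_Sn; auto. }
  replace (Finite 0) with (Finite (0 + 0)) by (f_equal; ring). apply is_lim_plus'; auto.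
Qed.

Lemma sum_n_split (a : nat -> R) n m :
  (n <= m)%nat -> sum_n a m = sum_n a n + sum_n_m a (S n) m.
Proof. intros Hnm; apply (sum_n_m_Chasles a 0 n m); lia. Qed.

(** The tail of the dominating series controls the tails of all the series at once;
    what is left is a finite sum. *)
Lemma tannery (a : nat -> R -> R) (M : nat -> R) :
  ex_series M -> (forall k t, 0 <= t -> 0 <= a k t <= M k) ->
  (forall k, is_lim (a k) p_infty 0) ->
  is_lim (fun t => Series (fun k => a k t)) p_infty 0.
Proof.
intros HM Ha Hlim; apply is_lim_spec; intros [d Hd]; simpl.
destruct (Cauchy_ex_series M HM (mkposreal _ (is_pos_div_2 (mkposreal d Hd)))) as [N HN]; simpl in HN.
generalize (sum_n_vanishes a N Hlim); intros HS; apply is_lim_spec in HS.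
destruct (HS (mkposreal _ (is_pos_div_2 (mkposreal d Hd)))) as [T HT]; simpl in HT.
exists (Rmax T 0); intros t Ht.
assert (T < t) by (eapply Rle_lt_trans; [apply Rmax_l|exact Ht]).
assert (0 < t) by (eapply Rle_lt_trans; [apply Rmax_r|exact Ht]).
assert (Hext : ex_series (fun k => a k t)).
{ apply (ex_series_le (V := R_CompleteNormedModule) (fun k => a k t) M); auto; intros k.
  destruct (Ha k t ltac:(lra)). change norm with Rabs; rewrite Rabs_right; lra. }
assert (Hpos : 0 <= Series (fun k => a k t)).
{ rewrite <- (Rmult_0_l (Series (fun k => a k t))), <- Series_scal_l. apply Series_le; auto.
  intros k; destruct (Ha k t ltac:(lra)); lra. }
rewrite Rminus_0_r, Rabs_right by lra.
assert (Hsplit : forall k, sum_n (fun k => a k t) k <= sum_n (fun k => a k t) N + d / 2).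
{ intros k; destruct (le_dec k N) as [h|h].
  - destruct (Nat.eq_dec k N) as [->|hk]; [lra|].
    rewrite (sum_n_split _ k N) by lia.
    assert (0 <= sum_n_m (fun k0 => a k0 t) (S k) N).
    { eapply Rle_trans; [|apply (sum_n_m_le (fun _ => 0)); intros j; apply Ha; lra].
      right; symmetry; apply (sum_n_m_const_zero (G := R_AbelianMonoid)). }
    lra.
  - rewrite (sum_n_split _ N k) by lia.
    apply Rplus_le_compat_l.
    eapply Rle_trans; [apply (sum_n_m_le _ M); intros j; apply Ha; lra|].
    eapply Rle_trans; [apply Rle_abs|]. left; apply (HN (S N) k); lia. }
assert (Hle : Series (fun k => a k t) <= sum_n (fun k => a k t) N + d / 2).
{ destruct Hext as [s Hs]; rewrite (is_series_unique _ _ Hs).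
  apply (is_lim_seq_le (sum_n (fun k => a k t)) (fun _ => sum_n (fun k => a k t) N + d / 2)
           s (sum_n (fun k => a k t) N + d / 2)); auto.
  apply is_lim_seq_const. }
specialize (HT t H); rewrite Rminus_0_r in HT.
generalize (Rle_abs (sum_n (fun k => a k t) N)); lra.
Qed.

Lemma ex_series_scaled (a : nat -> R) (s c : R) : is_series a s -> ex_series (fun k => c * a k).
Proof. intros Ha; apply (ex_series_scal (K := R_AbsRing) (V := R_NormedModule) c a); exists s; auto. Qed.

Lemma filterlim_of_norm_sq (H : RealHilbert) (f : R -> H) (l : H) :
  is_lim (fun t => norm (minus (f t) l) ^ 2) p_infty 0 ->
  filterlim f (Rbar_locally p_infty) (locally l).
Proof.
intros Hf; apply (filterlim_locally_ball_norm (F := Rbar_locally p_infty) (U := H) f l); intros [d Hd].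
apply is_lim_spec in Hf. assert (Hd2 : 0 < d ^ 2) by (apply pow_lt; auto).
destruct (Hf (mkposreal _ Hd2)) as [T HT]; exists T; intros t Ht.
specialize (HT t Ht); simpl in HT; unfold ball_norm; simpl.
rewrite Rminus_0_r, Rabs_right in HT by (apply Rle_ge; simpl; generalize (norm_ge_0 (minus (f t) l)); nra).
apply Rlt_of_sq; auto.
Qed.

(** Parseval's identity turns norm convergence into convergence of a series of
    squared coordinates, to which dominated convergence applies.  The limit vector is
    built from the limit coordinates, so it need not be known beforehand. *)
Lemma cvg_of_coordinates (H : RealHilbert) (e : nat -> H) (he : orthonormal_basis e)
    (f : R -> H) (a M : nat -> R) :
  ex_series M -> (forall k t, 0 <= t -> ip (f t) (e k) ^ 2 <= M k) ->
  (forall k, is_lim (fun t => ip (f t) (e k)) p_infty (a k)) ->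
  exists l : H, (forall k, ip l (e k) = a k) /\
    filterlim f (Rbar_locally p_infty) (locally l).
Proof.
intros HM Hdom Hlim.
assert (Hsq : forall k, is_lim (fun t => ip (f t) (e k) ^ 2) p_infty (a k ^ 2)).
{ intros k. apply (is_lim_ext (fun t => ip (f t) (e k) * ip (f t) (e k))); [intros; ring|].
  replace (Finite (a k ^ 2)) with (Rbar_mult (a k) (a k)) by (simpl; f_equal; ring).
  apply is_lim_mult; simpl; auto. }
assert (HaM : forall k, a k ^ 2 <= M k).
{ intros k. apply (is_lim_le_loc (fun t => ip (f t) (e k) ^ 2) (fun _ => M k) p_infty (a k ^ 2) (M k)).
  - exists 0; intros t Ht; apply Hdom; lra.
  - auto.
  - apply is_lim_const. }
destruct (riesz_fischer H e he a M HM HaM) as [l [_ Hl]].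
{ intros k Hk. assert (E : Finite (a k) = Finite 0); [|injection E; auto].
  rewrite <- (is_lim_unique _ _ _ (Hlim k)).
  apply is_lim_unique. apply (is_lim_ext (fun _ => 0)); [|apply is_lim_const].
  intros t; rewrite Hk, ip_zero_r; auto. }
exists l; split; auto.
apply filterlim_of_norm_sq.
apply (is_lim_ext (fun t => Series (fun k => ip (minus (f t) l) (e k) ^ 2))).
{ intros t; apply is_series_unique, parseval_sq; auto. }
apply (tannery (fun k t => ip (minus (f t) l) (e k) ^ 2) (fun k => 4 * M k)).
- apply (ex_series_scal 4 M HM).
- intros k t Ht; split; [apply pow2_ge_0|].
  rewrite ip_minus_l, Hl. generalize (Hdom k t Ht) (HaM k); intros.
  assert (0 <= (ip (f t) (e k) + a k) ^ 2) by apply pow2_ge_0. lra.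
- intros k. apply (is_lim_ext (fun t => (ip (f t) (e k) - a k) * (ip (f t) (e k) - a k))).
  { intros t; rewrite ip_minus_l, Hl; ring. }
  replace (Finite 0) with (Rbar_mult (a k - a k) (a k - a k)) by (simpl; f_equal; ring).
  assert (is_lim (fun t => ip (f t) (e k) - a k) p_infty (a k - a k)).
  { apply is_lim_minus'; auto; apply is_lim_const. }
  apply is_lim_mult; simpl; auto.
Qed.

(** * Spectral facts *)

Section Spectral.
Variable H : RealHilbert.

Lemma self_adjoint_sym (T : operator H) x y :
  self_adjoint T -> dom T x -> dom T y -> ip (T x) y = ip x (T y).
Proof.
intros [_ Hs] Hx Hy. destruct (Hs y (T y)) as [_ Hb]. apply Hb; auto.
Qed.

Lemma eigen_coordinate (T : operator H) (mu : R) v x :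
  self_adjoint T -> dom T v -> T v = scal mu v -> dom T x ->
  ip (T x) v = mu * ip x v.
Proof.
intros HT Hv E Hx; rewrite (self_adjoint_sym T x v), E, ip_scal_r; auto.
Qed.

(** The vector w = S v - mu v satisfies S w = - mu w, which positivity of S
    forbids unless w = 0. *)
Lemma sqrt_eigenvector (A S : operator H) (mu : R) v :
  is_sqrt A S -> 0 < mu -> dom A v -> A v = scal (mu ^ 2) v ->
  dom S v /\ S v = scal mu v.
Proof.
intros (_ & Hpos & Hdom & Hsq) Hmu Hv E.
destruct (proj1 (Hdom v) Hv) as [HSv HSSv].
split; auto.
rewrite (Hsq v Hv) in E.
pose (w := plus (S v) (scal (- mu) v)).
assert (Hw : dom S w) by (apply dom_plus; auto; apply dom_scal; auto).
assert (ESw : S w = scal (- mu) w).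
{ unfold w. rewrite op_plus, op_scal, E by (auto; apply dom_scal; auto).
  apply ip_ext; intros z. rewrite ip_plus_l, !ip_scal_l, ip_plus_l, ip_scal_l; ring. }
generalize (Hpos w Hw). rewrite ESw, ip_scal_l; intros Hn.
assert (Hw0 : w = zero) by (apply ip_self_eq0; generalize (ip_self_nonneg H w); nra).
apply ip_ext; intros z. assert (Ez : ip w z = 0) by (rewrite Hw0; apply ip_zero_l).
unfold w in Ez; rewrite ip_plus_l, ip_scal_l in Ez. rewrite ip_scal_l; lra.
Qed.

Section Basis.
Variable e : nat -> H.
Hypothesis he : orthonormal_basis e.

(** Self-adjointness includes maximality of the domain, so it suffices to test
    against the domain of T, where Parseval's identity reduces to coordinates. *)
Lemma eigenspace_in_domain (T : operator H) (mu : nat -> R) (m : R) l :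
  self_adjoint T -> (forall k, dom T (e k) /\ T (e k) = scal (mu k) (e k)) ->
  (forall k, mu k <> m -> ip l (e k) = 0) -> dom T l /\ T l = scal m l.
Proof.
intros HT He Hl. apply (proj2 HT); intros x Hx.
rewrite <- (is_series_unique _ _ (parseval H e he (T x) l)).
rewrite <- (is_series_unique _ _ (parseval H e he x (scal m l))).
apply Series_ext; intros k. destruct (He k) as [Hd Ek].
rewrite (eigen_coordinate T (mu k)), ip_scal_l; auto.
destruct (Req_dec (mu k) m) as [->|Hk]; [ring|rewrite (Hl k Hk); ring].
Qed.

Variables (lam : nat -> R) (nu : R).

Lemma component_spec x : is_series (component_terms e lam nu x) (component e lam nu x) /\
  forall k, ip (component e lam nu x) (e k) = if Req_EM_T (lam k) nu then ip x (e k) else 0.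
Proof.
pose (a := fun k => if Req_EM_T (lam k) nu then ip x (e k) else 0).
assert (Eterms : forall k, scal (a k) (e k) = component_terms e lam nu x k).
{ intros k; unfold a, component_terms; destruct (Req_EM_T (lam k) nu); auto.
  apply (scal_zero_l (V := H)). }
destruct (riesz_fischer H e he a (fun k => ip x (e k) ^ 2)) as [l [Hs Hl]].
- exists (norm x ^ 2); apply parseval_sq; auto.
- intros k; unfold a; destruct (Req_EM_T (lam k) nu); [lra|].
  rewrite pow_i by auto; apply pow2_ge_0.
- intros k Hk; unfold a; destruct (Req_EM_T (lam k) nu); auto; rewrite Hk; apply ip_zero_r.
- assert (Hs' : is_series (component_terms e lam nu x) l).
  { apply is_series_ext with (2 := Hs); auto. }
  assert (E : component e lam nu x = l).
  { unfold component. apply (iota_filterlim_locally (V := H) (F := eventually)); exact Hs'. }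
  rewrite E; auto.
Qed.

Lemma in_eigenspace_of_coordinates l :
  (forall k, lam k <> nu -> ip l (e k) = 0) -> in_eigenspace e lam nu l.
Proof.
intros Hl; unfold in_eigenspace. destruct he as (_ & _ & Hs).
apply is_series_ext with (2 := Hs l); intros k; unfold component_terms.
destruct (Req_EM_T (lam k) nu) as [E|E]; auto.
rewrite (Hl k E); apply (scal_zero_l (V := H)).
Qed.

Lemma component_eq0 x :
  (forall k, lam k = nu -> ip x (e k) = 0) -> component e lam nu x = zero.
Proof.
intros Hx; apply (coordinates_ext H e he); intros k.
rewrite (proj2 (component_spec x)), ip_zero_l.
destruct (Req_EM_T (lam k) nu); auto.
Qed.

End Basis.
End Spectral.

(** * One-sided derivatives *)

(** Linear continuation to negative times: one-sided derivatives at 0 become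
    two-sided ones, so that the usual differential calculus applies on [0, +oo). *)
Definition extend (f df : R -> R) (t : R) : R := if Rle_dec 0 t then f t else f 0 + t * df 0.

Lemma extend_nonneg f df t : 0 <= t -> extend f df t = f t.
Proof. intros Ht; unfold extend; destruct (Rle_dec 0 t); [auto|lra]. Qed.

Lemma extend_at0 f df : extend f df 0 = f 0.
Proof. apply extend_nonneg; lra. Qed.

Lemma at_nonneg_proper t : 0 <= t -> ProperFilter (at_nonneg t).
Proof.
intros Ht; split.
- intros P [d Hd]; exists t; apply Hd; auto; apply ball_center.
- apply within_filter, locally_filter.
Qed.

Lemma at_nonneg_lim t : is_filter_lim (at_nonneg t) t.
Proof. intros P HP; unfold at_nonneg, within; revert HP; apply (filter_imp (F := locally t)); auto. Qed.

Lemma derive_extend (f df : R -> R) :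
  derive_nonneg (V := R_NormedModule) f df ->
  forall t, 0 <= t -> is_derive (extend f df) t (df t).
Proof.
intros Hf t Ht; destruct (Hf t Ht) as [Hlin Hd]; split; [exact Hlin|].
intros x Hx. apply (is_filter_lim_locally_unique (V := R_NormedModule)) in Hx; subst x.
intros eps. specialize (Hd t (at_nonneg_lim t) eps).
assert (Hl : locally t (fun y => 0 < t -> 0 < y)).
{ destruct (Rle_lt_or_eq_dec 0 t Ht) as [h|<-].
  - exists (mkposreal t h); intros y Hy _; apply Rabs_def2 in Hy; simpl in Hy.
    unfold minus, plus, opp in Hy; simpl in Hy; lra.
  - apply (filter_forall (F := locally 0)); intros y h; lra. }
generalize (filter_and (F := locally t) _ _ Hl Hd); apply (filter_imp (F := locally t)); intros y [Hy Hyd].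
unfold extend at 2. destruct (Rle_dec 0 t) as [h|]; [|lra].
unfold extend; destruct (Rle_dec 0 y) as [hy|hy]; [exact (Hyd hy)|].
assert (t = 0) by (destruct (Rle_lt_or_eq_dec 0 t Ht) as [h0|]; auto; specialize (Hy h0); lra).
subst t. 
assert (E : minus (minus (f 0 + y * df 0) (f 0)) (scal (minus y 0) (df 0)) = 0).
{ unfold minus, plus, opp, scal, mult; simpl; unfold mult; simpl; ring. }
match goal with |- norm ?z <= _ => replace z with (0 : R) end.
change (norm (V := R_NormedModule) (@zero R_NormedModule) <= eps * norm (minus y 0)).
rewrite norm_zero; apply Rmult_le_pos; [left; apply cond_pos|apply norm_ge_0].
Qed.

(** At t = 0 only positive increments are available, and they already determine
    the derivative. *)
Lemma derive_nonneg_zero (f df : R -> R) :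
  derive_nonneg (V := R_NormedModule) f df -> (forall t, 0 <= t -> f t = 0) ->
  forall t, 0 <= t -> df t = 0.
Proof.
intros Hf Hz t Ht. generalize (derive_extend f df Hf t Ht); intros D.
apply is_derive_Reals in D.
destruct (Req_dec (df t) 0) as [h|h]; auto.
destruct (D (Rabs (df t)) (Rabs_pos_lt _ h)) as [d Hd].
assert (Hd0 : 0 < d / 2) by (destruct d as [d hd]; simpl; lra).
specialize (Hd (d / 2)). rewrite !extend_nonneg, !Hz in Hd by lra.
replace ((0 - 0) / (d / 2) - df t) with (- df t) in Hd by (field; lra).
rewrite Rabs_Ropp in Hd.
exfalso; apply (Rlt_irrefl (Rabs (df t))), Hd; [lra|].
rewrite Rabs_right; destruct d as [d hd]; simpl in *; lra.
Qed.

Section VectorDerivative.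
Variable H : RealHilbert.

Lemma derive_nonneg_linear (V W : NormedModule R_AbsRing) (L : V -> W) (f df : R -> V) :
  is_linear L -> derive_nonneg f df ->
  derive_nonneg (fun t => L (f t)) (fun t => L (df t)).
Proof.
intros HL Hf t Ht; generalize (at_nonneg_proper t Ht); intros PF.
apply (filterdiff_ext_lin (F := at_nonneg t)) with (l1 := fun h : R => L (scal h (df t))).
- apply (filterdiff_comp (F := at_nonneg t) f L (fun h : R => scal h (df t)) L (Hf t Ht)).
  apply filterdiff_linear; auto.
- intros h; apply (linear_scal L HL).
Qed.

Lemma derive_nonneg_ip (f df : R -> H) w :
  derive_nonneg f df ->
  derive_nonneg (V := R_NormedModule) (fun t => ip (f t) w) (fun t => ip (df t) w).
Proof.
intros Hf; apply (derive_nonneg_linear H R_NormedModule (fun x => ip x w)); auto.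
apply ip_is_linear.
Qed.

Lemma filterdiff_norm_sq (a : H) :
  filterdiff (V := R_NormedModule) (fun x : H => norm x ^ 2) (locally a) (fun h => 2 * ip h a).
Proof.
split.
- apply (is_linear_ext (fun h : H => ip h (scal 2 a))).
  { intros h; apply ip_scal_r. }
  apply ip_is_linear.
- intros x Hx; apply (is_filter_lim_locally_unique (V := H)) in Hx; subst x; intros eps.
  apply (locally_le_locally_norm (V := H) a); exists eps; intros y Hy.
  unfold ball_norm in Hy.
  change (Rabs (norm y ^ 2 - norm a ^ 2 - 2 * ip (minus y a) a) <= eps * norm (minus y a)).
  replace (norm y ^ 2 - norm a ^ 2 - 2 * ip (minus y a) a) with (norm (minus y a) ^ 2).
  + generalize (norm_ge_0 (minus y a)); intros Hn.
    rewrite Rabs_right by (apply Rle_ge, pow2_ge_0). 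
    simpl pow; rewrite Rmult_1_r; apply Rmult_le_compat_r; [exact Hn|left; exact Hy].
  + rewrite <- !ip_norm. rewrite !ip_minus_l, !ip_minus_r, (ip_sym a y); ring.
Qed.

Lemma derive_nonneg_norm_sq (f df : R -> H) :
  derive_nonneg f df ->
  derive_nonneg (V := R_NormedModule) (fun t => norm (f t) ^ 2) (fun t => 2 * ip (df t) (f t)).
Proof.
intros Hf t Ht; generalize (at_nonneg_proper t Ht); intros PF.
apply (filterdiff_ext_lin (F := at_nonneg t)) with (l1 := fun h : R => 2 * ip (scal h (df t)) (f t)).
- apply (filterdiff_comp (F := at_nonneg t) (W := R_NormedModule) f (fun x : H => norm x ^ 2)
     (fun h : R => scal h (df t)) (fun h => 2 * ip h (f t)) (Hf t Ht)).
  apply (filterdiff_locally (F := filtermap f (at_nonneg t)) _ (f t));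
    [|apply filterdiff_norm_sq].
  apply (filterdiff_continuous_aux (F := at_nonneg t) f); [|apply at_nonneg_lim].
  eexists; exact (Hf t Ht).
- intros h; rewrite ip_scal_l. unfold scal; simpl; unfold mult; simpl; ring.
Qed.

Lemma derive_nonneg_unique (f g df dg : R -> H) :
  derive_nonneg f df -> derive_nonneg g dg -> (forall t, 0 <= t -> f t = g t) ->
  forall t, 0 <= t -> df t = dg t.
Proof.
intros Hf Hg E t Ht; apply ip_ext; intros w.
assert (D : derive_nonneg (V := R_NormedModule) (fun t => ip (f t) w - ip (g t) w)
              (fun t => ip (df t) w - ip (dg t) w)).
{ intros s Hs. generalize (at_nonneg_proper s Hs); intros PF.
  apply (filterdiff_ext_lin (F := at_nonneg s)) with
    (l1 := fun h : R_NormedModule => minus (scal h (ip (df s) w)) (scal h (ip (dg s) w))).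
  - apply (filterdiff_minus_fct (F := at_nonneg s) (V := R_NormedModule)
      (fun t => ip (f t) w) (fun t => ip (g t) w)).
    + exact (derive_nonneg_ip f df w Hf s Hs).
    + exact (derive_nonneg_ip g dg w Hg s Hs).
  - intros h; unfold minus, scal, plus, opp, mult; simpl; unfold mult; simpl; ring. }
generalize (derive_nonneg_zero _ _ D); intros Z.
specialize (Z ltac:(intros s Hs; rewrite (E s Hs); ring) t Ht); simpl in Z; lra.
Qed.

End VectorDerivative.

(** * Damped oscillators with a slowly decaying coefficient *)

(** The properties of b = |A^{1/2} u|^{2 gamma} that the linear analysis uses: it
    has size 1/(1+t) and its logarithmic slope is O(1/(1+t)).  B is its primitive. *)
Record slow_coefficient (c1 c2 c3 : R) (b db B : R -> R) : Prop := {
  slow_derive : forall t, 0 <= t -> is_derive b t (db t);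
  slow_prim : forall t, 0 <= t -> is_derive B t (b t);
  slow_prim0 : B 0 = 0;
  slow_lower : forall t, 0 <= t -> c1 / (1 + t) <= b t;
  slow_upper : forall t, 0 <= t -> b t <= c2 / (1 + t);
  slow_slope : forall t, 0 <= t -> Rabs (db t) <= c3 * b t / (1 + t)
}.

Arguments slow_derive {c1 c2 c3 b db B}.
Arguments slow_prim {c1 c2 c3 b db B}.
Arguments slow_prim0 {c1 c2 c3 b db B}.
Arguments slow_lower {c1 c2 c3 b db B}.
Arguments slow_upper {c1 c2 c3 b db B}.
Arguments slow_slope {c1 c2 c3 b db B}.

Record damped_mode (eps m : R) (b y dy ddy : R -> R) : Prop := {
  mode_derive1 : forall t, 0 <= t -> is_derive y t (dy t);
  mode_derive2 : forall t, 0 <= t -> is_derive dy t (ddy t);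
  mode_eq : forall t, 0 <= t -> eps * ddy t + m * b t * y t + dy t = 0
}.

Arguments mode_derive1 {eps m b y dy ddy}.
Arguments mode_derive2 {eps m b y dy ddy}.
Arguments mode_eq {eps m b y dy ddy}.

(** Bounds (1+t) |ka| and (1+t)^2 |et| for all modes with m <= L, where ka and et
    are the coupling coefficients of the rescaled mode. *)
Definition fast_slow_rate (c2 c3 L : R) : R := 2 * L * c2 + L * (c3 * c2 + L * c2 ^ 2).
Definition low_bound (c2 L : R) : R := 12 + 36 * (1 + L ^ 2 * c2 ^ 2).

(** Decay exponent required of the high modes.  As exp(- 2 n gamma B) is
    O(1/(1+t)), the excess 3 n gamma over n is worth (1+t)^{-3} in the squared
    coordinates. *)
Definition high_rate (n gamma : R) : R := n * (1 + 3 * gamma).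

Definition small_eps (n gamma c2 c3 eps : R) : Prop :=
  0 < eps <= 1 / 8 /\ 2 * eps * c3 <= 1 /\
  8 * high_rate n gamma * eps * c2 <= 1 /\
  8 * eps * fast_slow_rate c2 c3 (3 * high_rate n gamma) <= 1.

Definition energy_bound (n gamma c1 c2 : R) : R :=
  (3 * high_rate n gamma + 1) * low_bound c2 (3 * high_rate n gamma) + (2 / c1 + 3).

Section Coefficient.
Variables (c1 c2 c3 : R) (b db B : R -> R).
Hypothesis hc1 : 0 < c1.
Hypothesis hc2 : 0 < c2.
Hypothesis hc3 : 0 < c3.
Hypothesis hb : slow_coefficient c1 c2 c3 b db B.

Lemma slow_pos t : 0 <= t -> 0 < b t.
Proof.
intros Ht; eapply Rlt_le_trans; [|apply (slow_lower hb t Ht)].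
apply Rdiv_lt_0_compat; lra.
Qed.

Lemma slow_le t : 0 <= t -> b t <= c2.
Proof.
intros Ht; eapply Rle_trans; [apply (slow_upper hb t Ht)|].
apply div_le_self; lra.
Qed.

Lemma slow_prim_ge t : 0 <= t -> c1 * ln (1 + t) <= B t.
Proof.
intros Ht.
enough (B 0 - c1 * ln (1 + 0) <= B t - c1 * ln (1 + t)) as E.
{ rewrite (slow_prim0 hb), Rplus_0_r, ln_1 in E; lra. }
apply (nondecreasing_on_nonneg (fun t => B t - c1 * ln (1 + t))
        (fun t => b t - c1 * / (1 + t))); [| |lra].
- intros s Hs. auto_derive.
  + repeat split; [exists (b s); apply (slow_prim hb s Hs)|lra].
  + use_derivative (slow_prim hb s Hs); ring.
- intros s Hs; generalize (slow_lower hb s Hs); unfold Rdiv; lra.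
Qed.

Lemma slow_prim_nonneg t : 0 <= t -> 0 <= B t.
Proof.
intros Ht; eapply Rle_trans; [|apply slow_prim_ge; auto].
apply Rmult_le_pos; [lra|].
rewrite <- ln_1; destruct (Rle_lt_or_eq_dec _ _ Ht) as [H|<-].
- left; apply ln_increasing; lra.
- rewrite Rplus_0_r; lra.
Qed.

Section Mode.
Variables (eps m : R) (y dy ddy : R -> R).
Hypothesis heps : 0 < eps.
Hypothesis hy : damped_mode eps m b y dy ddy.

Lemma mode_ddy t : 0 <= t -> ddy t = - (m * b t * y t + dy t) / eps.
Proof.
intros Ht; generalize (mode_eq hy t Ht); intros E.
apply (Rmult_eq_reg_l eps); [|lra]; field_simplify; lra.
Qed.

(** Lyapunov functional: the natural energy eps y'^2/b + m y^2 plus 4 p times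
    eps y y' + y^2/2.  The natural energy dissipates only y'^2, and the added term
    dissipates y^2.  The conditions on eps keep the cross terms subordinate to the
    main ones; m >= 3 p leaves room for the rate 2 p b.  With p = 0 it says that
    the energy stays bounded by the initial one, which gives uniqueness. *)
Lemma energy_decay (p : R) (hp : 0 <= p) (hm : 3 * p <= m)
    (h3 : 2 * eps * c3 <= 1) (h2 : 8 * p * eps * c2 <= 1) t :
  0 <= t ->
  exp (2 * p * B t) * (eps * dy t ^ 2 / (2 * b t) + m * y t ^ 2)
    <= 2 * eps * dy 0 ^ 2 / b 0 + 3 * m * y 0 ^ 2.
Proof.
intros Ht.
pose (G := fun s => eps * dy s ^ 2 / b s + m * y s ^ 2
                    + 4 * p * (eps * y s * dy s + y s ^ 2 / 2)).
assert (Hpb : forall s, 0 <= s -> 0 <= p * eps * b s <= 1 / 8).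
{ intros s Hs; generalize (slow_pos s Hs) (slow_le s Hs); intros.
  assert (0 <= p * eps) by (apply Rmult_le_pos; lra). nra. }
assert (Hmono : exp (2 * p * B t) * G t <= exp (2 * p * B 0) * G 0).
{ apply (nonincreasing_on_nonneg (fun s => exp (2 * p * B s) * G s)
   (fun s => exp (2 * p * B s) * (2 * p * b s * G s +
      (eps * (2 * dy s * ddy s) / b s - eps * dy s ^ 2 * db s / b s ^ 2
       + m * (2 * y s * dy s)
       + 4 * p * (eps * dy s * dy s + eps * y s * ddy s + y s * dy s))))); [| |lra].
  - intros s Hs; unfold G. generalize (slow_pos s Hs); intros Hb.
    generalize (slow_derive hb s Hs) (slow_prim hb s Hs)
      (mode_derive1 hy s Hs) (mode_derive2 hy s Hs).
    intros D1 D2 D3 D4. auto_derive.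
    + repeat split; try (eexists; eassumption); lra.
    + use_derivative D1; use_derivative D2; use_derivative D3; use_derivative D4.
      field; lra.
  - intros s Hs. apply Rmult_nonneg_nonpos; [left; apply exp_pos|].
    generalize (slow_pos s Hs) (Hpb s Hs) (slow_slope hb s Hs); intros Hb Hh Hsl.
    assert (Hr : - (eps * (db s / b s)) <= 1 / 2).
    { assert (Rabs (db s) <= c3 * b s).
      { eapply Rle_trans; [exact Hsl|]. apply div_le_self; nra. }
      generalize (Rle_abs (- db s)); rewrite Rabs_Ropp; intros.
      apply (Rmult_le_reg_r (b s)); [auto|].
      replace (- (eps * (db s / b s)) * b s) with (eps * (- db s)) by (field; lra).
      nra. }
    rewrite (mode_ddy s Hs); unfold G.
    (* With v = y'/b the derivative is b times a quadratic form in v and y. *)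
    set (r := eps * (db s / b s)) in *; set (h := p * eps * b s) in *.
    set (v := dy s / b s).
    assert (Ev : dy s = v * b s) by (unfold v; field; lra).
    replace (2 * p * b s * _ + _) with
      (b s * (v ^ 2 * (- 2 - r + 6 * h) + y s ^ 2 * (4 * p ^ 2 - 2 * p * m)
              + 8 * h * (p * y s) * v))
     by (unfold r, h; rewrite Ev; field; lra).
    rewrite <- (Rmult_0_r (b s)); apply Rmult_le_compat_l; [lra|].
    assert (8 * h * (p * y s) * v <= ((p * y s) ^ 2 + v ^ 2) / 2).
    { assert (0 <= (p * y s - v) ^ 2) by apply pow2_ge_0.
      assert (0 <= (p * y s + v) ^ 2) by apply pow2_ge_0.
      nra. }
    assert (y s ^ 2 * (4 * p ^ 2 - 2 * p * m) <= - 2 * (p * y s) ^ 2).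
    { assert (0 <= y s ^ 2) by apply pow2_ge_0.
      assert (p * (3 * p) <= p * m) by (apply Rmult_le_compat_l; lra).
      replace (- 2 * (p * y s) ^ 2) with (y s ^ 2 * (4 * p ^ 2 - 2 * (p * (3 * p)))) by ring.
      apply Rmult_le_compat_l; lra. }
    assert (v ^ 2 * (- 2 - r + 6 * h) <= - 3 / 4 * v ^ 2).
    { assert (0 <= v ^ 2) by apply pow2_ge_0. nra. }
    assert (0 <= v ^ 2) by apply pow2_ge_0.
    assert (0 <= (p * y s) ^ 2) by apply pow2_ge_0. lra. }
assert (Hcross : forall s, 0 <= s -> - (eps * dy s ^ 2 / (2 * b s)) / 2 - 2 * p * y s ^ 2
          <= 4 * p * (eps * y s * dy s) <= eps * dy s ^ 2 / (2 * b s) / 2 + 2 * p * y s ^ 2).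
{ intros s Hs; generalize (slow_pos s Hs) (Hpb s Hs); intros Hb Hh.
  assert (E : 2 * p * (eps * dy s) ^ 2 <= eps * dy s ^ 2 / (2 * b s) / 2).
  { replace (2 * p * (eps * dy s) ^ 2) with (eps * dy s ^ 2 / b s * (2 * (p * eps * b s)))
      by (field; lra).
    assert (0 <= eps * dy s ^ 2 / b s).
    { apply Rdiv_le_0_compat; auto; apply Rmult_le_pos; [lra|apply pow2_ge_0]. }
    replace (eps * dy s ^ 2 / (2 * b s) / 2) with (eps * dy s ^ 2 / b s * (1 / 4)) by (field; lra).
    apply Rmult_le_compat_l; lra. }
  assert (0 <= p * (y s - eps * dy s) ^ 2) by (apply Rmult_le_pos; [lra|apply pow2_ge_0]).
  assert (0 <= p * (y s + eps * dy s) ^ 2) by (apply Rmult_le_pos; [lra|apply pow2_ge_0]).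
  split; nra. }
rewrite (slow_prim0 hb), Rmult_0_r, exp_0, Rmult_1_l in Hmono.
assert (Hhalf : forall s, 0 <= s -> eps * dy s ^ 2 / b s = 2 * (eps * dy s ^ 2 / (2 * b s))).
{ intros s Hs; generalize (slow_pos s Hs); intros; field; lra. }
assert (Hpos : forall s, 0 <= s -> 0 <= eps * dy s ^ 2 / (2 * b s)).
{ intros s Hs; generalize (slow_pos s Hs); intros.
  apply Rdiv_le_0_compat; [|lra]; apply Rmult_le_pos; [lra|apply pow2_ge_0]. }
assert (Rle 0 0) as H0 by lra.
eapply Rle_trans; [|eapply Rle_trans; [apply Hmono|]].
- apply Rmult_le_compat_l; [left; apply exp_pos|].
  unfold G; rewrite (Hhalf t Ht).
  generalize (Hcross t Ht) (Hpos t Ht); lra.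
- unfold G. replace (2 * eps * dy 0 ^ 2 / b 0) with (2 * (eps * dy 0 ^ 2 / b 0)) by (unfold Rdiv; ring).
  rewrite (Hhalf 0 H0).
  generalize (Hcross 0 H0) (Hpos 0 H0).
  assert (3 * p * y 0 ^ 2 <= m * y 0 ^ 2) by (apply Rmult_le_compat_r; [apply pow2_ge_0|lra]).
  assert (0 <= p * y 0 ^ 2) by (apply Rmult_le_pos; [lra|apply pow2_ge_0]).
  lra.
Qed.

Lemma mode_zero (hm : 0 < m) (h3 : 2 * eps * c3 <= 1) :
  y 0 = 0 -> dy 0 = 0 -> forall t, 0 <= t -> y t = 0 /\ dy t = 0.
Proof.
intros Hy Hdy t Ht.
generalize (energy_decay 0 ltac:(lra) ltac:(lra) h3 ltac:(lra) t Ht).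
rewrite Hy, Hdy; replace (2 * 0 * B t) with 0 by ring; rewrite exp_0.
replace (2 * eps * 0 ^ 2 / b 0 + 3 * m * 0 ^ 2) with 0
  by (generalize (slow_pos 0 ltac:(lra)); intros; field; lra).
generalize (slow_pos t Ht); intros Hb E.
assert (0 <= y t ^ 2) by apply pow2_ge_0.
assert (0 <= dy t ^ 2) by apply pow2_ge_0.
assert (0 <= eps * dy t ^ 2 / (2 * b t)).
{ apply Rdiv_le_0_compat; [|lra]; apply Rmult_le_pos; lra. }
assert (0 <= m * y t ^ 2) by (apply Rmult_le_pos; lra).
split.
- apply Rsqr_0_uniq; unfold Rsqr; apply (Rmult_eq_reg_l m); lra.
- apply Rsqr_0_uniq; unfold Rsqr; apply (Rmult_eq_reg_l (eps / (2 * b t))).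
  + replace (eps / (2 * b t) * (dy t * dy t)) with (eps * dy t ^ 2 / (2 * b t)) by (field; lra). lra.
  + apply Rgt_not_eq, Rdiv_lt_0_compat; lra.
Qed.

End Mode.

Lemma exp_prim_vanishes a : 0 < a -> is_lim (fun t => exp (- (a * B t))) p_infty 0.
Proof.
intros Ha.
assert (HB : is_lim B p_infty p_infty).
{ apply (is_lim_le_p_loc (fun t => c1 * ln (1 + t))).
  - exists 0; intros t Ht; apply (slow_prim_ge); lra.
  - apply is_lim_scal_pos_infty; auto.
    apply (is_lim_comp ln (fun t => 1 + t) p_infty p_infty p_infty).
    + apply is_lim_ln_p.
    + apply (is_lim_plus (fun _ => 1) (fun t => t) p_infty 1 p_infty p_infty);
        [apply is_lim_const|apply is_lim_id|reflexivity].
    + exists 0; intros; discriminate. }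
apply (is_lim_comp exp (fun t => - (a * B t)) p_infty 0 m_infty).
- apply is_lim_exp_m.
- apply (is_lim_opp (fun t => a * B t) p_infty p_infty), is_lim_scal_pos_infty; auto.
- exists 0; intros; discriminate.
Qed.

Section LowMode.
Variables (eps L m : R) (y dy ddy : R -> R).
Hypothesis heps : 0 < eps <= 1 / 8.
Hypothesis hm : 0 <= m <= L.
Hypothesis hec : 8 * eps * fast_slow_rate c2 c3 L <= 1.
Hypothesis hy : damped_mode eps m b y dy ddy.

Let c := fast_slow_rate c2 c3 L.
Let Y t := exp (m * B t) * y t.
Let Z t := exp (m * B t) * (dy t + m * b t * y t).
Let X t := Y t + eps * Z t.
Let et t := m * (db t - m * b t ^ 2).
Let ka t := 2 * m * b t - eps * et t.

Lemma fast_slow_rate_nonneg : 0 <= c.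
Proof.
unfold c, fast_slow_rate. assert (0 <= c2 ^ 2) by apply pow2_ge_0.
assert (0 <= L * c2) by (apply Rmult_le_pos; lra).
assert (0 <= L * (c3 * c2 + L * c2 ^ 2)).
{ apply Rmult_le_pos; [lra|]. apply Rplus_le_le_0_compat; apply Rmult_le_pos; lra. }
lra.
Qed.

Lemma fast_slow_et t : 0 <= t ->
  Rabs (et t) <= L * (c3 * c2 + L * c2 ^ 2) / (1 + t) ^ 2.
Proof.
intros Ht; unfold et.
pose (i := / (1 + t)).
assert (Hi : 0 < i <= 1) by (apply inv_shift_bounds; auto).
generalize (slow_pos t Ht) (slow_upper hb t Ht)
  (slow_slope hb t Ht); intros Hb0 Hb1 Hdb.
replace (L * (c3 * c2 + L * c2 ^ 2) / (1 + t) ^ 2) with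
  (L * (c3 * (c2 * i) * i + L * (c2 * i) ^ 2)) by (unfold i; field; lra).
replace (c2 / (1 + t)) with (c2 * i) in Hb1 by reflexivity.
replace (c3 * b t / (1 + t)) with (c3 * b t * i) in Hdb by reflexivity.
rewrite Rabs_mult, (Rabs_right m) by lra.
apply Rmult_le_compat; [lra|apply Rabs_pos|lra|].
eapply Rle_trans; [apply Rabs_triang|]; rewrite Rabs_Ropp.
assert (0 <= b t ^ 2) by apply pow2_ge_0.
rewrite (Rabs_right (m * b t ^ 2)) by (apply Rle_ge, Rmult_le_pos; lra).
apply Rplus_le_compat.
- eapply Rle_trans; [exact Hdb|]. apply Rmult_le_compat_r; [lra|].
  apply Rmult_le_compat_l; lra.
- apply Rmult_le_compat; try lra. apply pow_incr; lra.
Qed.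

(** Here et = m (b' - m b^2): after removing the factor exp(- m B), the slow
    equation is solved up to the error eps et Y, and b' and b^2 are both
    O((1+t)^{-2}). *)
Lemma fast_slow_system :
  (forall t, 0 <= t -> is_derive X t (eps * (ka t * Z t + et t * X t))) /\
  (forall t, 0 <= t -> is_derive Z t (- Z t / eps + (ka t * Z t + et t * X t))) /\
  (forall t, 0 <= t -> Rabs (ka t) <= c / (1 + t)) /\
  (forall t, 0 <= t -> Rabs (et t) <= c / (1 + t) ^ 2).
Proof.
assert (HLc : 0 <= L * (c3 * c2 + L * c2 ^ 2)).
{ assert (0 <= c2 ^ 2) by apply pow2_ge_0. apply Rmult_le_pos; [lra|].
  apply Rplus_le_le_0_compat; apply Rmult_le_pos; lra. }
assert (Hlc : 0 <= L * c2) by (apply Rmult_le_pos; lra).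
assert (HZ : forall t, 0 <= t -> is_derive Z t (- Z t / eps + (ka t * Z t + et t * X t))).
{ intros t Ht; unfold X, ka, et, Z, Y.
  generalize (slow_derive hb t Ht) (slow_prim hb t Ht)
      (mode_derive1 hy t Ht) (mode_derive2 hy t Ht).
  intros D1 D2 D3 D4. auto_derive.
  - repeat split; eexists; eassumption.
  - use_derivative D1; use_derivative D2; use_derivative D3; use_derivative D4.
    rewrite (mode_ddy _ _ _ _ _ (proj1 heps) hy t Ht). field; lra. }
split; [|split; [exact HZ|split]].
- intros t Ht. generalize (HZ t Ht); intros DZ.
  generalize (slow_prim hb t Ht) (mode_derive1 hy t Ht).
  intros D2 D3. unfold X at 1, Y at 1. auto_derive.
  + repeat split; try (eexists; eassumption).
  + use_derivative DZ; use_derivative D2; use_derivative D3.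
    unfold X, ka, et, Z, Y; field; lra.
- intros t Ht; generalize (fast_slow_et t Ht); intros He.
  generalize (slow_pos t Ht) (slow_upper hb t Ht); intros Hb0 Hb1.
  unfold ka. eapply Rle_trans; [apply Rabs_triang|].
  rewrite Rabs_Ropp, (Rabs_mult eps), (Rabs_right eps) by lra.
  rewrite (Rabs_right (2 * m * b t)) by (apply Rle_ge; repeat apply Rmult_le_pos; lra).
  unfold c, fast_slow_rate, Rdiv; rewrite Rmult_plus_distr_r; apply Rplus_le_compat.
  + replace (2 * L * c2 * / (1 + t)) with (2 * (L * (c2 / (1 + t)))) by (unfold Rdiv; ring).
    rewrite Rmult_assoc; apply Rmult_le_compat_l; [lra|]. apply Rmult_le_compat; lra.
  + apply Rle_trans with (1 * Rabs (et t)).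
    { apply Rmult_le_compat_r; [apply Rabs_pos|lra]. }
    rewrite Rmult_1_l; eapply Rle_trans; [exact He|].
    apply Rmult_le_compat_l; auto. apply Rinv_le_contravar; nra.
- intros t Ht; eapply Rle_trans; [apply fast_slow_et; auto|].
  unfold c, fast_slow_rate, Rdiv; apply Rmult_le_compat_r; [|lra].
  left; apply Rinv_0_lt_compat, pow_lt; lra.
Qed.

Lemma low_mode_initial :
  Y 0 = y 0 /\ Z 0 = dy 0 + m * b 0 * y 0 /\
  Rabs (Z 0) <= Rabs (dy 0) + L * c2 * Rabs (y 0).
Proof.
unfold Y, Z; rewrite (slow_prim0 hb), Rmult_0_r, exp_0.
repeat split; try ring.
generalize (slow_pos 0 (Rle_refl 0)) (slow_le 0 (Rle_refl 0)); intros.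
rewrite Rmult_1_l; eapply Rle_trans; [apply Rabs_triang|]; apply Rplus_le_compat_l.
rewrite !Rabs_mult, (Rabs_right m), (Rabs_right (b 0)) by lra.
apply Rmult_le_compat_r; [apply Rabs_pos|]. apply Rmult_le_compat; lra.
Qed.

Lemma low_mode_bound t : 0 <= t ->
  Y t ^ 2 <= low_bound c2 L * (dy 0 ^ 2 + y 0 ^ 2) /\
  (1 + t) ^ 4 * Z t ^ 2 <= low_bound c2 L * (dy 0 ^ 2 + y 0 ^ 2).
Proof.
intros Ht.
destruct fast_slow_system as (hX & hZ & hka & het).
generalize (fast_slow_bounded _ _ _ _ _ _ heps fast_slow_rate_nonneg hec hX hZ hka het t Ht)
  (fast_slow_decay _ _ _ _ _ _ heps fast_slow_rate_nonneg hec hX hZ hka het t Ht).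
destruct low_mode_initial as (EY & EZ & _).
generalize (slow_pos 0 (Rle_refl 0)) (slow_le 0 (Rle_refl 0)); intros.
assert (HZ0 : Z 0 ^ 2 <= 2 * dy 0 ^ 2 + 2 * (L ^ 2 * c2 ^ 2) * y 0 ^ 2).
{ rewrite EZ. assert ((m * b 0) ^ 2 <= L ^ 2 * c2 ^ 2).
  { rewrite <- Rpow_mult_distr. apply pow_incr; split; [apply Rmult_le_pos; lra|].
    apply Rmult_le_compat; lra. }
  assert (0 <= y 0 ^ 2) by apply pow2_ge_0.
  assert ((m * b 0) ^ 2 * y 0 ^ 2 <= L ^ 2 * c2 ^ 2 * y 0 ^ 2) by (apply Rmult_le_compat_r; lra).
  assert (0 <= (dy 0 - m * b 0 * y 0) ^ 2) by apply pow2_ge_0. lra. }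
assert (0 <= Z 0 ^ 2) by apply pow2_ge_0.
assert (0 <= Z t ^ 2) by apply pow2_ge_0.
assert (HX0 : X 0 ^ 2 + eps * Z 0 ^ 2 <= 2 * y 0 ^ 2 + 3 * Z 0 ^ 2).
{ unfold X; rewrite EY. assert (0 <= (y 0 - eps * Z 0) ^ 2) by apply pow2_ge_0.
  assert (eps * Z 0 ^ 2 <= 1 * Z 0 ^ 2) by (apply Rmult_le_compat_r; lra).
  assert (eps * (eps * Z 0 ^ 2) <= 1 * (1 * Z 0 ^ 2)) by (apply Rmult_le_compat; nra). lra. }
assert (HY : Y t ^ 2 <= 2 * (X t ^ 2 + eps * Z t ^ 2)).
{ replace (Y t) with (X t - eps * Z t) by (unfold X; ring).
  assert (0 <= (X t + eps * Z t) ^ 2) by apply pow2_ge_0.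
  assert (eps * (eps * Z t ^ 2) <= 1 * (eps * Z t ^ 2)) by (apply Rmult_le_compat_r; nra). lra. }
assert (0 <= y 0 ^ 2) by apply pow2_ge_0. assert (0 <= dy 0 ^ 2) by apply pow2_ge_0.
assert (0 <= L ^ 2 * c2 ^ 2) by (apply Rmult_le_pos; apply pow2_ge_0).
assert (0 <= L ^ 2 * c2 ^ 2 * dy 0 ^ 2) by (apply Rmult_le_pos; lra).
assert (0 <= L ^ 2 * c2 ^ 2 * y 0 ^ 2) by (apply Rmult_le_pos; lra).
unfold low_bound; split; lra.
Qed.

Lemma fast_part_vanishes : is_lim (fun t => (1 + t) * Z t) p_infty 0.
Proof.
apply (is_lim_0_of_square _ (fun t => / (1 + t)) (low_bound c2 L * (dy 0 ^ 2 + y 0 ^ 2)));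
  [|apply is_lim_inv_shift].
intros t Ht; destruct (low_mode_bound t Ht) as [_ H].
set (K := low_bound c2 L * (dy 0 ^ 2 + y 0 ^ 2)) in *.
apply (Rmult_le_reg_r (1 + t)); [lra|].
replace (K * / (1 + t) * (1 + t)) with K by (field; lra).
eapply Rle_trans; [|exact H].
replace (((1 + t) * Z t) ^ 2 * (1 + t)) with ((1 + t) ^ 3 * Z t ^ 2) by ring.
apply Rmult_le_compat_r; [apply pow2_ge_0|]. apply Rle_pow; [lra|auto].
Qed.

Lemma low_mode_cvg : exists l : R, is_lim X p_infty l /\ is_lim Y p_infty l.
Proof.
destruct fast_slow_system as (hX & hZ & hka & het).
destruct (fast_slow_cvg _ _ _ _ _ _ heps fast_slow_rate_nonneg hec hX hZ hka het) as [l Hl].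
exists l; split; auto.
apply (is_lim_ext_nonneg (fun t => X t - eps * (/ (1 + t) * ((1 + t) * Z t)))).
{ intros t Ht; unfold X; field; lra. }
replace (Finite l) with (Finite (l - eps * (0 * 0))) by (f_equal; ring).
apply is_lim_minus'; auto.
apply (is_lim_scal_l _ eps p_infty (0 * 0)).
apply (is_lim_mult _ _ _ 0 0); [apply is_lim_inv_shift|apply fast_part_vanishes|exact I].
Qed.

(** Y differs from X by eps Z, which is O(sqrt eps) by the energy bound, and X
    drifts by O(eps).  The three smallness conditions bound the drift, the initial
    correction and the current correction by |y(0)|/8 each. *)
Lemma low_mode_persists q :
  q = Rabs (y 0) + 2 * (Rabs (dy 0) + L * c2 * Rabs (y 0)) ->
  56 * eps * c * q <= Rabs (y 0) -> 8 * eps * q <= Rabs (y 0) ->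
  192 * eps * q ^ 2 <= y 0 ^ 2 -> y 0 <> 0 ->
  forall t, 0 <= t -> Rabs (y 0) / 2 <= Rabs (Y t).
Proof.
intros Eq H1 H2 H3 Hy t Ht.
destruct fast_slow_system as (hX & hZ & hka & het).
destruct low_mode_initial as (EY & EZ & Hz0).
assert (Hy0 : 0 < Rabs (y 0)) by (apply Rabs_pos_lt; auto).
assert (0 <= L * c2 * Rabs (y 0)) by (repeat apply Rmult_le_pos; lra).
generalize (Rabs_pos (dy 0)); intros.
set (z := Rabs (dy 0) + L * c2 * Rabs (y 0)) in *.
assert (Hq : 0 < q) by (rewrite Eq; unfold z; lra).
assert (HX0a : Rabs (X 0) <= Rabs (y 0) + z).
{ unfold X; rewrite EY; eapply Rle_trans; [apply Rabs_triang|].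
  rewrite Rabs_mult, (Rabs_right eps) by lra. generalize (Rabs_pos (Z 0)); nra. }
assert (HQ0 : X 0 ^ 2 + eps * Z 0 ^ 2 <= q ^ 2).
{ rewrite <- (pow2_abs (X 0)), <- (pow2_abs (Z 0)).
  generalize (Rabs_pos (Z 0)) (Rabs_pos (X 0)); intros.
  assert (Rabs (X 0) ^ 2 <= (Rabs (y 0) + z) ^ 2) by (apply pow_incr; lra).
  assert (Rabs (Z 0) ^ 2 <= z ^ 2) by (apply pow_incr; lra).
  assert (0 <= Rabs (Z 0) ^ 2) by apply pow2_ge_0.
  assert (eps * Rabs (Z 0) ^ 2 <= 1 * Rabs (Z 0) ^ 2) by (apply Rmult_le_compat_r; lra).
  rewrite Eq. assert (0 <= z) by (unfold z; lra).
  assert (0 <= Rabs (y 0) * z) by (apply Rmult_le_pos; lra).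
  assert (0 <= z ^ 2) by apply pow2_ge_0. lra. }
generalize (fast_slow_drift _ _ _ _ _ _ heps fast_slow_rate_nonneg hec hX hZ hka het q t Hq HQ0 Ht)
  (fast_slow_bounded _ _ _ _ _ _ heps fast_slow_rate_nonneg hec hX hZ hka het t Ht).
intros Hd HQ.
assert (HZt : eps * Rabs (Z t) <= Rabs (y 0) / 8).
{ assert (E : (eps * Rabs (Z t)) ^ 2 <= (Rabs (y 0) / 8) ^ 2).
  { replace ((Rabs (y 0) / 8) ^ 2) with (y 0 ^ 2 / 64) by (rewrite <- (pow2_abs (y 0)); field).
    replace ((eps * Rabs (Z t)) ^ 2) with (eps * (eps * Z t ^ 2))
      by (rewrite <- (pow2_abs (Z t)); ring).
    assert (0 <= X t ^ 2) by apply pow2_ge_0.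
    assert (eps * (eps * Z t ^ 2) <= eps * (3 * q ^ 2)) by (apply Rmult_le_compat_l; lra). lra. }
  apply Rsqr_incr_0; [|apply Rmult_le_pos; [lra|apply Rabs_pos]|lra].
  unfold Rsqr; lra. }
assert (HZ0 : eps * Rabs (Z 0) <= Rabs (y 0) / 8).
{ assert (eps * Rabs (Z 0) <= eps * q) by (apply Rmult_le_compat_l; [lra|unfold z in *; lra]). lra. }
assert (E : Y t = y 0 + (X t - X 0) - eps * Z t + eps * Z 0) by (unfold X; rewrite EY; ring).
rewrite E.
assert (T : Rabs (y 0) <= Rabs (y 0 + (X t - X 0) - eps * Z t + eps * Z 0) + Rabs (X t - X 0)
          + eps * Rabs (Z t) + eps * Rabs (Z 0)).
{ rewrite <- (Rabs_right eps) at 3 4 by lra; rewrite <- !Rabs_mult.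
  unfold Rabs; repeat destruct Rcase_abs; lra. }
unfold c in *; lra.
Qed.

(** When y(0) = 0, one has X(0) = eps y'(0), while the square root of the
    initial energy is of order sqrt eps |y'(0)|; so the drift is O(eps^{3/2}) and cannot
    cancel X(0). *)
Lemma low_mode_kicked :
  392 * c ^ 2 * eps <= 1 -> y 0 = 0 ->
  forall t, 0 <= t -> eps * Rabs (dy 0) / 2 <= Rabs (X t).
Proof.
intros H1 Hy t Ht.
destruct (Req_dec (dy 0) 0) as [->|Hdy].
{ rewrite Rabs_R0; generalize (Rabs_pos (X t)); lra. }
destruct fast_slow_system as (hX & hZ & hka & het).
destruct low_mode_initial as (EY & EZ & _).
assert (Hd0 : 0 < Rabs (dy 0)) by (apply Rabs_pos_lt; auto).
assert (EX : X 0 = eps * dy 0) by (unfold X; rewrite EY, EZ, Hy; ring).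
assert (Hs : 0 < sqrt (2 * eps)) by (apply sqrt_lt_R0; lra).
assert (Es : sqrt (2 * eps) ^ 2 = 2 * eps) by (apply pow2_sqrt; lra).
set (s := sqrt (2 * eps)) in *.
assert (HQ0 : X 0 ^ 2 + eps * Z 0 ^ 2 <= (s * Rabs (dy 0)) ^ 2).
{ rewrite Rpow_mult_distr, Es, pow2_abs, EX, EZ, Hy.
  assert (0 <= dy 0 ^ 2) by apply pow2_ge_0.
  assert (eps * dy 0 ^ 2 <= 1 * dy 0 ^ 2) by (apply Rmult_le_compat_r; lra).
  assert (eps * (eps * dy 0 ^ 2) <= eps * (1 * dy 0 ^ 2)) by (apply Rmult_le_compat_l; lra). lra. }
generalize (fast_slow_drift _ _ _ _ _ _ heps fast_slow_rate_nonneg hec hX hZ hka het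
   (s * Rabs (dy 0)) t (Rmult_lt_0_compat _ _ Hs Hd0) HQ0 Ht). fold c; intros Hd.
generalize fast_slow_rate_nonneg; intros Hc.
assert (Hcs : 14 * (c * s) <= 1).
{ assert ((14 * (c * s)) ^ 2 <= 1 ^ 2).
  { replace ((14 * (c * s)) ^ 2) with (196 * c ^ 2 * s ^ 2) by ring. rewrite Es; lra. }
  apply Rsqr_incr_0; [unfold Rsqr; lra| |lra]. repeat apply Rmult_le_pos; lra. }
assert (7 * c * eps * (s * Rabs (dy 0)) <= eps * Rabs (dy 0) / 2).
{ replace (7 * c * eps * (s * Rabs (dy 0))) with (14 * (c * s) * (eps * Rabs (dy 0) / 2)) by field.
  rewrite <- (Rmult_1_l (eps * Rabs (dy 0) / 2)) at 2.
  apply Rmult_le_compat_r; auto. assert (0 < eps * Rabs (dy 0)) by (apply Rmult_lt_0_compat; lra). lra. }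
assert (Rabs (X 0) = eps * Rabs (dy 0)) by (rewrite EX, Rabs_mult, (Rabs_right eps); lra).
assert (Rabs (X 0) <= Rabs (X t) + Rabs (X t - X 0)).
{ unfold Rabs; repeat destruct Rcase_abs; lra. }
lra.
Qed.

End LowMode.

Section Spectrum.
Variables (n gamma eps : R).
Hypothesis hn : 0 < n.
Hypothesis hgamma : 0 < gamma.
Hypothesis hsmall : small_eps n gamma c2 c3 eps.

Let p := high_rate n gamma.
Let L := 3 * p.
Let CL := low_bound c2 L.

Lemma high_rate_gt : n < p.
Proof. unfold p, high_rate; nra. Qed.

Lemma low_bound_pos : 0 < CL.
Proof.
unfold CL, low_bound. assert (0 <= L ^ 2 * c2 ^ 2) by (apply Rmult_le_pos; apply pow2_ge_0). lra.
Qed.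

Lemma high_mode_bound m y dy ddy t :
  L <= m -> damped_mode eps m b y dy ddy -> 0 <= t ->
  exp (2 * p * B t) * (eps * dy t ^ 2 / (2 * b t) + m * y t ^ 2)
    <= (2 / c1 + 3) * (dy 0 ^ 2 + m * y 0 ^ 2).
Proof.
intros Hm hy Ht; destruct hsmall as (he & h3 & h2 & _); generalize high_rate_gt; intros Hp.
eapply Rle_trans.
- apply (energy_decay eps m y dy ddy (proj1 he) hy p); auto; try lra;
    unfold p, L in *; lra.
- assert (Hb0 : c1 <= b 0).
  { generalize (slow_lower hb 0 (Rle_refl 0)).
    replace (c1 / (1 + 0)) with c1 by field; auto. }
  assert (0 <= dy 0 ^ 2) by apply pow2_ge_0.
  assert (0 <= m * y 0 ^ 2) by (apply Rmult_le_pos; [unfold L in *; lra|apply pow2_ge_0]).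
  assert (2 * eps * dy 0 ^ 2 / b 0 <= 2 / c1 * dy 0 ^ 2).
  { replace (2 * eps * dy 0 ^ 2 / b 0) with (2 * (eps * / b 0) * dy 0 ^ 2) by (field; lra).
    apply Rmult_le_compat_r; auto. unfold Rdiv; apply Rmult_le_compat_l; [lra|].
    assert (/ b 0 <= / c1) by (apply Rinv_le_contravar; lra).
    assert (0 < / b 0) by (apply Rinv_0_lt_compat; lra). nra. }
  assert (0 <= 2 / c1) by (apply Rdiv_le_0_compat; lra).
  assert (0 <= 2 / c1 * (m * y 0 ^ 2)) by (apply Rmult_le_pos; auto).
  lra.
Qed.

Lemma weighted_low_mode m w t : n <= m -> 0 <= t ->
  (exp (n * B t) * w) ^ 2 <= (exp (m * B t) * w) ^ 2 /\
  (exp (n * B t) * w) ^ 2 = exp (- (2 * (m - n) * B t)) * (exp (m * B t) * w) ^ 2.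
Proof.
intros Hm Ht; generalize (slow_prim_nonneg t Ht); intros HB.
assert (E : (exp (n * B t) * w) ^ 2 = exp (- (2 * (m - n) * B t)) * (exp (m * B t) * w) ^ 2).
{ rewrite !Rpow_mult_distr, !exp_double.
  replace (2 * (n * B t)) with (- (2 * (m - n) * B t) + 2 * (m * B t)) by ring.
  rewrite exp_plus; ring. }
split; auto. rewrite E.
rewrite <- (Rmult_1_l ((exp (m * B t) * w) ^ 2)) at 2.
apply Rmult_le_compat_r; [apply pow2_ge_0|]. apply exp_le1.
assert (0 <= (m - n) * B t) by (apply Rmult_le_pos; lra). lra.
Qed.

Lemma weighted_high_mode w t : 0 <= t ->
  (exp (n * B t) * w) ^ 2 = exp (- (2 * (p - n) * B t)) * (exp (2 * p * B t) * w ^ 2) /\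
  (exp (n * B t) * w) ^ 2 <= exp (2 * p * B t) * w ^ 2.
Proof.
intros Ht; destruct (weighted_low_mode p w t (Rlt_le _ _ high_rate_gt) Ht) as [H1 H2].
rewrite (Rpow_mult_distr (exp (p * B t))), exp_double, <- (Rmult_assoc 2) in H1, H2.
auto.
Qed.

(** The two regimes overlap at m = 3 p; the constant depends neither on m nor on
    eps, so the bound can be summed over all modes. *)
Lemma mode_uniform_bound m y dy ddy t :
  n <= m -> damped_mode eps m b y dy ddy -> 0 <= t ->
  m * (exp (n * B t) * y t) ^ 2 <= energy_bound n gamma c1 c2 * (dy 0 ^ 2 + m * y 0 ^ 2).
Proof.
intros Hm hy Ht; generalize high_rate_gt low_bound_pos; intros Hp HCL.
assert (0 <= dy 0 ^ 2) by apply pow2_ge_0.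
assert (0 <= m * y 0 ^ 2) by (apply Rmult_le_pos; [lra|apply pow2_ge_0]).
assert (0 < 2 / c1) by (apply Rdiv_lt_0_compat; lra).
unfold energy_bound; fold p; fold L; fold CL.
assert (HL : 0 <= L) by (unfold L; lra).
destruct (Rle_dec m L) as [HmL|HmL].
- destruct hsmall as (he & _ & _ & hec).
  destruct (low_mode_bound eps L m y dy ddy he
              ltac:(lra) hec hy t Ht) as [HY _].
  destruct (weighted_low_mode m (y t) t Hm Ht) as [HE _].
  fold CL in HY.
  apply Rle_trans with (m * (CL * (dy 0 ^ 2 + y 0 ^ 2))); [apply Rmult_le_compat_l; lra|].
  assert (CL * (m * dy 0 ^ 2) <= CL * (L * dy 0 ^ 2)).
  { apply Rmult_le_compat_l; [lra|]; apply Rmult_le_compat_r; lra. }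
  assert (0 <= CL * dy 0 ^ 2) by (apply Rmult_le_pos; lra).
  assert (0 <= CL * (L * (m * y 0 ^ 2))) by (apply Rmult_le_pos; [|apply Rmult_le_pos]; lra).
  assert (0 <= (2 / c1 + 3) * (dy 0 ^ 2 + m * y 0 ^ 2)) by (apply Rmult_le_pos; lra).
  lra.
- generalize (high_mode_bound m y dy ddy t ltac:(lra) hy Ht); intros HE.
  destruct (weighted_high_mode (y t) t Ht) as [_ HW].
  assert (0 <= exp (2 * p * B t) * (eps * dy t ^ 2 / (2 * b t))).
  { apply Rmult_le_pos; [left; apply exp_pos|]. destruct hsmall as (he & _).
    generalize (slow_pos t Ht); intros.
    apply Rdiv_le_0_compat; [|lra]. apply Rmult_le_pos; [lra|apply pow2_ge_0]. }
  assert (m * (exp (n * B t) * y t) ^ 2 <= m * (exp (2 * p * B t) * y t ^ 2)) by (apply Rmult_le_compat_l; lra).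
  assert (0 <= (L + 1) * CL * (dy 0 ^ 2 + m * y 0 ^ 2)) by (apply Rmult_le_pos; [apply Rmult_le_pos|]; lra).
  lra.
Qed.

Lemma mode_cvg m y dy ddy : n <= m -> damped_mode eps m b y dy ddy ->
  exists l : R, is_lim (fun t => exp (n * B t) * y t) p_infty l /\ (n < m -> l = 0).
Proof.
intros Hm hy; generalize high_rate_gt low_bound_pos; intros Hp HCL.
destruct hsmall as (he & _ & _ & hec).
destruct (Rle_lt_or_eq_dec n m Hm) as [Hlt|Heq].
- exists 0; split; auto.
  destruct (Rle_dec m L) as [HmL|HmL].
  + apply (is_lim_0_of_square _ (fun t => exp (- (2 * (m - n) * B t))) (CL * (dy 0 ^ 2 + y 0 ^ 2))).
    2:{ apply (exp_prim_vanishes); lra. }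
    intros t Ht; destruct (weighted_low_mode m (y t) t Hm Ht) as [_ ->].
    destruct (low_mode_bound eps L m y dy ddy he
              ltac:(lra) hec hy t Ht) as [HY _].
    rewrite Rmult_comm; apply Rmult_le_compat_r; [left; apply exp_pos|exact HY].
  + apply (is_lim_0_of_square _ (fun t => exp (- (2 * (p - n) * B t)))
             ((2 / c1 + 3) * (dy 0 ^ 2 + m * y 0 ^ 2) / m)).
    2:{ apply (exp_prim_vanishes); lra. }
    intros t Ht; destruct (weighted_high_mode (y t) t Ht) as [-> _].
    generalize (high_mode_bound m y dy ddy t ltac:(lra) hy Ht); intros HE.
    assert (0 <= exp (2 * p * B t) * (eps * dy t ^ 2 / (2 * b t))).
    { apply Rmult_le_pos; [left; apply exp_pos|].
      generalize (slow_pos t Ht); intros.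
      apply Rdiv_le_0_compat; [|lra]. apply Rmult_le_pos; [lra|apply pow2_ge_0]. }
    rewrite Rmult_comm; apply Rmult_le_compat_r; [left; apply exp_pos|].
    apply (Rmult_le_reg_r m); [lra|].
    replace ((2 / c1 + 3) * (dy 0 ^ 2 + m * y 0 ^ 2) / m * m)
      with ((2 / c1 + 3) * (dy 0 ^ 2 + m * y 0 ^ 2)) by (field; lra).
    lra.
- subst m. destruct (low_mode_cvg eps L n y dy ddy he
              ltac:(unfold L; lra) hec hy) as [l [_ Hl]].
  exists l; split; auto; lra.
Qed.

Section Velocity.
Variable K : R.
Hypothesis hK : forall t, 0 <= t -> exp (- (2 * n * gamma * B t)) <= K / (1 + t).

Lemma decay_const_pos : 0 < K.
Proof.
generalize (hK 0 (Rle_refl 0)) (exp_pos (- (2 * n * gamma * B 0))).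
replace (K / (1 + 0)) with K by field; lra.
Qed.

(** exp(- 2 (p - n) B) is the cube of exp(- 2 n gamma B). *)
Lemma weighted_high_mode_decay w t : 0 <= t ->
  (1 + t) ^ 3 * (exp (n * B t) * w) ^ 2 <= K ^ 3 * (exp (2 * p * B t) * w ^ 2).
Proof.
intros Ht; destruct (weighted_high_mode w t Ht) as [-> _].
rewrite <- Rmult_assoc; apply Rmult_le_compat_r.
{ apply Rmult_le_pos; [left; apply exp_pos|apply pow2_ge_0]. }
(* p - n = 3 n gamma. *)
replace (exp (- (2 * (p - n) * B t))) with (exp (- (2 * n * gamma * B t)) ^ 3).
2:{ simpl; rewrite Rmult_1_r, <- !exp_plus; f_equal; unfold p, high_rate; ring. }
rewrite <- Rpow_mult_distr; apply pow_incr; split.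
{ apply Rmult_le_pos; [lra|left; apply exp_pos]. }
apply (Rmult_le_reg_r (/ (1 + t))); [apply Rinv_0_lt_compat; lra|].
replace ((1 + t) * exp (- (2 * n * gamma * B t)) * / (1 + t))
  with (exp (- (2 * n * gamma * B t))) by (field; lra).
apply hK; auto.
Qed.

Lemma high_mode_velocity m y dy ddy t :
  L <= m -> damped_mode eps m b y dy ddy -> 0 <= t ->
  (1 + t) ^ 4 * (exp (n * B t) * dy t) ^ 2
    <= 2 * c2 * K ^ 3 / eps * (2 / c1 + 3) * (dy 0 ^ 2 + m * y 0 ^ 2).
Proof.
intros Hm hy Ht; generalize (high_mode_bound m y dy ddy t Hm hy Ht); intros HE.
destruct hsmall as (he & _); generalize high_rate_gt decay_const_pos; intros Hp HK.
generalize (slow_pos t Ht) (slow_upper hb t Ht); intros Hb Hbu.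
assert (He : 0 < exp (2 * p * B t)) by apply exp_pos.
set (G := (2 / c1 + 3) * (dy 0 ^ 2 + m * y 0 ^ 2)) in *.
assert (0 <= exp (2 * p * B t) * (m * y t ^ 2)).
{ apply Rmult_le_pos; [lra|]; apply Rmult_le_pos; [unfold L in *; lra|apply pow2_ge_0]. }
assert (Hk : exp (2 * p * B t) * dy t ^ 2 <= 2 * b t / eps * G).
{ replace (exp (2 * p * B t) * dy t ^ 2) with
    (2 * b t / eps * (exp (2 * p * B t) * (eps * dy t ^ 2 / (2 * b t)))) by (field; lra).
  apply Rmult_le_compat_l; [apply Rdiv_le_0_compat; lra|lra]. }
assert (HG : 0 <= G).
{ eapply Rle_trans; [|exact HE]. rewrite Rmult_plus_distr_l.
  apply Rplus_le_le_0_compat; auto. apply Rmult_le_pos; [lra|].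
  apply Rdiv_le_0_compat; [|lra]. apply Rmult_le_pos; [lra|apply pow2_ge_0]. }
generalize (weighted_high_mode_decay (dy t) t Ht); intros HW.
assert (HK3 : 0 < K ^ 3) by (apply pow_lt; auto).
apply Rle_trans with ((1 + t) * (K ^ 3 * (2 * (c2 / (1 + t)) / eps * G))).
- replace ((1 + t) ^ 4 * (exp (n * B t) * dy t) ^ 2) with
    ((1 + t) * ((1 + t) ^ 3 * (exp (n * B t) * dy t) ^ 2)) by ring.
  apply Rmult_le_compat_l; [lra|]. apply Rle_trans with (1 := HW).
  apply Rmult_le_compat_l; [lra|]. apply Rle_trans with (1 := Hk).
  apply Rmult_le_compat_r; auto. unfold Rdiv; apply Rmult_le_compat_r; [left; apply Rinv_0_lt_compat; lra|].
  apply Rmult_le_compat_l; lra.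
- right; unfold G; field; lra.
Qed.

Lemma velocity_split m y t dyt :
  exp (n * B t) * dyt = exp (n * B t) * (dyt + m * b t * y) - m * b t * (exp (n * B t) * y).
Proof. ring. Qed.

Lemma mode_velocity_bound : exists C : R, 0 <= C /\
  forall m y dy ddy t, n <= m -> damped_mode eps m b y dy ddy -> 0 <= t ->
  ((1 + t) * (exp (n * B t) * dy t)) ^ 2 <= C * (dy 0 ^ 2 + m * y 0 ^ 2).
Proof.
generalize high_rate_gt decay_const_pos low_bound_pos; intros Hp HK HCL.
pose (Ch := 2 * c2 * K ^ 3 / eps * (2 / c1 + 3)).
pose (Cl := (2 + 2 * L ^ 2 * c2 ^ 2) * CL * (1 + / n)).
destruct hsmall as (he & _ & _ & hec).
assert (HCh : 0 <= Ch).
{ unfold Ch. assert (0 < K ^ 3) by (apply pow_lt; auto).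
  assert (0 < 2 / c1) by (apply Rdiv_lt_0_compat; lra).
  apply Rmult_le_pos; [|lra]. apply Rdiv_le_0_compat; [|lra]. repeat apply Rmult_le_pos; lra. }
assert (HCl : 0 <= Cl).
{ unfold Cl. assert (0 <= L ^ 2 * c2 ^ 2) by (apply Rmult_le_pos; apply pow2_ge_0).
  assert (0 < / n) by (apply Rinv_0_lt_compat; lra). repeat apply Rmult_le_pos; lra. }
exists (Ch + Cl); split; [lra|].
intros m y dy ddy t Hm hy Ht.
assert (0 <= dy 0 ^ 2) by apply pow2_ge_0.
assert (0 <= y 0 ^ 2) by apply pow2_ge_0.
assert (0 <= m * y 0 ^ 2) by (apply Rmult_le_pos; lra).
assert (HD : 0 <= dy 0 ^ 2 + m * y 0 ^ 2) by lra.
destruct (Rle_dec m L) as [HmL|HmL].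
- apply Rle_trans with (Cl * (dy 0 ^ 2 + m * y 0 ^ 2)); [|apply Rmult_le_compat_r; lra].
  destruct (low_mode_bound eps L m y dy ddy he
              ltac:(lra) hec hy t Ht) as [HY HZ]; fold CL in HY, HZ.
  destruct (weighted_low_mode m (y t) t Hm Ht) as [HY' _].
  destruct (weighted_low_mode m (dy t + m * b t * y t) t Hm Ht) as [HZ' _].
  set (D0 := CL * (dy 0 ^ 2 + y 0 ^ 2)) in *.
  rewrite velocity_split with (m := m) (y := y t).
  set (w := exp (n * B t) * (dy t + m * b t * y t)) in *.
  set (v := exp (n * B t) * y t) in *.
  set (W := exp (m * B t) * (dy t + m * b t * y t)) in *.
  set (V := exp (m * B t) * y t) in *.
  generalize (slow_pos t Ht) (slow_upper hb t Ht); intros Hb Hbu.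
  assert (Hmb : 0 <= (1 + t) * (m * b t) <= L * c2).
  { split; [repeat apply Rmult_le_pos; lra|].
    replace ((1 + t) * (m * b t)) with (m * ((1 + t) * b t)) by ring.
    apply Rmult_le_compat; try lra; [apply Rmult_le_pos; lra|].
    replace c2 with ((1 + t) * (c2 / (1 + t))) by (field; lra).
    apply Rmult_le_compat_l; lra. }
  assert (Hw : ((1 + t) * w) ^ 2 <= D0).
  { apply Rle_trans with ((1 + t) ^ 4 * W ^ 2); auto.
    rewrite Rpow_mult_distr. apply Rmult_le_compat; try apply pow2_ge_0; auto.
    apply Rle_pow; [lra|auto]. }
  assert (Hv : ((1 + t) * (m * b t) * v) ^ 2 <= L ^ 2 * c2 ^ 2 * D0).
  { rewrite Rpow_mult_distr, <- Rpow_mult_distr with (x := L).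
    apply Rmult_le_compat; try apply pow2_ge_0; [apply pow_incr; lra|lra]. }
  assert (0 <= ((1 + t) * w + (1 + t) * (m * b t) * v) ^ 2) by apply pow2_ge_0.
  assert (HD0 : D0 <= CL * ((1 + / n) * (dy 0 ^ 2 + m * y 0 ^ 2))).
  { unfold D0; apply Rmult_le_compat_l; [lra|].
    assert (0 < / n) by (apply Rinv_0_lt_compat; lra).
    assert (y 0 ^ 2 <= / n * (m * y 0 ^ 2)).
    { apply (Rmult_le_reg_l n); auto.
      replace (n * (/ n * (m * y 0 ^ 2))) with (m * y 0 ^ 2) by (field; lra).
      apply Rmult_le_compat_r; auto. }
    assert (0 <= / n * dy 0 ^ 2) by (apply Rmult_le_pos; lra). lra. }
  assert (0 <= L ^ 2 * c2 ^ 2) by (apply Rmult_le_pos; apply pow2_ge_0).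
  apply Rle_trans with ((2 + 2 * L ^ 2 * c2 ^ 2) * D0).
  { lra. }
  apply Rle_trans with ((2 + 2 * L ^ 2 * c2 ^ 2) * (CL * ((1 + / n) * (dy 0 ^ 2 + m * y 0 ^ 2)))).
  { apply Rmult_le_compat_l; lra. }
  right; unfold Cl; ring.
- apply Rle_trans with (Ch * (dy 0 ^ 2 + m * y 0 ^ 2)); [|apply Rmult_le_compat_r; lra].
  eapply Rle_trans; [|apply (high_mode_velocity m y dy ddy t); auto; lra].
  rewrite Rpow_mult_distr; apply Rmult_le_compat_r; [apply pow2_ge_0|].
  apply Rle_pow; [lra|auto].
Qed.

(** For low modes y'' is - exp(- m B) Z/eps, so the fast decay of Z is inherited; for
    high modes the equation bounds y'' by y' and m b y, at the cost of one factor m. *)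
Lemma mode_acceleration_bound : exists C : R, 0 <= C /\
  forall m y dy ddy t, n <= m -> damped_mode eps m b y dy ddy -> 0 <= t ->
  ((1 + t) ^ 2 * (exp (n * B t) * ddy t)) ^ 2 <= C * (1 + m) * (dy 0 ^ 2 + m * y 0 ^ 2).
Proof.
generalize high_rate_gt decay_const_pos low_bound_pos; intros Hp HK HCL.
pose (Ch := 2 * c2 * K ^ 3 / eps * (2 / c1 + 3)).
pose (Ch' := c2 ^ 2 * K ^ 3 * (2 / c1 + 3)).
pose (Cl := CL * (1 + / n)).
destruct hsmall as (he & _ & _ & hec).
assert (HK3 : 0 < K ^ 3) by (apply pow_lt; auto).
assert (Hc1i : 0 < 2 / c1) by (apply Rdiv_lt_0_compat; lra).
assert (HCh : 0 <= Ch).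
{ unfold Ch. apply Rmult_le_pos; [|lra]. apply Rdiv_le_0_compat; [|lra]. repeat apply Rmult_le_pos; lra. }
assert (HCh' : 0 <= Ch').
{ unfold Ch'. apply Rmult_le_pos; [|lra]. apply Rmult_le_pos; [apply pow2_ge_0|lra]. }
assert (Hni : 0 < / n) by (apply Rinv_0_lt_compat; lra).
assert (HCl : 0 <= Cl) by (unfold Cl; apply Rmult_le_pos; lra).
assert (Hei : 0 <= / eps ^ 2) by (left; apply Rinv_0_lt_compat, pow_lt; lra).
exists (/ eps ^ 2 * (2 * Ch + 2 * Ch' + Cl)); split; [apply Rmult_le_pos; lra|].
intros m y dy ddy t Hm hy Ht.
assert (0 <= dy 0 ^ 2) by apply pow2_ge_0.
assert (0 <= y 0 ^ 2) by apply pow2_ge_0.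
assert (0 <= m * y 0 ^ 2) by (apply Rmult_le_pos; lra).
assert (HD : 0 <= dy 0 ^ 2 + m * y 0 ^ 2) by lra.
set (D := dy 0 ^ 2 + m * y 0 ^ 2) in *.
rewrite (mode_ddy _ _ _ _ _ (proj1 he) hy t Ht).
set (E := exp (n * B t)).
replace (((1 + t) ^ 2 * (E * (- (m * b t * y t + dy t) / eps))) ^ 2) with
  (/ eps ^ 2 * ((1 + t) ^ 4 * (E * (dy t + m * b t * y t)) ^ 2)) by (field; lra).
rewrite !(Rmult_assoc (/ eps ^ 2)). apply Rmult_le_compat_l; auto.
assert (HmD : 0 <= m * D) by (apply Rmult_le_pos; lra).
assert (0 <= Ch * D) by (apply Rmult_le_pos; lra).
assert (0 <= Ch' * D) by (apply Rmult_le_pos; lra).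
assert (0 <= Cl * D) by (apply Rmult_le_pos; lra).
assert (0 <= Ch * (m * D)) by (apply Rmult_le_pos; lra).
assert (0 <= Ch' * (m * D)) by (apply Rmult_le_pos; lra).
assert (0 <= Cl * (m * D)) by (apply Rmult_le_pos; lra).
destruct (Rle_dec m L) as [HmL|HmL].
- destruct (low_mode_bound eps L m y dy ddy he
              ltac:(lra) hec hy t Ht) as [_ HZ]; fold CL in HZ.
  destruct (weighted_low_mode m (dy t + m * b t * y t) t Hm Ht) as [HZ' _]; fold E in HZ'.
  assert (HD0 : CL * (dy 0 ^ 2 + y 0 ^ 2) <= CL * ((1 + / n) * D)).
  { unfold D; apply Rmult_le_compat_l; [lra|].
    assert (y 0 ^ 2 <= / n * (m * y 0 ^ 2)).
    { apply (Rmult_le_reg_l n); auto.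
      replace (n * (/ n * (m * y 0 ^ 2))) with (m * y 0 ^ 2) by (field; lra).
      apply Rmult_le_compat_r; auto. }
    assert (0 <= / n * dy 0 ^ 2) by (apply Rmult_le_pos; lra). lra. }
  assert ((1 + t) ^ 4 * (E * (dy t + m * b t * y t)) ^ 2 <= Cl * D).
  { replace (Cl * D) with (CL * ((1 + / n) * D)) by (unfold Cl; ring). eapply Rle_trans; [|exact HD0].
    eapply Rle_trans; [|exact HZ]. apply Rmult_le_compat_l; [apply pow_le; lra|auto]. }
  lra.
- generalize (high_mode_velocity m y dy ddy t ltac:(lra) hy Ht); fold Ch D E; intros HV.
  generalize (high_mode_bound m y dy ddy t ltac:(lra) hy Ht); fold D; intros HE.
  generalize (weighted_high_mode_decay (y t) t Ht); fold E; intros HW.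
  generalize (slow_pos t Ht) (slow_upper hb t Ht); intros Hb Hbu.
  assert (0 <= exp (2 * p * B t) * (eps * dy t ^ 2 / (2 * b t))).
  { apply Rmult_le_pos; [left; apply exp_pos|].
    apply Rdiv_le_0_compat; [|lra]. apply Rmult_le_pos; [lra|apply pow2_ge_0]. }
  assert (HP : (1 + t) ^ 4 * (E * (m * b t * y t)) ^ 2 <= Ch' * (m * D)).
  { apply Rle_trans with ((1 + t) * (m * (c2 / (1 + t)) ^ 2 * (m * ((1 + t) ^ 3 * (E * y t) ^ 2)))).
    - replace ((1 + t) ^ 4 * (E * (m * b t * y t)) ^ 2) with
       ((1 + t) * (m * b t ^ 2 * (m * ((1 + t) ^ 3 * (E * y t) ^ 2)))) by ring.
      apply Rmult_le_compat_l; [lra|]. apply Rmult_le_compat_r.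
      { apply Rmult_le_pos; [lra|]. apply Rmult_le_pos; [apply pow_le; lra|apply pow2_ge_0]. }
      apply Rmult_le_compat_l; [lra|]. apply pow_incr; lra.
    - assert (HX : m * ((1 + t) ^ 3 * (E * y t) ^ 2) <= K ^ 3 * ((2 / c1 + 3) * D)).
      { apply Rle_trans with (m * (K ^ 3 * (exp (2 * p * B t) * y t ^ 2))).
        { apply Rmult_le_compat_l; lra. }
        replace (m * (K ^ 3 * (exp (2 * p * B t) * y t ^ 2))) with
          (K ^ 3 * (exp (2 * p * B t) * (m * y t ^ 2))) by ring.
        apply Rmult_le_compat_l; lra. }
      assert (HX0 : 0 <= K ^ 3 * ((2 / c1 + 3) * D)) by (apply Rmult_le_pos; [|apply Rmult_le_pos]; lra).
      set (G := K ^ 3 * ((2 / c1 + 3) * D)) in *.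
      apply Rle_trans with ((1 + t) * (m * (c2 / (1 + t)) ^ 2 * G)).
      { apply Rmult_le_compat_l; [lra|]. apply Rmult_le_compat_l; auto.
        apply Rmult_le_pos; [lra|apply pow2_ge_0]. }
      replace ((1 + t) * (m * (c2 / (1 + t)) ^ 2 * G)) with (m * c2 ^ 2 * G * / (1 + t))
        by (field; lra).
      replace (Ch' * (m * D)) with (m * c2 ^ 2 * G * 1) by (unfold Ch', G; ring).
      apply Rmult_le_compat_l.
      { apply Rmult_le_pos; auto; apply Rmult_le_pos; [lra|apply pow2_ge_0]. }
      rewrite <- Rinv_1; apply Rinv_le_contravar; lra. }
  assert (0 <= (1 + t) ^ 4 * (E * dy t - E * (m * b t * y t)) ^ 2).
  { apply Rmult_le_pos; [apply pow_le; lra|apply pow2_ge_0]. }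
  replace ((1 + t) ^ 4 * (E * (dy t + m * b t * y t)) ^ 2) with
    (2 * ((1 + t) ^ 4 * (E * dy t) ^ 2) + 2 * ((1 + t) ^ 4 * (E * (m * b t * y t)) ^ 2)
      - (1 + t) ^ 4 * (E * dy t - E * (m * b t * y t)) ^ 2) by ring.
  lra.
Qed.

(** y' = - m b y + exp(- m B) Z, where Z is negligible and (1+t) b has a limit. *)
Lemma mode_velocity_cvg m y dy ddy (l : R) :
  n <= m -> damped_mode eps m b y dy ddy ->
  is_lim (fun t => (1 + t) * b t) p_infty (1 / (2 * n * gamma)) ->
  is_lim (fun t => exp (n * B t) * y t) p_infty l -> (n < m -> l = 0) ->
  is_lim (fun t => (1 + t) * (exp (n * B t) * dy t)) p_infty (- (1 / (2 * gamma)) * l).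
Proof.
intros Hm hy Hbl Hl Hl0; generalize high_rate_gt; intros Hp.
destruct hsmall as (he & _ & _ & hec).
destruct (Rle_dec m L) as [HmL|HmL].
- assert (HZ : is_lim (fun t => (1 + t) * (exp (n * B t) * (dy t + m * b t * y t))) p_infty 0).
  { apply (is_lim_0_of_square _
      (fun t => ((1 + t) * (exp (m * B t) * (dy t + m * b t * y t))) ^ 2) 1).
    - intros t Ht. destruct (weighted_low_mode m (dy t + m * b t * y t) t Hm Ht) as [H _].
      rewrite Rmult_1_l, !(Rpow_mult_distr (1 + t)). apply Rmult_le_compat_l; auto; apply pow2_ge_0.
    - generalize (fast_part_vanishes eps L m y dy ddy he
              ltac:(lra) hec hy); intros HZ.
      apply (is_lim_ext (fun t => (1 + t) * (exp (m * B t) * (dy t + m * b t * y t)) *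
                                  ((1 + t) * (exp (m * B t) * (dy t + m * b t * y t))))).
      { intros t; ring. }
      replace (Finite 0) with (Rbar_mult 0 0) by (simpl; f_equal; ring).
      apply is_lim_mult; simpl; auto. }
  apply (is_lim_ext (fun t => (1 + t) * (exp (n * B t) * (dy t + m * b t * y t))
            - m * ((1 + t) * b t * (exp (n * B t) * y t)))).
  { intros t; ring. }
  replace (- (1 / (2 * gamma)) * l) with (0 - m * (1 / (2 * n * gamma) * l)).
  + apply is_lim_minus'; auto.
    apply (is_lim_scal_l _ m p_infty (1 / (2 * n * gamma) * l)).
    apply (is_lim_mult _ _ p_infty (1 / (2 * n * gamma)) l); simpl; auto.
  + destruct (Rle_lt_or_eq_dec n m Hm) as [h| <-]; [rewrite (Hl0 h); ring|field; lra].
- rewrite (Hl0 ltac:(unfold L in *; lra)), Rmult_0_r.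
  apply (is_lim_0_of_square _ (fun t => / (1 + t))
          (2 * c2 * K ^ 3 / eps * (2 / c1 + 3) * (dy 0 ^ 2 + m * y 0 ^ 2))); [|apply is_lim_inv_shift].
  intros t Ht; generalize (high_mode_velocity m y dy ddy t ltac:(lra) hy Ht).
  set (C := 2 * c2 * K ^ 3 / eps * (2 / c1 + 3) * (dy 0 ^ 2 + m * y 0 ^ 2)); intros H.
  apply (Rmult_le_reg_r (1 + t)); [lra|].
  replace (C * / (1 + t) * (1 + t)) with C by (field; lra).
  eapply Rle_trans; [|exact H].
  rewrite (Rpow_mult_distr (1 + t)), Rmult_comm, <- Rmult_assoc.
  apply Rmult_le_compat_r; [apply pow2_ge_0|].
  replace ((1 + t) * (1 + t) ^ 2) with ((1 + t) ^ 3) by ring. apply Rle_pow; [lra|auto].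
Qed.

End Velocity.
End Spectrum.
End Coefficient.

(** * From the Kirchhoff equation to its modes *)

Lemma Rpower_pos x a : 0 < Rpower x a.
Proof. apply exp_pos. Qed.

Lemma is_derive_Rpower (f : R -> R) (t df a : R) :
  is_derive f t df -> 0 < f t ->
  is_derive (fun s => Rpower (f s) a) t (a * (df / f t) * Rpower (f t) a).
Proof.
intros D Hp; unfold Rpower; auto_derive.
- repeat split; [eexists; eassumption|exact Hp].
- use_derivative D; field; lra.
Qed.

Lemma Rabs_le_of_sq x y : 0 <= y -> x ^ 2 <= y ^ 2 -> Rabs x <= y.
Proof.
intros Hy Hxy; apply Rsqr_incr_0; [|apply Rabs_pos|auto].
rewrite <- Rsqr_abs; unfold Rsqr; lra.
Qed.

Lemma b_eq_Rpower (H : RealHilbert) (S : operator H) (gamma : R) (u : R -> H) t :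
  0 < norm (S (u t)) ^ 2 -> b S gamma u t = Rpower (norm (S (u t)) ^ 2) gamma.
Proof.
intros Hn; unfold b, rpow.
assert (Hp : 0 < norm (S (u t))) by (generalize (norm_ge_0 (S (u t))); nra).
destruct (Rlt_dec 0 (norm (S (u t)))) as [_|h]; [|lra].
unfold Rpower; f_equal. replace (norm (S (u t)) ^ 2) with (norm (S (u t)) * norm (S (u t))) by ring.
rewrite ln_mult by auto; ring.
Qed.

Lemma continuous_Rmax0 t : continuous (fun s => Rmax 0 s) t.
Proof.
apply filterlim_locally; intros [d Hd]; exists (mkposreal d Hd); intros s Hs.
apply Rabs_def2 in Hs; apply Rabs_def1; simpl in *; unfold minus, plus, opp in *; simpl in *;
unfold Rmax; destruct (Rle_dec 0 s), (Rle_dec 0 t); lra.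
Qed.

(** Freezing f for negative times keeps it continuous everywhere, which makes its
    integral differentiable at 0. *)
Lemma primitive_nonneg (f df : R -> R) :
  (forall t, 0 <= t -> is_derive f t (df t)) ->
  exists F : R -> R, F 0 = 0 /\ (forall t, 0 <= t -> is_derive F t (f t)) /\
    forall t, 0 <= t -> F t = RInt f 0 t.
Proof.
intros Hf; pose (g := fun t => f (Rmax 0 t)).
assert (Hg : forall t, continuous g t).
{ intros t; unfold g; apply (continuous_comp (fun s => Rmax 0 s) f).
  - apply continuous_Rmax0.
  - apply (ex_derive_continuous f); exists (df (Rmax 0 t)); apply Hf, Rmax_l. }
assert (Eg : forall t, 0 <= t -> g t = f t) by (intros t Ht; unfold g; rewrite Rmax_right; auto).
exists (RInt g 0); split; [apply (RInt_point (V := R_CompleteNormedModule))|split].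
- intros t Ht; rewrite <- Eg by auto.
  apply (is_derive_RInt g (RInt g 0) 0 t); [|apply Hg].
  apply (filter_forall (F := locally t)); intros s.
  apply (RInt_correct (V := R_CompleteNormedModule)), (ex_RInt_continuous (V := R_CompleteNormedModule)); intros; apply Hg.
- intros t Ht; apply RInt_ext; intros s.
  rewrite Rmin_left, Rmax_right by lra; intros; apply Eg; lra.
Qed.

Section Reduction.
Variables (H : RealHilbert) (A S : operator H).
Hypothesis hA : self_adjoint A.
Hypothesis hS : is_sqrt A S.
Variables (gamma eps K1 K2 : R) (u0 u1 : H) (u du ddu : R -> H).
Hypothesis hgamma : 0 < gamma.
Hypothesis hK1 : 0 < K1.
Hypothesis hK2 : 0 < K2.
Hypothesis hsol : is_global_solution A S gamma u0 u1 eps u du ddu.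
Hypothesis hdecay : decay_estimates A S gamma K1 K2 u du.

Lemma sqrt_norm_pos t : 0 <= t -> 0 < norm (S (u t)) ^ 2.
Proof.
intros Ht; destruct (hdecay t Ht) as [[Hl _] _].
eapply Rlt_le_trans; [|exact Hl]. apply Rmult_lt_0_compat; auto; apply Rpower_pos.
Qed.

(** b = N^gamma with N = |S u|^2 and N' = 2 <u', A u>, so b'/b = gamma N'/N.  The
    decay estimates bound |u'| |A u| and N by the same power of 1+t up to the factor
    1/(1+t). *)
Lemma solution_coefficient : exists b' db B',
  slow_coefficient (Rpower K1 gamma) (Rpower K2 gamma) (2 * gamma * K2 / K1) b' db B' /\
  forall t, 0 <= t -> b' t = b S gamma u t /\ B' t = B S gamma u t.
Proof.
pose (N := fun t => norm (S (u t)) ^ 2).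
pose (dN := fun t => 2 * ip (S (du t)) (S (u t))).
assert (HN : derive_nonneg (V := R_NormedModule) N dN).
{ apply (derive_nonneg_norm_sq H (fun t => S (u t)) (fun t => S (du t))).
  generalize (sol_derive_S hsol); intros HG.
  exact (derive_nonneg_linear (prod_NormedModule R_AbsRing H H) H (fun p => snd p)
     (fun t => graph S (u t)) (fun t => graph S (du t)) is_linear_snd HG). }
pose (b' := fun t => Rpower (extend N dN t) gamma).
pose (db := fun t => gamma * (dN t / N t) * b' t).
assert (Eb : forall t, 0 <= t -> b' t = Rpower (N t) gamma).
{ intros t Ht; unfold b'; rewrite extend_nonneg; auto. }
assert (Hd : forall t, 0 <= t -> is_derive b' t (db t)).
{ intros t Ht; generalize (derive_extend N dN HN t Ht) (sqrt_norm_pos t Ht); intros D Hp.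
  generalize (is_derive_Rpower _ _ _ gamma D). rewrite extend_nonneg by auto; intros D'.
  unfold db; rewrite Eb by auto; apply D', Hp. }
destruct (primitive_nonneg b' db Hd) as (B' & HB0 & HB & EB).
exists b', db, B'; split.
2:{ intros t Ht; split.
  - rewrite Eb by auto; unfold N; rewrite b_eq_Rpower; auto; apply sqrt_norm_pos; auto.
  - rewrite EB by auto; unfold B; apply RInt_ext; intros s; rewrite Rmin_left, Rmax_right by lra.
    intros Hs; rewrite Eb, b_eq_Rpower by (lra || apply sqrt_norm_pos; lra); auto. }
assert (Er : forall t, 0 <= t -> Rpower (Rpower (1 + t) (- (1 / gamma))) gamma = / (1 + t)).
{ intros t Ht; rewrite Rpower_mult. replace (- (1 / gamma) * gamma) with (- (1)) by (field; lra).
  rewrite Rpower_Ropp, Rpower_1; lra. }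
split; auto.
- intros t Ht; destruct (hdecay t Ht) as [[Hl _] _]. rewrite Eb by auto.
  unfold Rdiv; rewrite <- Er, Rpower_mult_distr by (auto; apply Rpower_pos).
  apply Rle_Rpower_l; [lra|]. split; auto. apply Rmult_lt_0_compat; auto; apply Rpower_pos.
- intros t Ht; destruct (hdecay t Ht) as [[_ Hu] _]. rewrite Eb by auto.
  unfold Rdiv; rewrite <- Er, Rpower_mult_distr by (auto; apply Rpower_pos).
  apply Rle_Rpower_l; [lra|]. split; auto. apply sqrt_norm_pos; auto.
- intros t Ht; destruct (hdecay t Ht) as [[Hl _] [[_ Hu] Hv]].
  set (r := Rpower (1 + t) (- (1 / gamma))) in *.
  assert (Hr : 0 < r) by apply Rpower_pos.
  assert (Ev : Rpower (1 + t) (- 2 - 1 / gamma) = r / (1 + t) ^ 2).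
  { unfold Rminus; rewrite Rpower_plus; unfold Rdiv; rewrite Rmult_comm; f_equal.
    replace (-2) with (- (INR 2)) by (simpl; ring). rewrite Rpower_Ropp; f_equal.
    apply Rpower_pow; lra. }
  rewrite Ev in Hv.
  destruct hS as (HSs & _ & Hdom & Hsq).
  generalize (sol_dom_A hsol Ht) (sol_dom_S hsol Ht); intros HAu [HSu HSdu].
  destruct (proj1 (Hdom _) HAu) as [_ HSS].
  assert (EdN : dN t = 2 * ip (du t) (A (u t))).
  { unfold dN; rewrite (self_adjoint_sym H S (du t) (S (u t))) by auto.
    rewrite (Hsq _ HAu); auto. }
  assert (HdN : Rabs (dN t) <= 2 * (K2 * r / (1 + t))).
  { rewrite EdN, Rabs_mult, (Rabs_right 2) by lra. apply Rmult_le_compat_l; [lra|].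
    eapply Rle_trans; [apply cauchy_schwarz|].
    rewrite <- (Rabs_right (norm (du t) * norm (A (u t))))
      by (apply Rle_ge, Rmult_le_pos; apply norm_ge_0).
    apply Rabs_le_of_sq.
    { apply Rdiv_le_0_compat; [|lra]. apply Rmult_le_pos; lra. }
    rewrite Rpow_mult_distr.
    replace ((K2 * r / (1 + t)) ^ 2) with (K2 * (r / (1 + t) ^ 2) * (K2 * r)) by (field; lra).
    apply Rmult_le_compat; auto; apply pow2_ge_0. }
  unfold db. assert (Hb0 : 0 < b' t) by apply Rpower_pos.
  rewrite Rabs_mult, (Rabs_right (b' t)) by lra.
  replace (2 * gamma * K2 / K1 * b' t / (1 + t)) with (2 * gamma * K2 / K1 / (1 + t) * b' t) by (field; lra).
  apply Rmult_le_compat_r; [lra|].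
  rewrite Rabs_mult, (Rabs_right gamma) by lra.
  replace (2 * gamma * K2 / K1 / (1 + t)) with (gamma * (2 * (K2 * r / (1 + t)) / (K1 * r))) by (field; lra).
  apply Rmult_le_compat_l; [lra|].
  unfold Rdiv at 1; rewrite Rabs_mult.
  assert (HKr : 0 < K1 * r) by (apply Rmult_lt_0_compat; lra).
  apply Rmult_le_compat; auto; try apply Rabs_pos.
  assert (HN0 : 0 < N t) by (apply sqrt_norm_pos; auto).
  rewrite Rabs_right by (left; apply Rinv_0_lt_compat; auto).
  apply Rinv_le_contravar; auto.
Qed.

Lemma solution_mode (bt : R -> R) (v : H) (m : R) :
  (forall t, 0 <= t -> bt t = b S gamma u t) ->
  dom A v -> A v = scal m v ->
  damped_mode eps m bt (extend (fun t => ip (u t) v) (fun t => ip (du t) v))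
    (extend (fun t => ip (du t) v) (fun t => ip (ddu t) v)) (fun t => ip (ddu t) v).
Proof.
intros Hb Hv Ev; split.
- intros t Ht; rewrite (extend_nonneg (fun t => ip (du t) v)) by auto.
  apply (derive_extend (fun t => ip (u t) v) (fun t => ip (du t) v)); auto.
  apply derive_nonneg_ip, (sol_derive1 hsol).
- intros t Ht.
  apply (derive_extend (fun t => ip (du t) v) (fun t => ip (ddu t) v)); auto.
  apply derive_nonneg_ip, (sol_derive2 hsol).
- intros t Ht; rewrite !extend_nonneg, Hb by auto.
  generalize (f_equal (fun x => ip x v) (sol_eq hsol Ht)).
  rewrite !ip_plus_l, !ip_scal_l, ip_zero_l, (eigen_coordinate H A m v (u t)); auto; try lra.
  apply (sol_dom_A hsol Ht).
Qed.

End Reduction.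

(** * Linear growth of the weight *)

(** L'Hopital's rule against 1+t. *)
Lemma slope_limit (f df : R -> R) (l : R) :
  (forall t, 0 <= t -> is_derive f t (df t)) -> is_lim df p_infty l ->
  is_lim (fun t => f t / (1 + t)) p_infty l.
Proof.
intros Hd Hl; apply is_lim_spec; intros [d Hd0]; simpl.
apply is_lim_spec in Hl.
destruct (Hl (mkposreal _ (is_pos_div_2 (mkposreal d Hd0)))) as [T0 HT0]; simpl in HT0.
pose (T := Rmax T0 0 + 1).
assert (HT : 0 < T /\ T0 < T) by (unfold T; generalize (Rmax_l T0 0) (Rmax_r T0 0); lra).
pose (c := Rabs (f T - l * (1 + T))).
assert (Hv : is_lim (fun t => c * / (1 + t)) p_infty 0).
{ replace (Finite 0) with (Rbar_mult c 0) by (simpl; f_equal; ring).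
  apply is_lim_scal_l, is_lim_inv_shift. }
apply is_lim_spec in Hv.
destruct (Hv (mkposreal _ (is_pos_div_2 (mkposreal d Hd0)))) as [T1 HT1]; simpl in HT1.
exists (Rmax T T1); intros t Ht.
assert (T < t) by (eapply Rle_lt_trans; [apply Rmax_l|exact Ht]).
assert (T1 < t) by (eapply Rle_lt_trans; [apply Rmax_r|exact Ht]).
specialize (HT1 t H0); rewrite Rminus_0_r in HT1.
destruct (MVT_gen f T t df) as [x [Hx E]].
- intros x Hx; rewrite Rmin_left in Hx by lra; apply Hd; lra.
- intros x Hx; rewrite Rmin_left in Hx by lra.
  apply derivable_continuous_pt; exists (df x); apply is_derive_Reals, Hd; lra.
- rewrite Rmin_left, Rmax_right in Hx by lra.
  specialize (HT0 x ltac:(lra)).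
  replace (f t / (1 + t) - l) with
    ((f T - l * (1 + T)) * / (1 + t) + (df x - l) * ((t - T) / (1 + t))).
  2:{ replace (f t) with (f T + df x * (t - T)) by lra. field; lra. }
  assert (0 < / (1 + t)) by (apply Rinv_0_lt_compat; lra).
  rewrite Rabs_right in HT1 by (apply Rle_ge, Rmult_le_pos; [apply Rabs_pos|lra]).
  eapply Rle_lt_trans; [apply Rabs_triang|]; rewrite !Rabs_mult.
  fold c; rewrite (Rabs_right (/ (1 + t))) by lra.
  assert (0 <= (t - T) / (1 + t) <= 1).
  { split; [apply Rdiv_le_0_compat; lra|]. apply (Rmult_le_reg_r (1 + t)); [lra|].
    replace ((t - T) / (1 + t) * (1 + t)) with (t - T) by (field; lra). lra. }
  rewrite (Rabs_right ((t - T) / (1 + t))) by lra.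
  generalize (Rabs_pos (df x - l)); intros.
  assert (Rabs (df x - l) * ((t - T) / (1 + t)) <= Rabs (df x - l) * 1) by (apply Rmult_le_compat_l; lra).
  lra.
Qed.

Lemma Rpower_lim (f : R -> R) (l a : R) :
  0 < l -> is_lim f p_infty l -> is_lim (fun t => Rpower (f t) a) p_infty (Rpower l a).
Proof.
intros Hl Hf; apply (is_lim_comp_continuous f (fun x => Rpower x a)); auto.
apply (ex_derive_continuous (fun x : R => Rpower x a)).
eexists; apply (is_derive_Rpower (fun x => x) l 1 a); auto.
apply (is_derive_id (K := R_AbsRing)).
Qed.

Lemma bounded_of_limit (f : R -> R) (l : R) :
  is_lim f p_infty l -> (forall t, 0 <= t -> f t <= 1 + t) ->
  exists K, forall t, 0 <= t -> f t <= K.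
Proof.
intros Hl Hf; apply is_lim_spec in Hl; destruct (Hl (mkposreal 1 Rlt_0_1)) as [T HT]; simpl in HT.
exists (Rmax (l + 1) (1 + T)); intros t Ht.
destruct (Rle_dec t T) as [h|h].
- eapply Rle_trans; [apply Hf; auto|]. eapply Rle_trans; [|apply Rmax_r]; lra.
- eapply Rle_trans; [|apply Rmax_l]. specialize (HT t ltac:(lra)). apply Rabs_def2 in HT; lra.
Qed.

Section Weight.
Variables (n gamma : R) (b' B' N : R -> R).
Hypothesis hn : 0 < n.
Hypothesis hgamma : 0 < gamma.
Hypothesis hB : forall t, 0 <= t -> is_derive B' t (b' t).
Hypothesis hB0 : B' 0 = 0.
Hypothesis hN : forall t, 0 <= t -> 0 < N t.
Hypothesis hbN : forall t, 0 <= t -> b' t = Rpower (N t) gamma.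

Let R0 t := exp (n * B' t) ^ 2 * N t.
Let E t := exp (2 * n * gamma * B' t).

Lemma rescaled_pos t : 0 <= t -> 0 < R0 t.
Proof. intros Ht; apply Rmult_lt_0_compat; [apply pow_lt, exp_pos|auto]. Qed.

Lemma weight_mul_b t : 0 <= t -> E t * b' t = Rpower (R0 t) gamma.
Proof.
intros Ht; rewrite hbN by auto; unfold R0.
rewrite <- Rpower_mult_distr by (auto; apply pow_lt, exp_pos).
f_equal. unfold E, Rpower; f_equal. rewrite exp_double, ln_exp; ring.
Qed.

(** The equation closes here: the coefficient b is a power of the energy, and the
    rescaling of the energy is exactly what exp(2 n gamma B) absorbs. *)
Lemma weight_derive t : 0 <= t -> is_derive E t (2 * n * gamma * Rpower (R0 t) gamma).
Proof.
intros Ht; rewrite <- weight_mul_b by auto; unfold E.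
generalize (hB t Ht); intros D. auto_derive.
- eexists; eassumption.
- use_derivative D; ring.
Qed.

Lemma weight_at0 : E 0 = 1.
Proof. unfold E; rewrite hB0, Rmult_0_r, exp_0; auto. Qed.

Lemma weight_upper C : (forall t, 0 <= t -> R0 t <= C) ->
  forall t, 0 <= t -> E t <= (1 + 2 * n * gamma * Rpower C gamma) * (1 + t).
Proof.
intros HC t Ht. set (r := 2 * n * gamma * Rpower C gamma).
assert (Hr : 0 < r).
{ unfold r; apply Rmult_lt_0_compat; [|apply Rpower_pos]. apply Rmult_lt_0_compat; lra. }
enough (E t - r * t <= E 0 - r * 0) by (rewrite weight_at0 in *; nra).
apply (nonincreasing_on_nonneg (fun t => E t - r * t)
   (fun t => 2 * n * gamma * Rpower (R0 t) gamma - r)); [| |lra].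
- intros s Hs; generalize (weight_derive s Hs); intros D; auto_derive.
  + eexists; eassumption.
  + use_derivative D; ring.
- intros s Hs; unfold r.
  assert (Rpower (R0 s) gamma <= Rpower C gamma).
  { apply Rle_Rpower_l; [lra|]; split; [apply rescaled_pos; auto|auto]. }
  assert (0 < 2 * n * gamma) by (apply Rmult_lt_0_compat; lra). nra.
Qed.

Lemma weight_lower c : 0 < c -> (forall t, 0 <= t -> c <= R0 t) ->
  forall t, 0 <= t -> Rmin 1 (2 * n * gamma * Rpower c gamma) * (1 + t) <= E t.
Proof.
intros Hc0 Hc t Ht. set (r := 2 * n * gamma * Rpower c gamma).
enough (E 0 - r * 0 <= E t - r * t).
{ rewrite weight_at0 in *; generalize (Rmin_l 1 r) (Rmin_r 1 r); nra. }
apply (nondecreasing_on_nonneg (fun t => E t - r * t)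
   (fun t => 2 * n * gamma * Rpower (R0 t) gamma - r)); [| |lra].
- intros s Hs; generalize (weight_derive s Hs); intros D; auto_derive.
  + eexists; eassumption.
  + use_derivative D; ring.
- intros s Hs; unfold r.
  assert (Rpower c gamma <= Rpower (R0 s) gamma).
  { apply Rle_Rpower_l; [lra|]; split; auto. }
  assert (0 < 2 * n * gamma) by (apply Rmult_lt_0_compat; lra). nra.
Qed.

Lemma weight_lim r : 0 < r -> is_lim R0 p_infty r ->
  is_lim (fun t => (1 + t) * exp (- (2 * n * gamma * B' t))) p_infty
    (1 / (2 * n * gamma * Rpower r gamma)).
Proof.
intros Hr Hlim.
assert (Hng : 0 < 2 * n * gamma) by (apply Rmult_lt_0_compat; lra).
assert (HL : 0 < 2 * n * gamma * Rpower r gamma) by (apply Rmult_lt_0_compat; [auto|apply Rpower_pos]).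
assert (HE : is_lim (fun t => E t / (1 + t)) p_infty (2 * n * gamma * Rpower r gamma)).
{ apply (slope_limit E (fun t => 2 * n * gamma * Rpower (R0 t) gamma) _ weight_derive).
  apply (is_lim_scal_l _ (2 * n * gamma) p_infty (Rpower r gamma)), Rpower_lim; auto. }
apply (is_lim_ext_nonneg (fun t => / (E t / (1 + t)))).
{ intros t Ht; unfold E; rewrite exp_Ropp; field; split; [apply Rgt_not_eq, exp_pos|lra]. }
replace (1 / (2 * n * gamma * Rpower r gamma)) with (/ (2 * n * gamma * Rpower r gamma))
  by (unfold Rdiv; ring).
apply (is_lim_inv _ p_infty (2 * n * gamma * Rpower r gamma)); auto.
intros C; injection C; lra.
Qed.

End Weight.

Lemma filterlim_scal_fun (H : RealHilbert) (f : R -> R) (g : R -> H) (a : R) (l : H) :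
  is_lim f p_infty a -> filterlim g (Rbar_locally p_infty) (locally l) ->
  filterlim (fun t => scal (f t) (g t)) (Rbar_locally p_infty) (locally (scal a l)).
Proof.
intros Hf Hg.
apply (filterlim_comp_2 (F := Rbar_locally p_infty) f g (fun (x : R) (y : H) => scal x y) Hf Hg).
apply (filterlim_scal (V := H) a l).
Qed.

Lemma norm_sq_lim (H : RealHilbert) (g : R -> H) (l : H) :
  filterlim g (Rbar_locally p_infty) (locally l) ->
  is_lim (fun t => norm (g t) ^ 2) p_infty (norm l ^ 2).
Proof.
intros Hg.
assert (Hn : is_lim (fun t => norm (g t)) p_infty (norm l)).
{ apply (filterlim_comp _ _ _ g (norm (V := H)) (Rbar_locally p_infty) (locally l)); auto.
  apply (filterlim_norm (V := H)). }
apply (is_lim_ext (fun t => norm (g t) * norm (g t))); [intros; ring|].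
replace (Finite (norm l ^ 2)) with (Rbar_mult (norm l) (norm l)) by (simpl; f_equal; ring).
apply is_lim_mult; simpl; auto.
Qed.

Lemma cvg_infty_in_intro (H : RealHilbert) (T : operator H) (f g : R -> H) (l : H) :
  dom T l -> (forall t, 0 <= t -> T (f t) = g t) ->
  filterlim f (Rbar_locally p_infty) (locally l) ->
  filterlim g (Rbar_locally p_infty) (locally (T l)) ->
  cvg_infty_in T f l.
Proof.
intros Hl HT Hf Hg; split; auto.
apply (filterlim_locally (F := Rbar_locally p_infty) (U := prod_UniformSpace H H)); intros eps.
generalize (proj1 (filterlim_locally (F := Rbar_locally p_infty) (U := H) f l) Hf eps)
  (proj1 (filterlim_locally (F := Rbar_locally p_infty) (U := H) g (T l)) Hg eps).
intros [T1 H1] [T2 H2]; exists (Rmax (Rmax T1 T2) 0); intros t Ht.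
assert (Rmax T1 T2 < t) by (eapply Rle_lt_trans; [apply Rmax_l|exact Ht]).
assert (0 < t) by (eapply Rle_lt_trans; [apply Rmax_r|exact Ht]).
generalize (Rmax_l T1 T2) (Rmax_r T1 T2); intros.
split; simpl.
- apply H1; lra.
- rewrite HT by lra; apply H2; lra.
Qed.

Lemma limit_bounded_away (f : R -> R) (c l : R) :
  0 < c -> (forall t, 0 <= t -> c <= Rabs (f t)) -> is_lim f p_infty l -> l <> 0.
Proof.
intros Hc Hf Hl ->; apply is_lim_spec in Hl.
destruct (Hl (mkposreal c Hc)) as [T HT]; simpl in HT.
specialize (HT (Rmax T 0 + 1)); generalize (Rmax_l T 0) (Rmax_r T 0); intros.
specialize (HT ltac:(lra)); rewrite Rminus_0_r in HT.
specialize (Hf (Rmax T 0 + 1) ltac:(lra)); lra.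
Qed.

(** * The rescaled solution and its limit *)

Section Profile.
Variables (H : RealHilbert) (A S : operator H) (e : nat -> H) (lam : nat -> R).
Hypothesis hA : self_adjoint A.
Hypothesis hS : is_sqrt A S.
Hypothesis he : eigenbasis A e lam.
Variables (gamma nu eps : R) (u0 u1 : H) (u du ddu : R -> H).
Hypothesis hgamma : 0 < gamma.
Hypothesis hu0 : dom A u0.
Hypothesis hu1 : dom S u1.
Hypothesis hnu : is_lowest_frequency e lam u0 u1 nu.
Hypothesis hsol : is_global_solution A S gamma u0 u1 eps u du ddu.
Variables (c1 c2 c3 : R) (b' db B' : R -> R).
Hypothesis hc1 : 0 < c1.
Hypothesis hc2 : 0 < c2.
Hypothesis hc3 : 0 < c3.
Hypothesis hb : slow_coefficient c1 c2 c3 b' db B'.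
Hypothesis hbE : forall t, 0 <= t -> b' t = b S gamma u t.
Hypothesis hBE : forall t, 0 <= t -> B' t = B S gamma u t.
Hypothesis hsmall : small_eps (nu ^ 2) gamma c2 c3 eps.
Hypothesis hpos : forall t, 0 <= t -> 0 < norm (S (u t)) ^ 2.

Let D k := ip u1 (e k) ^ 2 + lam k ^ 2 * ip u0 (e k) ^ 2.
Let n := nu ^ 2.
Let W t := exp (n * B' t).

Lemma lowest_frequency_pos : 0 < nu.
Proof. destruct hnu as [[k [_ E]] _]; rewrite <- E; apply (proj2 he k). Qed.

Let hn : 0 < n.
Proof. apply pow_lt, lowest_frequency_pos. Qed.

Lemma sqrt_eigenbasis k : dom S (e k) /\ S (e k) = scal (lam k) (e k).
Proof.
destruct (proj2 he k) as (Hl & Hd & He).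
apply (sqrt_eigenvector H A S); auto.
Qed.

Lemma coordinate_A x k : dom A x -> ip (A x) (e k) = lam k ^ 2 * ip x (e k).
Proof. destruct (proj2 he k) as (_ & Hd & He); apply eigen_coordinate; auto. Qed.

Lemma coordinate_S x k : dom S x -> ip (S x) (e k) = lam k * ip x (e k).
Proof.
destruct (sqrt_eigenbasis k) as (Hd & He); apply eigen_coordinate; auto; apply hS.
Qed.

Lemma coordinate_mode k :
  damped_mode eps (lam k ^ 2) b' (extend (fun t => ip (u t) (e k)) (fun t => ip (du t) (e k)))
    (extend (fun t => ip (du t) (e k)) (fun t => ip (ddu t) (e k))) (fun t => ip (ddu t) (e k)).
Proof.
destruct (proj2 he k) as (_ & Hd & He).
eapply solution_mode; eauto.
Qed.

Lemma mode_data k :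
  extend (fun t => ip (u t) (e k)) (fun t => ip (du t) (e k)) 0 = ip u0 (e k) /\
  extend (fun t => ip (du t) (e k)) (fun t => ip (ddu t) (e k)) 0 = ip u1 (e k).
Proof. rewrite !extend_at0, (sol_init0 hsol), (sol_init1 hsol); auto. Qed.

Lemma lowest_is_low : 0 <= n <= 3 * high_rate n gamma.
Proof. generalize hn; unfold high_rate; intros; nra. Qed.

Lemma D_nonneg k : 0 <= D k.
Proof.
unfold D; apply Rplus_le_le_0_compat; [apply pow2_ge_0|].
apply Rmult_le_pos; apply pow2_ge_0.
Qed.

(** Such a mode has null data, and the equation has only the zero solution. *)
Lemma coordinate_below k : lam k < nu ->
  forall t, 0 <= t -> ip (u t) (e k) = 0 /\ ip (du t) (e k) = 0 /\ ip (ddu t) (e k) = 0.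
Proof.
intros Hk t Ht; destruct hsmall as (he0 & h3 & _).
destruct (mode_data k) as [E0 E1].
assert (Hz : ip u0 (e k) = 0 /\ ip u1 (e k) = 0).
{ destruct (Req_dec (ip u0 (e k)) 0), (Req_dec (ip u1 (e k)) 0); auto;
    generalize (proj2 hnu k ltac:(tauto)); lra. }
destruct (mode_zero _ _ _ _ _ _ hc1 hc2 hc3 hb _ _ _ _ _ (proj1 he0) (coordinate_mode k)
   ltac:(apply pow_lt, (proj2 he k)) h3 ltac:(rewrite E0; tauto) ltac:(rewrite E1; tauto) t Ht)
  as [Z0 Z1].
generalize (mode_eq (coordinate_mode k) t Ht).
rewrite Z0, Z1. rewrite extend_nonneg in Z0, Z1 by auto.
intros E; repeat split; auto. apply (Rmult_eq_reg_l eps); lra.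
Qed.

Lemma above_sq k : nu <= lam k -> nu ^ 2 <= lam k ^ 2.
Proof. intros Hk; apply pow_incr; generalize lowest_frequency_pos; lra. Qed.

Lemma coordinate_bound k t : 0 <= t ->
  lam k ^ 2 * (W t * ip (u t) (e k)) ^ 2 <= energy_bound (nu ^ 2) gamma c1 c2 * D k /\
  nu ^ 2 * (W t * ip (u t) (e k)) ^ 2 <= energy_bound (nu ^ 2) gamma c1 c2 * D k.
Proof.
intros Ht; destruct (Rle_dec nu (lam k)) as [Hk|Hk].
- generalize (mode_uniform_bound _ _ _ _ _ _ hc1 hc2 hc3 hb (nu ^ 2) gamma eps hn hgamma hsmall
    _ _ _ _ t (above_sq k Hk) (coordinate_mode k) Ht).
  destruct (mode_data k) as [-> ->]. rewrite extend_nonneg by auto.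
  fold (W t); fold (D k); intros E; split; auto. eapply Rle_trans; [|exact E].
  apply Rmult_le_compat_r; [apply pow2_ge_0|apply above_sq; auto].
- destruct (coordinate_below k ltac:(lra) t Ht) as [-> _].
  assert (0 <= energy_bound (nu ^ 2) gamma c1 c2 * D k).
  { apply Rmult_le_pos; [|apply D_nonneg].
    assert (0 < 2 / c1) by (apply Rdiv_lt_0_compat; lra).
    generalize (low_bound_pos c2 (nu ^ 2) gamma).
    unfold energy_bound; set (q := low_bound c2 (3 * high_rate (nu ^ 2) gamma)).
    assert (0 < high_rate (nu ^ 2) gamma).
    { unfold high_rate; apply Rmult_lt_0_compat; [exact hn|lra]. }
    intros; nra. }
  rewrite Rmult_0_r, pow_i, !Rmult_0_r by auto; auto.
Qed.

Lemma coordinate_cvg k :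
  exists l : R, is_lim (fun t => W t * ip (u t) (e k)) p_infty l /\ (lam k <> nu -> l = 0).
Proof.
destruct (Rle_dec nu (lam k)) as [Hk|Hk].
- destruct (mode_cvg _ _ _ _ _ _ hc1 hc2 hc3 hb (nu ^ 2) gamma eps hn hgamma hsmall
    _ _ _ _ (above_sq k Hk) (coordinate_mode k)) as [l [Hl Hl0]].
  exists l; split.
  + apply (is_lim_ext_nonneg _ _ l) with (2 := Hl); intros t Ht; rewrite extend_nonneg; auto.
  + intros Hne; apply Hl0. generalize lowest_frequency_pos; intros. nra.
- exists 0; split; auto.
  apply (is_lim_ext_nonneg (fun _ => 0)); [|apply is_lim_const].
  intros t Ht; destruct (coordinate_below k ltac:(lra) t Ht) as [-> _]; ring.
Qed.

Lemma dom_sqrt_u0 : dom S u0 /\ dom S (S u0) /\ A u0 = S (S u0).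
Proof.
destruct hS as (_ & _ & Hd & Hs). destruct (proj1 (Hd u0) hu0); auto.
Qed.

(** D k and lam k ^ 2 * D k are squared coordinates of u1 and S u0, respectively of
    S u1 and A u0: summability is exactly the regularity of the data. *)
Lemma is_series_D : is_series D (norm u1 ^ 2 + norm (S u0) ^ 2).
Proof.
apply (is_series_ext (fun k => ip u1 (e k) ^ 2 + ip (S u0) (e k) ^ 2)).
{ intros k; unfold D; rewrite coordinate_S by apply dom_sqrt_u0.
  match goal with |- ?x = ?y => change (@eq R x y) end; ring. }
apply (is_series_plus (K := R_AbsRing) (V := R_NormedModule)); apply parseval_sq; apply he.
Qed.

Lemma is_series_weighted_D :
  is_series (fun k => lam k ^ 2 * D k) (norm (S u1) ^ 2 + norm (A u0) ^ 2).
Proof.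
apply (is_series_ext (fun k => ip (S u1) (e k) ^ 2 + ip (A u0) (e k) ^ 2)).
{ intros k; unfold D; rewrite coordinate_S, coordinate_A by auto.
  match goal with |- ?x = ?y => change (@eq R x y) end; ring. }
apply (is_series_plus (K := R_AbsRing) (V := R_NormedModule)); apply parseval_sq; apply he.
Qed.

Lemma solution_in_domains t : 0 <= t ->
  dom S (u t) /\ dom S (du t) /\ dom A (u t).
Proof.
intros Ht; destruct (sol_dom_S hsol Ht); generalize (sol_dom_A hsol Ht); auto.
Qed.

Lemma weighted_energy_bound t : 0 <= t ->
  W t ^ 2 * norm (S (u t)) ^ 2
    <= energy_bound (nu ^ 2) gamma c1 c2 * (norm u1 ^ 2 + norm (S u0) ^ 2).
Proof.
intros Ht; rewrite <- norm_scal_sq.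
rewrite <- (is_series_unique _ _ is_series_D), <- Series_scal_l.
apply (norm_sq_le_of_coordinates H e (proj1 he)).
- eapply ex_series_scaled, is_series_D.
- intros k; rewrite ip_scal_l, coordinate_S by (apply solution_in_domains; auto).
  eapply Rle_trans; [|apply (proj1 (coordinate_bound k t Ht))]. right; ring.
Qed.

Lemma weighted_energy_ge k t : 0 <= t -> lam k = nu ->
  nu ^ 2 * (W t * ip (u t) (e k)) ^ 2 <= W t ^ 2 * norm (S (u t)) ^ 2.
Proof.
intros Ht Hk. rewrite Rpow_mult_distr, <- Rmult_assoc, (Rmult_comm (nu ^ 2)), Rmult_assoc.
apply Rmult_le_compat_l; [apply pow2_ge_0|].
rewrite <- Hk, <- Rpow_mult_distr, <- coordinate_S by (apply solution_in_domains; auto).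
rewrite <- (pow2_abs (ip _ _)).
assert (Hc : Rabs (ip (S (u t)) (e k)) <= norm (S (u t)) * norm (e k)) by apply cauchy_schwarz.
assert (He1 : norm (e k) <= 1).
{ destruct (basis_norm_sq H e (proj1 he) k) as [He _]; rewrite ip_norm in He.
  generalize (norm_ge_0 (e k)); intros; nra. }
apply pow_incr; split; [apply Rabs_pos|].
eapply Rle_trans; [exact Hc|]. generalize (norm_ge_0 (S (u t))); intros; nra.
Qed.

(** The dominating sequences are multiples of D k for u and S u, and of
    lam k ^ 2 * D k for A u. *)
Lemma profile_exists : exists Y : H,
  (forall k, is_lim (fun t => W t * ip (u t) (e k)) p_infty (ip Y (e k))) /\
  (forall k, lam k <> nu -> ip Y (e k) = 0) /\
  (dom A Y /\ A Y = scal (nu ^ 2) Y) /\ (dom S Y /\ S Y = scal nu Y) /\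
  filterlim (fun t => scal (W t) (u t)) (Rbar_locally p_infty) (locally Y) /\
  filterlim (fun t => scal (W t) (S (u t))) (Rbar_locally p_infty) (locally (S Y)) /\
  filterlim (fun t => scal (W t) (A (u t))) (Rbar_locally p_infty) (locally (A Y)) /\
  filterlim (fun t => scal (W t) (component e lam nu (u t))) (Rbar_locally p_infty) (locally Y).
Proof.
pose (C := energy_bound (nu ^ 2) gamma c1 c2).
pose (a := fun k => real (Lim (fun t => W t * ip (u t) (e k)) p_infty)).
assert (Ha : forall k, is_lim (fun t => W t * ip (u t) (e k)) p_infty (a k) /\ (lam k <> nu -> a k = 0)).
{ intros k; destruct (coordinate_cvg k) as [l [Hl Hl0]].
  unfold a; rewrite (is_lim_unique _ _ _ Hl); auto. }
assert (HMex : ex_series (fun k => / nu ^ 2 * (C * D k))).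
{ apply (ex_series_scaled _ (C * (norm u1 ^ 2 + norm (S u0) ^ 2))).
  apply (is_series_scal (K := R_AbsRing) (V := R_NormedModule) C), is_series_D. }
assert (HM : forall k t, 0 <= t -> (W t * ip (u t) (e k)) ^ 2 <= / nu ^ 2 * (C * D k)).
{ intros k t Ht; destruct (coordinate_bound k t Ht) as [_ Hb].
  apply (Rmult_le_reg_l (nu ^ 2)); auto.
  replace (nu ^ 2 * (/ nu ^ 2 * (C * D k))) with (C * D k) by (field; apply Rgt_not_eq, lowest_frequency_pos).
  exact Hb. }
destruct (cvg_of_coordinates H e (proj1 he) (fun t => scal (W t) (u t)) a
            (fun k => / nu ^ 2 * (C * D k))) as [Y [HY HYlim]]; auto.
{ intros k t Ht; rewrite ip_scal_l; auto. }
{ intros k; apply is_lim_ext with (2 := proj1 (Ha k)); intros t; rewrite ip_scal_l; auto. }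
assert (HY0 : forall k, lam k <> nu -> ip Y (e k) = 0) by (intros k; rewrite HY; apply Ha).
assert (HAY : dom A Y /\ A Y = scal (nu ^ 2) Y).
{ apply (eigenspace_in_domain H e (proj1 he) A (fun k => lam k ^ 2)); auto.
  - intros k; apply (proj2 he k).
  - intros k Hk; apply HY0; intros E; apply Hk; rewrite E; auto. }
assert (HSY : dom S Y /\ S Y = scal nu Y).
{ apply (eigenspace_in_domain H e (proj1 he) S lam); auto.
  - apply hS.
  - apply sqrt_eigenbasis. }
exists Y; split; [intros k; rewrite HY; apply Ha|].
do 4 (split; auto).
split; [|split].
- destruct (cvg_of_coordinates H e (proj1 he) (fun t => scal (W (Rmax 0 t)) (S (u (Rmax 0 t))))
     (fun k => lam k * a k) (fun k => C * D k)) as [Z [HZ HZlim]].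
  + apply (ex_series_scaled _ _ C is_series_D).
  + intros k t Ht; rewrite Rmax_right, ip_scal_l, coordinate_S by (auto; apply solution_in_domains; auto).
    eapply Rle_trans; [|apply (proj1 (coordinate_bound k t Ht))]. right; ring.
  + intros k; apply (is_lim_ext_nonneg (fun t => lam k * (W t * ip (u t) (e k)))).
    * intros t Ht; rewrite Rmax_right, ip_scal_l, coordinate_S by (auto; apply solution_in_domains; auto). ring.
    * apply (is_lim_scal_l _ (lam k) p_infty (a k)), Ha.
  + assert (E : S Y = Z).
    { apply (coordinates_ext H e (proj1 he)); intros k; rewrite HZ, coordinate_S, HY by apply HSY; auto. }
    rewrite E. apply (filterlim_ext_loc (F := Rbar_locally p_infty)) with (2 := HZlim).
    exists 0; intros t Ht; rewrite Rmax_right by lra; auto.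
- destruct (cvg_of_coordinates H e (proj1 he) (fun t => scal (W (Rmax 0 t)) (A (u (Rmax 0 t))))
     (fun k => lam k ^ 2 * a k) (fun k => C * (lam k ^ 2 * D k))) as [Z [HZ HZlim]].
  + apply (ex_series_scaled _ _ C is_series_weighted_D).
  + intros k t Ht; rewrite Rmax_right, ip_scal_l, coordinate_A by (auto; apply solution_in_domains; auto).
    apply Rle_trans with (lam k ^ 2 * (lam k ^ 2 * (W t * ip (u t) (e k)) ^ 2)); [right; ring|].
    apply Rle_trans with (lam k ^ 2 * (C * D k)); [|right; ring].
    apply Rmult_le_compat_l; [apply pow2_ge_0|]. apply (coordinate_bound k t Ht).
  + intros k; apply (is_lim_ext_nonneg (fun t => lam k ^ 2 * (W t * ip (u t) (e k)))).
    * intros t Ht; rewrite Rmax_right, ip_scal_l, coordinate_A by (auto; apply solution_in_domains; auto). ring.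
    * apply (is_lim_scal_l _ (lam k ^ 2) p_infty (a k)), Ha.
  + assert (E : A Y = Z).
    { apply (coordinates_ext H e (proj1 he)); intros k; rewrite HZ, coordinate_A, HY by apply HAY; auto. }
    rewrite E. apply (filterlim_ext_loc (F := Rbar_locally p_infty)) with (2 := HZlim).
    exists 0; intros t Ht; rewrite Rmax_right by lra; auto.
- destruct (cvg_of_coordinates H e (proj1 he) (fun t => scal (W t) (component e lam nu (u t))) a
            (fun k => / nu ^ 2 * (C * D k))) as [Z [HZ HZlim]]; auto.
  + intros k t Ht; rewrite ip_scal_l, (proj2 (component_spec H e (proj1 he) lam nu (u t))).
    eapply Rle_trans; [|apply (HM k t Ht)].
    destruct (Req_EM_T (lam k) nu); [lra|]. rewrite Rmult_0_r, pow_i by auto; apply pow2_ge_0.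
  + intros k. destruct (Req_EM_T (lam k) nu) as [h|h].
    * apply is_lim_ext with (2 := proj1 (Ha k)); intros t.
      rewrite ip_scal_l, (proj2 (component_spec H e (proj1 he) lam nu (u t))).
      destruct (Req_EM_T (lam k) nu); [auto|tauto].
    * rewrite (proj2 (Ha k) h). apply (is_lim_ext (fun _ => 0)); [|apply is_lim_const].
      intros t; rewrite ip_scal_l, (proj2 (component_spec H e (proj1 he) lam nu (u t))).
      destruct (Req_EM_T (lam k) nu); [tauto|ring].
  + assert (E : Y = Z).
    { apply (coordinates_ext H e (proj1 he)); intros k; rewrite HZ, HY; auto. }
    rewrite E; auto.
Qed.

Section Velocity.
Variable K : R.
Hypothesis hK : forall t, 0 <= t -> exp (- (2 * nu ^ 2 * gamma * B' t)) <= K / (1 + t).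

Lemma velocity_cvg Y :
  (forall k, is_lim (fun t => W t * ip (u t) (e k)) p_infty (ip Y (e k))) ->
  (forall k, lam k <> nu -> ip Y (e k) = 0) -> dom S Y ->
  is_lim (fun t => (1 + t) * b' t) p_infty (1 / (2 * nu ^ 2 * gamma)) ->
  filterlim (fun t => scal ((1 + t) * W t) (du t)) (Rbar_locally p_infty)
    (locally (scal (- (1 / (2 * gamma))) Y)) /\
  filterlim (fun t => scal ((1 + t) * W t) (S (du t))) (Rbar_locally p_infty)
    (locally (S (scal (- (1 / (2 * gamma))) Y))).
Proof.
intros HY HY0 HSY Hbl.
destruct (mode_velocity_bound _ _ _ _ _ _ hc1 hc2 hc3 hb (nu ^ 2) gamma eps hn hgamma hsmall K hK)
  as [C [HC HCb]].
assert (Hbound : forall k t, 0 <= t -> ((1 + t) * W t * ip (du t) (e k)) ^ 2 <= C * D k).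
{ intros k t Ht; destruct (Rle_dec nu (lam k)) as [Hk|Hk].
  - generalize (HCb _ _ _ _ t (above_sq k Hk) (coordinate_mode k) Ht).
    destruct (mode_data k) as [-> ->]. rewrite extend_nonneg by auto. rewrite <- Rmult_assoc; auto.
  - destruct (coordinate_below k ltac:(lra) t Ht) as (_ & -> & _).
    rewrite Rmult_0_r, pow_i by auto. apply Rmult_le_pos; auto; apply D_nonneg. }
assert (Hlim : forall k, is_lim (fun t => (1 + t) * W t * ip (du t) (e k)) p_infty
                 (- (1 / (2 * gamma)) * ip Y (e k))).
{ intros k; destruct (Rle_dec nu (lam k)) as [Hk|Hk].
  - apply (is_lim_ext_nonneg (fun t => (1 + t) * (W t *
       extend (fun t => ip (du t) (e k)) (fun t => ip (ddu t) (e k)) t))).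
    { intros t Ht; rewrite extend_nonneg by auto; ring. }
    apply (mode_velocity_cvg _ _ _ _ _ _ hc1 hc2 hc3 hb (nu ^ 2) gamma eps hn hgamma hsmall K hK
       _ _ _ _ _ (above_sq k Hk) (coordinate_mode k) Hbl).
    + apply is_lim_ext_nonneg with (2 := HY k); intros t Ht; rewrite extend_nonneg; auto.
    + intros Hlt; apply HY0; intros E; rewrite E in Hlt; lra.
  - rewrite HY0, Rmult_0_r by lra.
    apply (is_lim_ext_nonneg (fun _ => 0)); [|apply is_lim_const].
    intros t Ht; destruct (coordinate_below k ltac:(lra) t Ht) as (_ & -> & _); ring. }
split.
- destruct (cvg_of_coordinates H e (proj1 he) (fun t => scal ((1 + t) * W t) (du t))
     (fun k => - (1 / (2 * gamma)) * ip Y (e k)) (fun k => C * D k)) as [Z [HZ HZlim]].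
  + apply (ex_series_scaled _ _ C is_series_D).
  + intros k t Ht; rewrite ip_scal_l; auto.
  + intros k; apply is_lim_ext with (2 := Hlim k); intros t; rewrite ip_scal_l; auto.
  + assert (E : scal (- (1 / (2 * gamma))) Y = Z).
    { apply (coordinates_ext H e (proj1 he)); intros k; rewrite HZ, ip_scal_l; auto. }
    rewrite E; auto.
- destruct (cvg_of_coordinates H e (proj1 he)
     (fun t => scal ((1 + Rmax 0 t) * W (Rmax 0 t)) (S (du (Rmax 0 t))))
     (fun k => lam k * (- (1 / (2 * gamma)) * ip Y (e k))) (fun k => C * (lam k ^ 2 * D k)))
     as [Z [HZ HZlim]].
  + apply (ex_series_scaled _ _ C is_series_weighted_D).
  + intros k t Ht; rewrite Rmax_right, ip_scal_l, coordinate_S by (auto; apply solution_in_domains; auto).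
    apply Rle_trans with (lam k ^ 2 * ((1 + t) * W t * ip (du t) (e k)) ^ 2); [right; ring|].
    apply Rle_trans with (lam k ^ 2 * (C * D k)); [|right; ring].
    apply Rmult_le_compat_l; [apply pow2_ge_0|auto].
  + intros k; apply (is_lim_ext_nonneg (fun t => lam k * ((1 + t) * W t * ip (du t) (e k)))).
    * intros t Ht; rewrite Rmax_right, ip_scal_l, coordinate_S by (auto; apply solution_in_domains; auto). ring.
    * apply (is_lim_scal_l _ (lam k) p_infty (- (1 / (2 * gamma)) * ip Y (e k))), Hlim.
  + assert (E : S (scal (- (1 / (2 * gamma))) Y) = Z).
    { apply (coordinates_ext H e (proj1 he)); intros k.
      rewrite HZ, coordinate_S, ip_scal_l by (apply dom_scal; auto); auto. }
    rewrite E. apply (filterlim_ext_loc (F := Rbar_locally p_infty)) with (2 := HZlim).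
    exists 0; intros t Ht; rewrite Rmax_right by lra; auto.
Qed.

(** The factor 1 + m in the bound of each mode is paid by the regularity of the
    data. *)
Lemma acceleration_bound : exists C : R, 0 <= C /\ forall t, 0 <= t ->
  ((1 + t) ^ 2 * W t) ^ 2 * norm (ddu t) ^ 2 <= C.
Proof.
destruct (mode_acceleration_bound _ _ _ _ _ _ hc1 hc2 hc3 hb (nu ^ 2) gamma eps hn hgamma hsmall K hK)
  as [C [HC HCb]].
assert (HM : is_series (fun k => C * (D k + lam k ^ 2 * D k))
   (C * ((norm u1 ^ 2 + norm (S u0) ^ 2) + (norm (S u1) ^ 2 + norm (A u0) ^ 2)))).
{ apply (is_series_scal (K := R_AbsRing) (V := R_NormedModule) C).
  apply (is_series_plus (K := R_AbsRing) (V := R_NormedModule));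
    [apply is_series_D|apply is_series_weighted_D]. }
eexists; split; [|intros t Ht; rewrite <- norm_scal_sq;
  eapply Rle_trans; [apply (norm_sq_le_of_coordinates H e (proj1 he)); [eexists; exact HM|]
                    |right; apply is_series_unique; exact HM]].
- apply Rmult_le_pos; auto. generalize (pow2_ge_0 (norm u1)) (pow2_ge_0 (norm (S u0)))
    (pow2_ge_0 (norm (S u1))) (pow2_ge_0 (norm (A u0))); intros; lra.
- intros k; rewrite ip_scal_l.
  generalize (D_nonneg k) (pow2_ge_0 (lam k)); intros HD Hl.
  assert (0 <= lam k ^ 2 * D k) by (apply Rmult_le_pos; auto).
  destruct (Rle_dec nu (lam k)) as [Hk|Hk].
  + generalize (HCb _ _ _ _ t (above_sq k Hk) (coordinate_mode k) Ht).
    destruct (mode_data k) as [-> ->]. fold (D k); fold (W t); rewrite <- Rmult_assoc.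
    intros; eapply Rle_trans; [eassumption|right; ring].
  + destruct (coordinate_below k ltac:(lra) t Ht) as (_ & _ & ->).
    rewrite Rmult_0_r, pow_i by auto. apply Rmult_le_pos; lra.
Qed.

End Velocity.

Let N t := norm (S (u t)) ^ 2.
Let Cu := energy_bound n gamma c1 c2 * (norm u1 ^ 2 + norm (S u0) ^ 2).
Let phi t := (1 + t) * exp (- (2 * n * gamma * B' t)).

Let hbN t : 0 <= t -> b' t = Rpower (N t) gamma.
Proof. intros Ht; rewrite hbE, b_eq_Rpower; auto. Qed.
Let hprim := slow_prim hb.
Let hprim0 := slow_prim0 hb.

Lemma weight_inverse t : 0 <= t ->
  exp (- 2 * nu ^ 2 * gamma * B S gamma u t) = / exp (2 * n * gamma * B' t) /\
  exp (- 2 * nu ^ 2 * gamma * B S gamma u t) = phi t / (1 + t).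
Proof.
intros Ht; rewrite <- hBE by auto.
assert (E : exp (- 2 * nu ^ 2 * gamma * B' t) = exp (- (2 * n * gamma * B' t)))
  by (f_equal; unfold n; ring).
rewrite E; split; [apply exp_Ropp|unfold phi; field; lra].
Qed.

(** The rescaled energy is bounded by the data, uniformly in eps, so the weight
    grows at most linearly. *)
Lemma weight_bound_below t : 0 <= t ->
  / (1 + 2 * n * gamma * Rpower Cu gamma) / (1 + t) <= exp (- 2 * nu ^ 2 * gamma * B S gamma u t).
Proof.
intros Ht; rewrite (proj1 (weight_inverse t Ht)).
assert (0 < 1 + 2 * n * gamma * Rpower Cu gamma).
{ assert (0 < 2 * n * gamma * Rpower Cu gamma); [|lra].
  apply Rmult_lt_0_compat; [|apply Rpower_pos]. apply Rmult_lt_0_compat; lra. }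
unfold Rdiv; rewrite <- Rinv_mult. apply Rinv_le_contravar; [apply exp_pos|].
apply (weight_upper n gamma b' B' N); auto.
intros s Hs; apply (weighted_energy_bound s Hs).
Qed.

(** A single coordinate bounded away from zero keeps the rescaled energy bounded
    below; with a bound c independent of eps, so is the constant. *)
Lemma weight_bound_above k c : lam k = nu -> 0 < c ->
  (forall t, 0 <= t -> c <= Rabs (W t * ip (u t) (e k))) ->
  forall t, 0 <= t ->
    exp (- 2 * nu ^ 2 * gamma * B S gamma u t)
      <= / Rmin 1 (2 * n * gamma * Rpower (n * c ^ 2) gamma) / (1 + t).
Proof.
intros Hk Hc Hlow t Ht; rewrite (proj1 (weight_inverse t Ht)).
assert (0 < n * c ^ 2) by (apply Rmult_lt_0_compat; [auto|apply pow_lt; auto]).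
assert (0 < Rmin 1 (2 * n * gamma * Rpower (n * c ^ 2) gamma)).
{ apply Rmin_glb_lt; [lra|]. apply Rmult_lt_0_compat; [|apply Rpower_pos]. apply Rmult_lt_0_compat; lra. }
unfold Rdiv; rewrite <- Rinv_mult. apply Rinv_le_contravar; [apply Rmult_lt_0_compat; lra|].
apply (weight_lower n gamma b' B' N); auto.
intros s Hs. eapply Rle_trans; [|apply (weighted_energy_ge k s Hs Hk)].
apply Rmult_le_compat_l; [left; exact hn|]. fold n; fold (W s). rewrite <- (pow2_abs (W s * _)).
apply pow_incr; split; [lra|auto].
Qed.

(** With phi = (1+t) exp(- 2 n gamma B), which has a positive limit, every power
    of 1+t in the statement is a power of phi times a power of exp(n B); the latter
    is absorbed in the rescaled solution. *)
Lemma solution_asymptotics k0 :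
  (forall l : R, is_lim (fun t => W t * ip (u t) (e k0)) p_infty l -> l <> 0) ->
  (exists uinf : H, uinf <> zero /\ in_eigenspace e lam nu uinf /\
        cvg_infty_in A
          (fun t => scal (Rpower (1 + t) (1 / (2 * gamma))) (u t)) uinf /\
        cvg_infty_in S
          (fun t => scal (Rpower (1 + t) (1 / (2 * gamma)))
                         (scal (1 + t) (du t)))
          (scal (- (1 / (2 * gamma))) uinf)) /\
      (exists Ke1 Ke2 : R, 0 < Ke1 /\ 0 < Ke2 /\
        forall t, 0 <= t ->
          Ke1 / (1 + t) <= exp (- 2 * nu ^ 2 * gamma * B S gamma u t)
            <= Ke2 / (1 + t)) /\
      is_lim (fun t => (1 + t) * b S gamma u t) p_infty
             (1 / (2 * nu ^ 2 * gamma)) /\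
      is_lim (fun t => Rpower (1 + t) (1 / gamma)
                       * norm (component e lam nu (u t)) ^ 2) p_infty
             (1 / (nu ^ 2 * Rpower (2 * nu ^ 2 * gamma) (1 / gamma))) /\
      (exists Ke : R, forall t, 0 <= t ->
        norm (ddu t) ^ 2 <= Ke * (1 / Rpower (1 + t) (4 + 1 / gamma))).
Proof.
intros Hk0.
destruct profile_exists
  as (Y & HY & HY0 & [HAd HAY] & [HSd HSY] & HlY & HlS & HlA & HlC).
fold n in HY, HlY, HlS, HlA, HlC.
assert (HYn : Y <> zero).
{ intros E; apply (Hk0 _ (HY k0)); rewrite E; apply ip_zero_l. }
assert (HYp : 0 < norm Y ^ 2).
{ rewrite <- ip_norm; destruct (Req_dec (ip Y Y) 0) as [h|h].
  - elim HYn; apply ip_self_eq0; auto.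
  - generalize (ip_self_nonneg H Y); lra. }
pose (r := n * norm Y ^ 2).
assert (Hr : 0 < r) by (apply Rmult_lt_0_compat; auto).
assert (Hng : 0 < 2 * n * gamma) by (apply Rmult_lt_0_compat; lra).
assert (HR : is_lim (fun t => W t ^ 2 * N t) p_infty r).
{ replace r with (norm (S Y) ^ 2) by (rewrite HSY, norm_scal_sq; auto).
  apply (is_lim_ext (fun t => norm (scal (W t) (S (u t))) ^ 2)).
  { intros t; rewrite norm_scal_sq; auto. }
  apply norm_sq_lim; exact HlS. }
generalize (weight_lim n gamma b' B' N hn hgamma hprim hpos hbN r Hr HR); fold phi; intros Hphi.
set (L := 1 / (2 * n * gamma * Rpower r gamma)) in *.
assert (HL : 0 < L).
{ apply Rdiv_lt_0_compat; [lra|]. apply Rmult_lt_0_compat; auto; apply Rpower_pos. }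
assert (Hphi_pos : forall t, 0 <= t -> 0 < phi t).
{ intros t Ht; apply Rmult_lt_0_compat; [lra|apply exp_pos]. }
assert (Hphi_le : forall t, 0 <= t -> phi t <= 1 + t).
{ intros t Ht; unfold phi. rewrite <- (Rmult_1_r (1 + t)) at 2.
  apply Rmult_le_compat_l; [lra|]. apply exp_le1.
  generalize (slow_prim_nonneg _ _ _ _ _ _ hc1 hb t Ht); intros.
  assert (0 <= 2 * n * gamma * B' t) by (apply Rmult_le_pos; lra). lra. }
destruct (bounded_of_limit phi L Hphi Hphi_le) as [K HK].
assert (HKpos : 0 < K) by (eapply Rlt_le_trans; [apply (Hphi_pos 0)|apply HK]; lra).
assert (HKw : forall t, 0 <= t -> exp (- (2 * nu ^ 2 * gamma * B' t)) <= K / (1 + t)).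
{ intros t Ht. apply (Rmult_le_reg_l (1 + t)); [lra|].
  replace ((1 + t) * (K / (1 + t))) with K by (field; lra). apply HK; auto. }
assert (Hbl : is_lim (fun t => (1 + t) * b' t) p_infty (1 / (2 * n * gamma))).
{ apply (is_lim_ext_nonneg (fun t => phi t * Rpower (W t ^ 2 * N t) gamma)).
  { intros t Ht; generalize (weight_mul_b n gamma b' B' N hpos hbN t Ht); intros E.
    change (exp (2 * n * gamma * B' t) * b' t = Rpower (W t ^ 2 * N t) gamma) in E.
    rewrite <- E; unfold phi; rewrite exp_Ropp; field. apply Rgt_not_eq, exp_pos. }
  replace (1 / (2 * n * gamma)) with (L * Rpower r gamma).
  2:{ unfold L; field. generalize (Rpower_pos r gamma); intros. repeat split; lra. }
  apply (is_lim_mult _ _ p_infty L (Rpower r gamma)); simpl; auto.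
  apply Rpower_lim; auto. }
assert (HPow : forall a t, 0 <= t ->
    Rpower (phi t) a = Rpower (1 + t) a * exp (- (2 * n * (gamma * a) * B' t))).
{ intros a t Ht; unfold phi. rewrite <- Rpower_mult_distr by (lra || apply exp_pos).
  f_equal. unfold Rpower; rewrite ln_exp; f_equal; ring. }
assert (HPhi1 : forall t, 0 <= t ->
   Rpower (1 + t) (1 / (2 * gamma)) = Rpower (phi t) (1 / (2 * gamma)) * W t).
{ intros t Ht; rewrite HPow, Rmult_assoc by auto; unfold W. rewrite <- exp_plus.
  replace (- (2 * n * (gamma * (1 / (2 * gamma))) * B' t) + n * B' t) with 0 by (field; lra).
  rewrite exp_0; ring. }
assert (HPhi2 : forall t, 0 <= t ->
   Rpower (1 + t) (1 / gamma) = Rpower (phi t) (1 / gamma) * W t ^ 2).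
{ intros t Ht; rewrite HPow, Rmult_assoc by auto; unfold W. rewrite exp_double, <- exp_plus.
  replace (- (2 * n * (gamma * (1 / gamma)) * B' t) + 2 * (n * B' t)) with 0 by (field; lra).
  rewrite exp_0; ring. }
pose (kap := Rpower L (1 / (2 * gamma))).
assert (Hkap : 0 < kap) by apply Rpower_pos.
assert (Hkl : is_lim (fun t => Rpower (phi t) (1 / (2 * gamma))) p_infty kap)
  by (apply Rpower_lim; auto).
destruct (velocity_cvg K HKw Y HY HY0 HSd Hbl)
  as [Hv1 Hv2]; fold n in Hv1, Hv2.
assert (Hdoms : forall t, 0 <= t -> dom S (u t) /\ dom S (du t) /\ dom A (u t)).
{ apply solution_in_domains. }
split; [exists (scal kap Y); repeat split|].
- intros E. generalize (f_equal (fun x => ip x Y) E); rewrite ip_scal_l, ip_zero_l, ip_norm.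
  intros E0; assert (0 < kap * norm Y ^ 2) by (apply Rmult_lt_0_compat; auto). lra.
- apply (in_eigenspace_of_coordinates H e (proj1 he)); intros k Hk.
  rewrite ip_scal_l, (HY0 k Hk); ring.
- apply dom_scal; auto.
- apply (cvg_infty_in_intro H A _ (fun t => scal (Rpower (phi t) (1 / (2 * gamma))) (scal (W t) (A (u t))))).
  + apply dom_scal; auto.
  + intros t Ht; rewrite op_scal, (HPhi1 t Ht) by (apply Hdoms; auto).
    apply ip_ext; intros w; rewrite !ip_scal_l; ring.
  + apply (filterlim_ext_loc (F := Rbar_locally p_infty)
      (fun t => scal (Rpower (phi t) (1 / (2 * gamma))) (scal (W t) (u t)))).
    { exists 0; intros t Ht; rewrite (HPhi1 t) by lra. apply ip_ext; intros w; rewrite !ip_scal_l; ring. }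
    apply filterlim_scal_fun; auto.
  + rewrite op_scal by auto. apply filterlim_scal_fun; auto.
- apply dom_scal, dom_scal; auto.
- assert (Esw : scal (- (1 / (2 * gamma))) (scal kap Y) = scal kap (scal (- (1 / (2 * gamma))) Y)).
  { apply ip_ext; intros w; rewrite !ip_scal_l; ring. }
  rewrite Esw.
  apply (cvg_infty_in_intro H S _ (fun t => scal (Rpower (phi t) (1 / (2 * gamma))) (scal ((1 + t) * W t) (S (du t))))).
  + apply dom_scal, dom_scal; auto.
  + intros t Ht; rewrite op_scal, op_scal, (HPhi1 t Ht) by (try apply dom_scal; apply Hdoms; auto).
    apply ip_ext; intros w; rewrite !ip_scal_l; ring.
  + apply (filterlim_ext_loc (F := Rbar_locally p_infty)
      (fun t => scal (Rpower (phi t) (1 / (2 * gamma))) (scal ((1 + t) * W t) (du t)))).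
    { exists 0; intros t Ht; rewrite (HPhi1 t) by lra. apply ip_ext; intros w; rewrite !ip_scal_l; ring. }
    apply filterlim_scal_fun; auto.
  + rewrite op_scal by (apply dom_scal; auto). apply filterlim_scal_fun; auto.
- split; [|split; [|split]].
  + exists (/ (1 + 2 * n * gamma * Rpower Cu gamma)), K; repeat split; auto.
    * apply Rinv_0_lt_compat. assert (0 < 2 * n * gamma * Rpower Cu gamma); [|lra].
      apply Rmult_lt_0_compat; auto; apply Rpower_pos.
    * apply weight_bound_below; auto.
    * rewrite (proj2 (weight_inverse t H0)). unfold Rdiv; apply Rmult_le_compat_r; auto.
      left; apply Rinv_0_lt_compat; lra.
  + apply is_lim_ext_nonneg with (2 := Hbl); intros t Ht; rewrite hbE; auto.
  + apply (is_lim_ext_nonneg (fun t => Rpower (phi t) (1 / gamma) *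
        norm (scal (W t) (component e lam nu (u t))) ^ 2)).
    { intros t Ht; rewrite norm_scal_sq, (HPhi2 t Ht); ring. }
    replace (1 / (nu ^ 2 * Rpower (2 * nu ^ 2 * gamma) (1 / gamma)))
      with (Rpower L (1 / gamma) * norm Y ^ 2).
    * apply (is_lim_mult _ _ p_infty (Rpower L (1 / gamma)) (norm Y ^ 2)); simpl; auto.
      -- apply Rpower_lim; auto.
      -- apply norm_sq_lim; auto.
    * assert (EL : Rpower L (1 / gamma) = / (Rpower (2 * n * gamma) (1 / gamma) * r)).
      { assert (EI : forall x, 0 < x -> 1 / x = Rpower x (- (1))).
        { intros x Hx; rewrite Rpower_Ropp, Rpower_1 by auto; unfold Rdiv; ring. }
        unfold L; rewrite EI by (apply Rmult_lt_0_compat; auto; apply Rpower_pos).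
        rewrite Rpower_mult. replace (- (1) * (1 / gamma)) with (- (1 / gamma)) by ring.
        rewrite Rpower_Ropp; f_equal.
        rewrite <- Rpower_mult_distr by (auto; apply Rpower_pos). f_equal.
        rewrite Rpower_mult. replace (gamma * (1 / gamma)) with 1 by (field; lra).
        apply Rpower_1; auto. }
      rewrite EL; fold n; unfold r; field.
      generalize (Rpower_pos (2 * n * gamma) (1 / gamma)); intros.
      assert (norm Y <> 0) by (intros h; rewrite h in HYp; simpl in HYp; lra).
      repeat split; auto; apply Rgt_not_eq; auto.
  + destruct (acceleration_bound K HKw) as [C [HC HCb]].
    exists (C * Rpower K (1 / gamma)); intros t Ht.
    generalize (HCb t Ht); fold n; fold (W t); intros Hc.
    assert (HW : 0 < W t ^ 2) by (apply pow_lt, exp_pos).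
    assert (Ht4 : 0 < (1 + t) ^ 4) by (apply pow_lt; lra).
    assert (Hrp : 0 < Rpower (1 + t) (1 / gamma)) by apply Rpower_pos.
    assert (E4 : Rpower (1 + t) (4 + 1 / gamma) = (1 + t) ^ 4 * Rpower (1 + t) (1 / gamma)).
    { rewrite Rpower_plus; f_equal. replace 4 with (INR 4) by (simpl; ring). apply Rpower_pow; lra. }
    rewrite E4.
    apply (Rmult_le_reg_l ((1 + t) ^ 4 * Rpower (1 + t) (1 / gamma))); [apply Rmult_lt_0_compat; auto|].
    replace ((1 + t) ^ 4 * Rpower (1 + t) (1 / gamma) *
      (C * Rpower K (1 / gamma) * (1 / ((1 + t) ^ 4 * Rpower (1 + t) (1 / gamma)))))
      with (C * Rpower K (1 / gamma)) by (field; split; apply Rgt_not_eq; auto; lra).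
    rewrite (HPhi2 t Ht).
    replace ((1 + t) ^ 4 * (Rpower (phi t) (1 / gamma) * W t ^ 2) * norm (ddu t) ^ 2)
      with (((1 + t) ^ 2 * W t) ^ 2 * norm (ddu t) ^ 2 * Rpower (phi t) (1 / gamma)) by ring.
    apply Rmult_le_compat; auto.
    * apply Rmult_le_pos; apply pow2_ge_0.
    * left; apply Rpower_pos.
    * apply Rle_Rpower_l; [|split; auto].
      left; apply Rdiv_lt_0_compat; lra.
Qed.

Lemma persistent_coordinate k q :
  lam k = nu -> ip u0 (e k) <> 0 ->
  q = Rabs (ip u0 (e k))
      + 2 * (Rabs (ip u1 (e k)) + 3 * high_rate n gamma * c2 * Rabs (ip u0 (e k))) ->
  56 * fast_slow_rate c2 c3 (3 * high_rate n gamma) * q * eps <= Rabs (ip u0 (e k)) ->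
  8 * q * eps <= Rabs (ip u0 (e k)) -> 192 * q ^ 2 * eps <= ip u0 (e k) ^ 2 ->
  forall t, 0 <= t -> Rabs (ip u0 (e k)) / 2 <= Rabs (W t * ip (u t) (e k)).
Proof.
intros Hk Ha0 Hq H1 H2 H3 t Ht; destruct hsmall as (Hse & _ & _ & Hec).
generalize (coordinate_mode k); rewrite Hk; fold n; intros Hmode.
destruct (mode_data k) as [E0 E1].
generalize (low_mode_persists _ _ _ _ _ _ hc1 hc2 hc3 hb eps (3 * high_rate n gamma) n _ _ _ Hse
   lowest_is_low Hec Hmode q).
rewrite E0, E1, <- (extend_nonneg (fun t => ip (u t) (e k)) (fun t => ip (du t) (e k)) t Ht).
intros HP; apply HP; auto; lra.
Qed.

Lemma kicked_coordinate k (l : R) :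
  lam k = nu -> ip u0 (e k) = 0 -> ip u1 (e k) <> 0 ->
  392 * fast_slow_rate c2 c3 (3 * high_rate n gamma) ^ 2 * eps <= 1 ->
  is_lim (fun t => W t * ip (u t) (e k)) p_infty l -> l <> 0.
Proof.
intros Hk Ha0 Ha1 H1 Hl; destruct hsmall as (Hse & _ & _ & Hec).
generalize (coordinate_mode k); rewrite Hk; fold n; intros Hmode.
destruct (mode_data k) as [E0 E1].
destruct (low_mode_cvg _ _ _ _ _ _ hc1 hc2 hc3 hb eps (3 * high_rate n gamma) n _ _ _ Hse
   lowest_is_low Hec Hmode) as [l' [HX HY]].
assert (El : l' = l).
{ assert (E : Finite l' = Finite l); [|injection E; auto].
  rewrite <- (is_lim_unique _ _ _ HY), <- (is_lim_unique _ _ _ Hl).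
  apply Lim_ext_loc; exists 0; intros t Ht; rewrite extend_nonneg by lra; auto. }
rewrite <- El. apply (limit_bounded_away _ (eps * Rabs (ip u1 (e k)) / 2)) with (3 := HX).
- assert (0 < eps * Rabs (ip u1 (e k))); [|lra].
  apply Rmult_lt_0_compat; [lra|apply Rabs_pos_lt; auto].
- rewrite <- E1; apply (low_mode_kicked _ _ _ _ _ _ hc1 hc2 hc3 hb eps (3 * high_rate n gamma) n _ _ _ Hse
   lowest_is_low Hec Hmode); auto; rewrite E0; auto.
Qed.

End Profile.

(** * Smallness of the parameter and conclusion *)

Lemma small_multiple (a c : R) : 0 < c ->
  exists e, 0 < e /\ forall eps, 0 < eps <= e -> a * eps <= c.
Proof.
intros Hc; exists (c / (Rabs a + 1)); generalize (Rabs_pos a); intros Ha; split.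
- apply Rdiv_lt_0_compat; lra.
- intros eps [He0 He].
  apply Rle_trans with ((Rabs a + 1) * eps).
  + generalize (Rle_abs a); intros; nra.
  + apply Rle_trans with ((Rabs a + 1) * (c / (Rabs a + 1))); [apply Rmult_le_compat_l; lra|].
    right; field; lra.
Qed.

Lemma small_both (P Q : R -> Prop) :
  (exists e, 0 < e /\ forall eps, 0 < eps <= e -> P eps) ->
  (exists e, 0 < e /\ forall eps, 0 < eps <= e -> Q eps) ->
  exists e, 0 < e /\ forall eps, 0 < eps <= e -> P eps /\ Q eps.
Proof.
intros [e1 [H1 HP]] [e2 [H2 HQ]]; exists (Rmin e1 e2); split; [apply Rmin_glb_lt; auto|].
intros eps Heps; generalize (Rmin_l e1 e2) (Rmin_r e1 e2); intros.
split; [apply HP|apply HQ]; lra.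
Qed.

Lemma small_eps_eventually (n gamma c2 c3 : R) :
  exists e, 0 < e /\ forall eps, 0 < eps <= e -> small_eps n gamma c2 c3 eps.
Proof.
destruct (small_both _ _ (small_multiple 8 1 Rlt_0_1)
  (small_both _ _ (small_multiple (2 * c3) 1 Rlt_0_1)
  (small_both _ _ (small_multiple (8 * high_rate n gamma * c2) 1 Rlt_0_1)
     (small_multiple (8 * fast_slow_rate c2 c3 (3 * high_rate n gamma)) 1 Rlt_0_1))))
  as [e [He Hs]].
exists e; split; auto; intros eps Heps; destruct (Hs eps Heps) as (H1 & H2 & H3 & H4).
unfold small_eps; repeat split; lra.
Qed.

(** The solutions agree by uniqueness, hence so do their derivatives, including
    the one-sided one at 0. *)
Lemma well_posed_decay (H : RealHilbert) (A S : operator H) (gamma eps1 K1 K2 : R) (u0 u1 : H) :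
  well_posed_with_decay A S gamma u0 u1 eps1 K1 K2 ->
  forall eps u du ddu, 0 < eps <= eps1 ->
    is_global_solution A S gamma u0 u1 eps u du ddu -> decay_estimates A S gamma K1 K2 u du.
Proof.
intros (_ & _ & _ & Hwp) eps u du ddu Heps Hsol.
destruct (Hwp eps Heps) as (v & dv & ddv & Hv & Hdec & Huniq).
assert (Eu : forall t, 0 <= t -> u t = v t) by (apply (Huniq u du ddu); auto).
assert (Edu : forall t, 0 <= t -> du t = dv t).
{ apply (derive_nonneg_unique H u v); auto; [apply (sol_derive1 Hsol)|apply (sol_derive1 Hv)]. }
intros t Ht; rewrite (Eu t Ht), (Edu t Ht); apply Hdec; auto.
Qed.

Theorem theorem2p3
  (H : RealHilbert) (A Ah : operator H) (e : nat -> H) (lam : nat -> R)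
  (hA : self_adjoint A) (hcoer : coercive A) (hS : is_sqrt A Ah)
  (he : eigenbasis A e lam)
  (gamma : R) (hgamma : 0 < gamma)
  (u0 u1 : H) (hu0 : dom A u0) (hu1 : dom Ah u1) (hu0nz : u0 <> zero)
  (nu : R) (hnu : is_lowest_frequency e lam u0 u1 nu)
  (eps1 K1 K2 : R) (hknown : well_posed_with_decay A Ah gamma u0 u1 eps1 K1 K2) :
  exists eps0 : R, 0 < eps0 <= eps1 /\
    (forall (eps : R) (u du ddu : R -> H), 0 < eps <= eps0 ->
      is_global_solution A Ah gamma u0 u1 eps u du ddu ->
      (exists uinf : H, uinf <> zero /\ in_eigenspace e lam nu uinf /\
        cvg_infty_in A
          (fun t => scal (Rpower (1 + t) (1 / (2 * gamma))) (u t)) uinf /\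
        cvg_infty_in Ah
          (fun t => scal (Rpower (1 + t) (1 / (2 * gamma)))
                         (scal (1 + t) (du t)))
          (scal (- (1 / (2 * gamma))) uinf)) /\
      (exists Ke1 Ke2 : R, 0 < Ke1 /\ 0 < Ke2 /\
        forall t, 0 <= t ->
          Ke1 / (1 + t) <= exp (- 2 * nu ^ 2 * gamma * B Ah gamma u t)
            <= Ke2 / (1 + t)) /\
      is_lim (fun t => (1 + t) * b Ah gamma u t) p_infty
             (1 / (2 * nu ^ 2 * gamma)) /\
      is_lim (fun t => Rpower (1 + t) (1 / gamma)
                       * norm (component e lam nu (u t)) ^ 2) p_infty
             (1 / (nu ^ 2 * Rpower (2 * nu ^ 2 * gamma) (1 / gamma))) /\
      (exists Ke : R, forall t, 0 <= t ->
        norm (ddu t) ^ 2 <= Ke * (1 / Rpower (1 + t) (4 + 1 / gamma)))) /\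
    (component e lam nu u0 <> zero ->
      exists Ku1 Ku2 : R, 0 < Ku1 /\ 0 < Ku2 /\
        forall (eps : R) (u du ddu : R -> H), 0 < eps <= eps0 ->
          is_global_solution A Ah gamma u0 u1 eps u du ddu ->
          forall t, 0 <= t ->
            Ku1 / (1 + t) <= exp (- 2 * nu ^ 2 * gamma * B Ah gamma u t)
              <= Ku2 / (1 + t)).
Proof.
generalize (well_posed_decay H A Ah gamma eps1 K1 K2 u0 u1 hknown); intros Hdec.
destruct hknown as ((heps1 & heps1') & hK1 & hK2 & _).
pose (c1 := Rpower K1 gamma); pose (c2 := Rpower K2 gamma); pose (c3 := 2 * gamma * K2 / K1).
assert (hc1 : 0 < c1) by apply Rpower_pos.
assert (hc2 : 0 < c2) by apply Rpower_pos.
assert (hc3 : 0 < c3).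
{ apply Rdiv_lt_0_compat; auto; apply Rmult_lt_0_compat; lra. }
assert (hcoef : forall eps u du ddu, 0 < eps <= eps1 ->
   is_global_solution A Ah gamma u0 u1 eps u du ddu ->
   (forall t, 0 <= t -> 0 < norm (Ah (u t)) ^ 2) /\
   exists b' db B', slow_coefficient c1 c2 c3 b' db B' /\
    (forall t, 0 <= t -> b' t = b Ah gamma u t) /\
    (forall t, 0 <= t -> B' t = B Ah gamma u t)).
{ intros eps u du ddu Heps Hsol; generalize (Hdec eps u du ddu Heps Hsol); intros Hd; split.
  { apply (sqrt_norm_pos H A Ah gamma K1 K2 u du hK1 Hd). }
  destruct (solution_coefficient H A Ah hS gamma eps K1 K2 u0 u1 u du ddu) as (b' & db & B' & Hsc & E);
    auto.
  exists b', db, B'; split; [exact Hsc|split; apply E]. }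
pose (n := nu ^ 2); pose (L := 3 * high_rate n gamma); pose (c := fast_slow_rate c2 c3 L).
(* If no coordinate at nu has a non-zero position, then u_{0,nu} = 0 and
   some coordinate at nu has a non-zero velocity. *)
destruct (classic (exists k, lam k = nu /\ ip u0 (e k) <> 0)) as [[k [Hk Ha0]]|Hno].
- assert (Ha0p : 0 < Rabs (ip u0 (e k))) by (apply Rabs_pos_lt; auto).
  pose (q := Rabs (ip u0 (e k)) + 2 * (Rabs (ip u1 (e k)) + L * c2 * Rabs (ip u0 (e k)))).
  destruct (small_both _ _ (small_eps_eventually n gamma c2 c3)
    (small_both _ _ (small_multiple (56 * c * q) _ Ha0p)
    (small_both _ _ (small_multiple (8 * q) _ Ha0p)
       (small_multiple (192 * q ^ 2) (ip u0 (e k) ^ 2)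
          ltac:(rewrite <- pow2_abs; apply pow_lt; auto)))))
    as [es [Hes Hs]].
  exists (Rmin eps1 es).
  assert (Heps0 : 0 < Rmin eps1 es) by (apply Rmin_glb_lt; auto).
  generalize (Rmin_l eps1 es) (Rmin_r eps1 es); intros Hl1 Hl2.
  assert (Hlow : forall eps u du ddu b' db B', 0 < eps <= Rmin eps1 es ->
     is_global_solution A Ah gamma u0 u1 eps u du ddu ->
     slow_coefficient c1 c2 c3 b' db B' -> (forall t, 0 <= t -> b' t = b Ah gamma u t) ->
     forall t, 0 <= t ->
     Rabs (ip u0 (e k)) / 2 <= Rabs (exp (n * B' t) * ip (u t) (e k))).
  { intros eps u du ddu b' db B' Heps Hsol Hsc Hb.
    destruct (Hs eps ltac:(lra)) as (Hse & Hq1 & Hq2 & Hq3).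
    apply (persistent_coordinate H A Ah e lam hA he gamma nu eps u0 u1 u du ddu
      hgamma hnu Hsol c1 c2 c3 b' db B' hc1 hc2 hc3 Hsc Hb Hse k q); auto. }
  split; [lra|split].
  + intros eps u du ddu Heps Hsol.
    destruct (hcoef eps u du ddu ltac:(lra) Hsol) as (Hpos & b' & db & B' & Hsc & Hb & HB).
    destruct (Hs eps ltac:(lra)) as (Hse & _).
    apply (solution_asymptotics H A Ah e lam hA hS he gamma nu eps u0 u1 u du ddu
      hgamma hu0 hu1 hnu Hsol c1 c2 c3 b' db B' hc1 hc2 hc3 Hsc Hb HB Hse Hpos k).
    intros l Hl. apply (limit_bounded_away _ (Rabs (ip u0 (e k)) / 2) l) with (3 := Hl); [lra|].
    apply (Hlow eps u du ddu b' db B'); auto.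
  + intros _.
    exists (/ (1 + 2 * n * gamma * Rpower (energy_bound n gamma c1 c2 * (norm u1 ^ 2 + norm (Ah u0) ^ 2)) gamma)),
      (/ Rmin 1 (2 * n * gamma * Rpower (n * (Rabs (ip u0 (e k)) / 2) ^ 2) gamma)).
    assert (hn : 0 < n) by (apply pow_lt, (lowest_frequency_pos H A e lam he nu u0 u1 hnu)).
    assert (hng : 0 < 2 * n * gamma) by (apply Rmult_lt_0_compat; lra).
    split; [|split].
    * apply Rinv_0_lt_compat. match goal with |- 0 < 1 + ?x => assert (0 < x); [|lra] end.
      apply Rmult_lt_0_compat; [auto|apply Rpower_pos].
    * apply Rinv_0_lt_compat, Rmin_glb_lt; [lra|]. apply Rmult_lt_0_compat; [auto|apply Rpower_pos].
    * intros eps u du ddu Heps Hsol t Ht.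
      destruct (hcoef eps u du ddu ltac:(lra) Hsol) as (Hpos & b' & db & B' & Hsc & Hb & HB).
      destruct (Hs eps ltac:(lra)) as (Hse & _).
      split.
      -- apply (weight_bound_below H A Ah e lam hA hS he gamma nu eps u0 u1 u du ddu
           hgamma hu0 hnu Hsol c1 c2 c3 b' db B' hc1 hc2 hc3 Hsc Hb HB Hse Hpos t Ht).
      -- apply (weight_bound_above H A Ah e lam hS he gamma nu eps u0 u1 u du ddu
           hgamma hnu Hsol c1 c2 c3 b' db B' Hsc Hb HB Hpos k); auto; [lra|].
         apply (Hlow eps u du ddu b' db B'); auto.
- assert (Hex : exists k, lam k = nu /\ ip u0 (e k) = 0 /\ ip u1 (e k) <> 0).
  { destruct hnu as [[k [Hk Ek]] _]; exists k; repeat split; auto.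
    - destruct (Req_dec (ip u0 (e k)) 0); auto; elim Hno; eauto.
    - destruct Hk as [Hk|Hk]; auto; elim Hno; eauto. }
  destruct Hex as (k & Hk & Ha0 & Ha1).
  destruct (small_both _ _ (small_eps_eventually n gamma c2 c3)
       (small_multiple (392 * c ^ 2) 1 Rlt_0_1)) as [es [Hes Hs]].
  exists (Rmin eps1 es).
  assert (Heps0 : 0 < Rmin eps1 es) by (apply Rmin_glb_lt; auto).
  generalize (Rmin_l eps1 es) (Rmin_r eps1 es); intros Hl1 Hl2.
  split; [lra|split].
  + intros eps u du ddu Heps Hsol.
    destruct (hcoef eps u du ddu ltac:(lra) Hsol) as (Hpos & b' & db & B' & Hsc & Hb & HB).
    destruct (Hs eps ltac:(lra)) as (Hse & Hc).
    apply (solution_asymptotics H A Ah e lam hA hS he gamma nu eps u0 u1 u du ddu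
      hgamma hu0 hu1 hnu Hsol c1 c2 c3 b' db B' hc1 hc2 hc3 Hsc Hb HB Hse Hpos k).
    intros l Hl; apply (kicked_coordinate H A Ah e lam hA he gamma nu eps u0 u1 u du ddu
      hgamma hnu Hsol c1 c2 c3 b' db B' hc1 hc2 hc3 Hsc Hb Hse k l); auto.
  + intros Hcomp; elim Hcomp. apply (component_eq0 H e (proj1 he)); intros k' Hk'.
    destruct (Req_dec (ip u0 (e k')) 0); auto; elim Hno; eauto.
Qed.
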